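(* Let $I$ be an inner function such that $I(0)=0$ and let $b=\frac{I(1+I^2)}{2}$. Then the following orthogonal decomposition of the de Branges-Rovnyak space $\mathcal{H}(b)$ holds: $$\mathcal{H}(b)=(1-I^2)H^2\oplus_b(2-I)(1-I)K_I\oplus_b(2+I+I^2)K_I .$$
   Context: $\mathbb{D}$ is the open unit disk, $\mathbb{T}=\partial\mathbb{D}$, and $H^2$ is the Hardy space on $\mathbb{D}$ with norm $\|\cdot\|$, identified via boundary values with a closed subspace of $L^2(\mathbb{T})$. For $\varphi\in L^\infty(\mathbb{T})$ the Toeplitz operator on $H^2$ is $T_\varphi f=P(\varphi f)$, where $P$ is the orthogonal projection of $L^2(\mathbb{T})$ onto $H^2$. For $b$ in the closed unit ball of $H^\infty$, the de Branges-Rovnyak space $\mathcal{H}(b)$ is the image of $H^2$ under $(1-T_bT_{\overline b})^{1/2}$, with the range norm defined by $\|(1-T_bT_{\overline b})^{1/2}f\|_b=\|f\|$ for $f\in(\ker(1-T_bT_{\overline b})^{1/2})^\perp$; it is a Hilbert space. For an inner function $I$, $K_I=H^2\ominus IH^2$ is the model space. For a function $g$ and a set $X$ of functions, $gX=\{gh: h\in X\}$. The symbol $\oplus_b$ denotes the orthogonal direct sum in the Hilbert space $\mathcal{H}(b)$. *)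

(* Defs.v *)
From HB Require Import structures.
From mathcomp Require Import all_boot all_order all_algebra.
From mathcomp Require Export complex.
From mathcomp Require Import all_classical all_reals all_analysis.

Set Implicit Arguments.
Unset Strict Implicit.
Unset Printing Implicit Defensive.

Import Order.TTheory GRing.Theory Num.Theory.
Import numFieldNormedType.Exports.

Local Open Scope classical_set_scope.
Local Open Scope ring_scope.
Local Open Scope complex_scope.

(** Functions on the unit disk live on a subtype, so that equality of two such
    functions is Leibniz equality, and sums, products and scalings of functions
    are those of the pointwise algebra [disk R -> R[i]]. *)

Definition disk (R : realType) : Type := {z : R[i] | `|z| < 1}.

Lemma disk0_subproof (R : realType) : `|0 : R[i]| < 1.
Proof. by rewrite normr0 ltr01. Qed.

Definition disk0 (R : realType) : disk R := exist _ 0 (disk0_subproof R).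

Section L2_circle.
Variable R : realType.
Local Notation C := R[i].
Local Notation mu := (@lebesgue_measure R).

(** A function on the unit circle is given by the angle: [u t] stands for its
    value at [expi t]; the arc length measure is normalized to total mass 1. *)

Definition angles : set R := `[0, 2 * pi].

Definition expi (t : R) : C := cos t +i* sin t.

Definition sqmod (z : C) : R := complex.Re z ^+ 2 + complex.Im z ^+ 2.

Definition circle_mean (u : R -> C) : C :=
  ((2 * pi)^-1)%:C *
  ((\int[mu]_(t in angles) complex.Re (u t))%R +i*
   (\int[mu]_(t in angles) complex.Im (u t))%R).

Definition L2 : set (R -> C) := [set u |
  [/\ measurable_fun angles (fun t => complex.Re (u t)),
      measurable_fun angles (fun t => complex.Im (u t)) &
      (\int[mu]_(t in angles) (sqmod (u t))%:E < +oo)%E]].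

Definition L2_dot (u v : R -> C) : C := circle_mean (fun t => u t * (v t)^*).

End L2_circle.

Section Hardy.
Variable R : realType.
Local Notation C := R[i].
Local Notation mu := (@lebesgue_measure R).
Implicit Types f g h : disk R -> C.

(** [C^o] is [C] with the topology of its own absolute value. *)
Definition taylor f (a : nat -> C) : Prop :=
  forall z : disk R, series (fun n => a n * sval z ^+ n : C^o) @ \oo --> (f z : C^o).

Definition H2 : set (disk R -> C) := [set f | exists a : nat -> C,
  taylor f a /\ (\sum_(0 <= n <oo) (sqmod (a n))%:E < +oo)%E].

Definition Hinf : set (disk R -> C) := [set f |
  (exists a : nat -> C, taylor f a) /\
  (exists M : C, forall z : disk R, `|f z| <= M)].

(** [dilate f r t] is f(r e^{it}), for |r| < 1; the value 0 given otherwise is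
    never used. *)
Definition dilate f (r t : R) : C := oapp f 0 (insub (r%:C * expi t)).

(** The boundary function of f in H^2 is the limit in L^2 of the functions
    f(r e^{it}) as r increases to 1; it is unique up to a null set, and every
    notion below only depends on its class modulo null sets. *)
Definition boundary f : R -> C := xget (cst 0) [set u | L2 u /\
  (\int[mu]_(t in @angles R) (sqmod (dilate f r t - u t))%:E)%E
    @[r --> 1^'-] --> 0%E].

Definition H2_dot f g : C := L2_dot (boundary f) (boundary g).

Definition H2_norm f : R := Num.sqrt (complex.Re (H2_dot f f)).

Definition inner_function : set (disk R -> C) := [set f | Hinf f /\
  {ae mu, forall t, angles t -> `|boundary f t| = 1}].

(** Orthogonal projection of L^2 onto H^2. *)
Definition riesz_proj (u : R -> C) : disk R -> C := xget 0 [set h | H2 h /\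
  forall g, H2 g -> L2_dot (fun t => u t - boundary h t) (boundary g) = 0].

Definition toeplitz (phi : R -> C) f : disk R -> C :=
  riesz_proj (fun t => phi t * boundary f t).

Definition model_space f : set (disk R -> C) := [set h | H2 h /\
  forall g, H2 g -> H2_dot h (f * g) = 0].

(** Operators on H^2 are functions on [disk R -> C] whose values outside H^2
    are irrelevant. *)
Definition bounded_operator (S : (disk R -> C) -> disk R -> C) : Prop :=
  [/\ forall f, H2 f -> H2 (S f),
      forall (a : C) f g, H2 f -> H2 g -> S (a *: f + g) = a *: S f + S g &
      exists M : R, forall f, H2 f -> H2_norm (S f) <= M * H2_norm f].

Definition positive_operator (S : (disk R -> C) -> disk R -> C) : Prop :=
  [/\ bounded_operator S,
      forall f g, H2 f -> H2 g -> H2_dot (S f) g = H2_dot f (S g) &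
      forall f, H2 f -> 0 <= H2_dot (S f) f].

(** The positive square root of an operator T on H^2; it is unique on H^2. *)
Definition op_sqrt (T : (disk R -> C) -> disk R -> C) :
  (disk R -> C) -> disk R -> C :=
  xget (fun f => f : disk R -> C) [set S | positive_operator S /\ forall f, H2 f -> S (S f) = T f].

Definition defect (b : disk R -> C) : (disk R -> C) -> disk R -> C :=
  op_sqrt (fun f =>
    f - toeplitz (boundary b) (toeplitz (fun t => (boundary b t)^*) f)).

Definition dBR_space (b : disk R -> C) : set (disk R -> C) :=
  [set defect b f | f in H2].

(** The f orthogonal to the kernel of [defect b] with [defect b f = u]. *)
Definition dBR_lift (b u : disk R -> C) : disk R -> C := xget 0 [set f |
  [/\ H2 f, forall g, H2 g -> defect b g = 0 -> H2_dot f g = 0 &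
      defect b f = u]].

(** The inner product of the range norm, whose square is [dBR_dot b u u]. *)
Definition dBR_dot (b u v : disk R -> C) : C :=
  H2_dot (dBR_lift b u) (dBR_lift b v).

End Hardy.

Definition mulset (A : pzRingType) (g : A) (X : set A) : set A :=
  [set g * h | h in X].

(** [H] is the direct sum of [X], [Y], [Z], orthogonal for [dot]. *)
Definition orthogonal_sum3 (K : pzRingType) (V : zmodType) (dot : V -> V -> K)
    (H X Y Z : set V) : Prop :=
  [/\ [/\ X `<=` H, Y `<=` H & Z `<=` H],
      H = [set w | exists x y z, [/\ X x, Y y, Z z & w = x + y + z]] &
      [/\ forall x y, X x -> Y y -> dot x y = 0,
          forall x z, X x -> Z z -> dot x z = 0 &
          forall y z, Y y -> Z z -> dot y z = 0]].

(* Main.v *)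
From HB Require Import structures.
Require Import Defs.
From mathcomp Require Import all_boot all_order all_algebra.
From mathcomp Require Import complex ring lra.
From mathcomp Require Import all_classical all_reals all_analysis measurable_realfun.
Import Order.TTheory GRing.Theory Num.Theory.
Import numFieldNormedType.Exports.
Local Open Scope ring_scope.

Set Implicit Arguments.
Unset Strict Implicit.
Unset Printing Implicit Defensive.

(** Let [V = T_I], an isometry of [H^2], and let [P = 1 - V V^*] be the projection
    onto [K_I].  Then [T_b = (V + V^3) / 2], and [A = 1 - T_b T_b^*] equals
    [1/4 (1 - V^2) (1 + P / 3) (1 - V^2)^*
     + 1/24 ((2 - V) (1 - V)) P ((2 - V) (1 - V))^*
     + 1/8 (2 + V + V^2) P (2 + V + V^2)^*].
    Hence [A = D D^*], where [D] maps [H^2 (+) H^2 (+) H^2] to [H^2].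
    By polar decomposition [D] and [A^(1/2)] have the same range and
    induce the same range norm, so [H(b)] is the sum of the ranges of the three
    components of [D]; these are mutually orthogonal because [ker D] is the product
    of the kernels of the components. *)

(** * Inner product spaces *)

(** The identity for [A] is found as follows. With [x], [y] for [V], [V^*], the polynomial
    [4 - x y (1 + x^2) (1 + y^2)] equals [(1 - x^2) (1 - y^2)] when [x y = 1], which accounts for
    the first summand; the difference is [1 - x y] times [3 + 2 x y + x^2 + y^2 + x^2 y^2]. As a
    Hermitian form in [1, x, x^2] this factor has rank 3, one too many for two copies of [K_I],
    while [(1 - V^2) K_I] already lies in the first summand. Subtracting [(1 - x^2) (1 - y^2) / 3]
    is exactly what lowers the rank to 2, whence the term [P / 3]. What is left is
    [2/3 (2 + x^2) (2 + y^2) + 2 x y], and [(2 + x^2) - 3 x] and [(2 + x^2) + x] give another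
    diagonal form of it: these are [(2 - x) (1 - x)] and [2 + x + x^2]. The rank drop makes the sum
    direct, and hence the kernel of [D] a product. The complement of a product of kernels is the
    product of the complements, so a vector of one summand has its minimal preimage in one
    component, and vectors of different summands have orthogonal preimages. *)

Section Sqmod.
Variable R : realType.
Implicit Types z w : R[i].

Lemma conjCE z : z^* = (complex.Re z -i* complex.Im z)%C.
Proof. by case: z. Qed.

Lemma cReD z w : complex.Re (z + w) = complex.Re z + complex.Re w.
Proof. by case: z; case: w. Qed.

Lemma cImD z w : complex.Im (z + w) = complex.Im z + complex.Im w.
Proof. by case: z; case: w. Qed.

Lemma cReM z w : complex.Re (z * w) =
  complex.Re z * complex.Re w - complex.Im z * complex.Im w.
Proof. by case: z; case: w. Qed.

Lemma cImM z w : complex.Im (z * w) =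
  complex.Re z * complex.Im w + complex.Im z * complex.Re w.
Proof. by case: z; case: w. Qed.

Lemma cReN z : complex.Re (- z) = - complex.Re z.
Proof. by case: z. Qed.

Lemma cImN z : complex.Im (- z) = - complex.Im z.
Proof. by case: z. Qed.

Lemma cReJ z : complex.Re z^* = complex.Re z.
Proof. by case: z. Qed.

Lemma cImJ z : complex.Im z^* = - complex.Im z.
Proof. by case: z. Qed.

Definition complexDE := (cReD, cImD, cReM, cImM, cReN, cImN, cReJ, cImJ).

Lemma sqmod_ge0 z : 0 <= sqmod z.
Proof. by rewrite /sqmod addr_ge0 ?sqr_ge0. Qed.

Lemma sqmod_eq0 z : sqmod z = 0 -> z = 0.
Proof.
case: z => a b; rewrite /sqmod /= => h.
have /eqP := h; rewrite paddr_eq0 ?sqr_ge0// !sqrf_eq0.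
by move=> /andP[/eqP -> /eqP ->].
Qed.

Lemma sqmod0 : sqmod (0 : R[i]) = 0.
Proof. by rewrite /sqmod /= expr0n /= addr0. Qed.

Lemma sqmodC z : (sqmod z)%:C%C = z * z^*.
Proof. by case: z => a b; apply/eqP; rewrite eq_complex /sqmod /=; apply/andP; split; apply/eqP; ring. Qed.

Lemma sqmod_norm z : (sqmod z)%:C%C = `|z| ^+ 2.
Proof. by rewrite sqmodC normCK. Qed.

Lemma sqmodM z w : sqmod (z * w) = sqmod z * sqmod w.
Proof. by rewrite /sqmod !complexDE; ring. Qed.

Lemma sqmodJ z : sqmod z^* = sqmod z.
Proof. by rewrite /sqmod !complexDE sqrrN. Qed.

Lemma sqmodN z : sqmod (- z) = sqmod z.
Proof. by rewrite /sqmod !complexDE !sqrrN. Qed.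

Lemma sqmodX z n : sqmod (z ^+ n) = sqmod z ^+ n.
Proof.
elim: n => [|n ih]; last by rewrite !exprS sqmodM ih.
by rewrite !expr0 /sqmod /= expr1n expr0n /= addr0.
Qed.

Lemma sqmod_real (x : R) : sqmod x%:C%C = x ^+ 2.
Proof. by rewrite /sqmod /= expr0n /= addr0. Qed.

Lemma sqmodD_le z w : sqmod (z + w) <= 2 * (sqmod z + sqmod w).
Proof.
rewrite /sqmod !complexDE -subr_ge0.
have -> : 2 * (complex.Re z ^+ 2 + complex.Im z ^+ 2 +
    (complex.Re w ^+ 2 + complex.Im w ^+ 2)) -
  ((complex.Re z + complex.Re w) ^+ 2 + (complex.Im z + complex.Im w) ^+ 2) =
  (complex.Re z - complex.Re w) ^+ 2 + (complex.Im z - complex.Im w) ^+ 2.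
  by ring.
by rewrite addr_ge0 ?sqr_ge0.
Qed.

Lemma ge0_complexE z : 0 <= z -> z = (complex.Re z)%:C%C.
Proof. by case: z => a b; rewrite lecE /= => /andP[/eqP-> _]. Qed.

Lemma normReM_le z w : `|complex.Re (z * w)| <= sqmod z + sqmod w /\
  `|complex.Im (z * w)| <= sqmod z + sqmod w.
Proof.
case: z w => a b [c d]; rewrite /sqmod !complexDE /= !ler_norml.
have := (sqr_ge0 (a - c), sqr_ge0 (a + c), sqr_ge0 (b - d), sqr_ge0 (b + d)).
have := (sqr_ge0 (a - d), sqr_ge0 (a + d), sqr_ge0 (b - c), sqr_ge0 (b + c)).
move=> [[[h1 h2] h3] h4] [[[h5 h6] h7] h8].
by split; apply/andP; split; lra.
Qed.

Lemma half_real : (2^-1 : R)%:C%C = 2^-1 :> R[i].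
Proof. by rewrite rmorphV ?unitfE ?pnatr_eq0//= rmorph_nat. Qed.

Lemma half_conj : (2^-1 : R[i])^* = 2^-1.
Proof. by rewrite -half_real conjCE /= oppr0. Qed.

Lemma sqmod_half : sqmod (2^-1 : R[i]) = 4^-1.
Proof. by rewrite -half_real sqmod_real; field. Qed.

End Sqmod.

(** The form is only positive semidefinite, and [definite] is a separate condition: functions on the
    circle are not taken modulo null sets, so limits in L^2 are determined only up to vectors of
    seminorm 0. The Hardy space itself is definite. *)
Record inner (R : realType) (V : lmodType R[i]) (dot : V -> V -> R[i]) : Prop :=
  Inner {
    dotPl : forall a u v w, dot (a *: u + v) w = a * dot u w + dot v w;
    dotJ : forall u v, dot v u = (dot u v)^*;
    dot_ge0 : forall u, 0 <= dot u u }.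

Definition sqn (R : realType) (V : lmodType R[i]) (dot : V -> V -> R[i]) (u : V) : R :=
  complex.Re (dot u u).

Definition nm (R : realType) (V : lmodType R[i]) (dot : V -> V -> R[i]) (u : V) : R :=
  Num.sqrt (sqn dot u).

Definition definite (R : realType) (V : lmodType R[i]) (dot : V -> V -> R[i]) : Prop :=
  forall u, sqn dot u = 0 -> u = 0.

Definition tends (R : realType) (V : lmodType R[i]) (dot : V -> V -> R[i])
    (u : nat -> V) (l : V) : Prop :=
  (sqn dot (u n - l) @[n --> \oo] --> 0)%classic.

Definition cauchy_seq (R : realType) (V : lmodType R[i]) (dot : V -> V -> R[i])
    (u : nat -> V) : Prop :=
  forall e, 0 < e -> exists N, forall m n, (N <= m)%N -> (N <= n)%N ->
    sqn dot (u m - u n) <= e.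

Definition cauchy_complete (R : realType) (V : lmodType R[i]) (dot : V -> V -> R[i]) : Prop :=
  forall u, cauchy_seq dot u -> exists l, tends dot u l.

Section InnerTheory.
Variables (R : realType) (V : lmodType R[i]) (dot : V -> V -> R[i]).
Hypothesis D : inner dot.
Implicit Types (u v w : V) (a : R[i]).
Local Notation sqn := (sqn dot).
Local Notation nm := (nm dot).

Lemma dotDl u v w : dot (u + v) w = dot u w + dot v w.
Proof. by rewrite -[u]scale1r (dotPl D) mul1r scale1r. Qed.

Lemma dot0l w : dot 0 w = 0.
Proof. by apply: (addrI (dot 0 w)); rewrite -dotDl !addr0. Qed.

Lemma dotZl a u w : dot (a *: u) w = a * dot u w.
Proof. by rewrite -[a *: u]addr0 (dotPl D) dot0l addr0. Qed.

Lemma dotNl u w : dot (- u) w = - dot u w.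
Proof. by rewrite -scaleN1r dotZl mulN1r. Qed.

Lemma dotBl u v w : dot (u - v) w = dot u w - dot v w.
Proof. by rewrite dotDl dotNl. Qed.

Lemma dotDr u v w : dot w (u + v) = dot w u + dot w v.
Proof. by rewrite !(dotJ D _ w) dotDl rmorphD. Qed.

Lemma dot0r w : dot w 0 = 0.
Proof. by rewrite (dotJ D) dot0l rmorph0. Qed.

Lemma dotZr a u w : dot w (a *: u) = a^* * dot w u.
Proof. by rewrite !(dotJ D _ w) dotZl rmorphM. Qed.

Lemma dotNr u w : dot w (- u) = - dot w u.
Proof. by rewrite !(dotJ D _ w) dotNl rmorphN. Qed.

Lemma dotBr u v w : dot w (u - v) = dot w u - dot w v.
Proof. by rewrite dotDr dotNr. Qed.

Lemma dot_sqn u : dot u u = (sqn u)%:C%C.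
Proof. exact/ge0_complexE/(dot_ge0 D). Qed.

Lemma sqn_ge0 u : 0 <= sqn u.
Proof. by have := dot_ge0 D u; rewrite dot_sqn ler0c. Qed.

Lemma sqn0 : sqn 0 = 0.
Proof. by rewrite /sqn dot0l. Qed.

Lemma sqnZ a u : sqn (a *: u) = sqmod a * sqn u.
Proof.
apply: (@complexI R); rewrite -dot_sqn dotZl dotZr dot_sqn mulrA -sqmodC.
by rewrite rmorphM.
Qed.

Lemma sqnN u : sqn (- u) = sqn u.
Proof. by rewrite /sqn dotNl dotNr opprK. Qed.

Lemma sqnC u v : sqn (u - v) = sqn (v - u).
Proof. by rewrite -sqnN opprB. Qed.

Lemma sqnD u v : sqn (u + v) = sqn u + 2 * complex.Re (dot u v) + sqn v.
Proof.
rewrite /sqn dotDl !dotDr (dotJ D u v) !complexDE; ring.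
Qed.

Lemma sqnB u v : sqn (u - v) = sqn u - 2 * complex.Re (dot u v) + sqn v.
Proof. by rewrite sqnD sqnN dotNr cReN mulrN. Qed.

Lemma parallelogram u v : sqn (u + v) + sqn (u - v) = 2 * (sqn u + sqn v).
Proof. by rewrite sqnD sqnB; ring. Qed.

Lemma sqnD_le u v : sqn (u + v) <= 2 * (sqn u + sqn v).
Proof. by rewrite -parallelogram lerDl sqn_ge0. Qed.

(** The best [t] is [1 / p]. The constant [s] is left free because [coimage_projection] takes for it
    a squared distance minus its infimum. *)
Lemma discriminant_le (s q p : R) : 0 <= q -> 0 <= p ->
  (forall t, 0 <= s - 2 * t * q + t ^+ 2 * q * p) -> q <= s * p.
Proof.
move=> q0 p0 key; move: p0; rewrite le_eqVlt => /orP[/eqP p0|p0].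
  rewrite -p0 mulr0 leNgt; apply/negP => qgt0.
  (* With [p = 0] the expression is affine in [t], and this [t] gives it the value -1. *)
  have := key ((s + 1) / (2 * q)); rewrite -p0 mulr0 addr0.
  have -> : 2 * ((s + 1) / (2 * q)) * q = s + 1 by field; rewrite gt_eqF.
  by rewrite opprD addrA subrr add0r oppr_ge0 ler10.
have := key p^-1.
have -> : s - 2 * p^-1 * q + p^-1 ^+ 2 * q * p = (s * p - q) / p.
  by field; rewrite gt_eqF.
by rewrite pmulr_lge0 ?invr_gt0// subr_ge0.
Qed.

Lemma sqn_shift u v (t : R) : sqn (u - (t%:C%C * dot u v) *: v) =
  sqn u - 2 * t * sqmod (dot u v) + t ^+ 2 * sqmod (dot u v) * sqn v.
Proof.
rewrite sqnB sqnZ sqmodM sqmod_real dotZr rmorphM /=.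
have -> : complex.Re ((t%:C%C)^* * (dot u v)^* * dot u v) = t * sqmod (dot u v).
  by rewrite /sqmod !complexDE /=; ring.
by rewrite mulrA.
Qed.

Lemma cauchy_schwarz u v : sqmod (dot u v) <= sqn u * sqn v.
Proof.
apply: discriminant_le; rewrite ?sqmod_ge0 ?sqn_ge0// => t.
by rewrite -sqn_shift sqn_ge0.
Qed.

Lemma nm_ge0 u : 0 <= nm u.
Proof. exact: sqrtr_ge0. Qed.

Lemma nm_sqr u : nm u ^+ 2 = sqn u.
Proof. by rewrite sqr_sqrtr// sqn_ge0. Qed.

Lemma nmD u v : nm (u + v) <= nm u + nm v.
Proof.
rewrite -(@ler_pXn2r _ 2)// ?nnegrE ?addr_ge0 ?nm_ge0//.
rewrite sqrrD !nm_sqr sqnD lerD2r lerD2l mulr2n mulrDl mul1r.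
suff h : complex.Re (dot u v) <= nm u * nm v by rewrite lerD.
apply: le_trans (ler_norm _) _.
rewrite -(@ler_pXn2r _ 2)// ?nnegrE ?mulr_ge0 ?nm_ge0//.
rewrite real_normK ?num_real// exprMn !nm_sqr.
apply: le_trans (cauchy_schwarz u v).
by rewrite /sqmod lerDl sqr_ge0.
Qed.

Lemma nmZ_real (x : R) u : 0 <= x -> nm (x%:C%C *: u) = x * nm u.
Proof.
move=> x0; rewrite /nm sqnZ sqmod_real sqrtrM ?sqr_ge0// sqrtr_sqr.
by rewrite ger0_norm.
Qed.

Lemma nm_le_sqn (c : R) u v : 0 <= c -> sqn u <= c ^+ 2 * sqn v -> nm u <= c * nm v.
Proof.
move=> c0 h; rewrite -(@ler_pXn2r _ 2)// ?nnegrE ?mulr_ge0 ?nm_ge0//.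
by rewrite exprMn !nm_sqr.
Qed.

Lemma sqn_le_nm u v : (sqn u <= sqn v) = (nm u <= nm v).
Proof. by rewrite /nm ler_sqrt// sqn_ge0. Qed.

Lemma sqn_eq0_dot u v : sqn u = 0 -> dot u v = 0.
Proof.
move=> u0; apply: sqmod_eq0; apply/eqP; rewrite eq_le sqmod_ge0 andbT.
by apply: le_trans (cauchy_schwarz u v) _; rewrite u0 mul0r.
Qed.

End InnerTheory.

(** * Limits of sequences *)

Section RealSequences.
Variable R : realType.
Local Open Scope classical_set_scope.
Implicit Types x y : nat -> R.

Lemma cvg0_le x y : (forall n, 0 <= x n <= y n) -> y @ \oo --> 0 -> x @ \oo --> 0.
Proof.
move=> h y0; have c0 : (fun=> 0 : R) @ \oo --> (0 : R) by exact: cvg_cst.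
by apply: (squeeze_cvgr _ c0 y0); exact: nearW.
Qed.

Lemma cvg0_eps x : (forall n, 0 <= x n) ->
  (forall e, 0 < e -> exists N, forall n, (N <= n)%N -> x n <= e) -> x @ \oo --> 0.
Proof.
move=> x0 h; apply/cvgrPdist_le => e e0; have [N hN] := h e e0.
by exists N => // n /= Nn; rewrite sub0r normrN ger0_norm ?hN.
Qed.

Lemma cvg0_epsP x e : x @ \oo --> 0 -> 0 < e -> exists N, forall n, (N <= n)%N -> x n <= e.
Proof.
move=> /cvgrPdist_le /(_ e) h /h [N _ hN]; exists N => n /hN /=.
by rewrite sub0r normrN; apply: le_trans; exact: ler_norm.
Qed.

Lemma cst_cvg0_eq0 (c : R) y : 0 <= c -> (forall n, c <= y n) -> y @ \oo --> 0 -> c = 0.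
Proof.
move=> c0 h y0; apply/eqP; rewrite eq_le c0 andbT.
have /cvg_lim <- // := y0; apply: limr_ge; first by apply/cvg_ex; exists 0.
exact: nearW.
Qed.

End RealSequences.

Section InnerLimits.
Variables (R : realType) (V : lmodType R[i]) (dot : V -> V -> R[i]).
Hypothesis D : inner dot.
Implicit Types (l : V) (u v : nat -> V).
Local Open Scope classical_set_scope.
Local Notation sqn := (sqn dot).

Lemma tends_le u l (x : nat -> R) : (forall n, sqn (u n - l) <= x n) ->
  x @ \oo --> 0 -> tends dot u l.
Proof. by move=> h; apply: cvg0_le => n; rewrite (sqn_ge0 D) h. Qed.

Lemma sqn_tri a b l : sqn (a - b) <= 2 * (sqn (a - l) + sqn (b - l)).
Proof.
have -> : a - b = (a - l) + (l - b) by rewrite addrA subrK.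
by apply: le_trans (sqnD_le D _ _) _; rewrite (sqnC D l b).
Qed.

Lemma cvg0_twice_sum (x y : nat -> R) : x @ \oo --> 0 -> y @ \oo --> 0 ->
  (fun n => 2 * (x n + y n)) @ \oo --> 0.
Proof.
move=> x0 y0; have -> : 0 = 2 * (0 + 0) :> R by rewrite addr0 mulr0.
by apply: cvgM; [exact: cvg_cst|exact: cvgD].
Qed.

Lemma tends_dist u l l' : tends dot u l -> tends dot u l' -> sqn (l - l') = 0.
Proof.
move=> ul ul'.
apply: (cst_cvg0_eq0 (sqn_ge0 D _) _ (cvg0_twice_sum ul ul')) => n.
apply: le_trans (sqn_tri l l' (u n)) _.
by rewrite (sqnC D l) (sqnC D l').
Qed.

Lemma tends_cauchy u l : tends dot u l -> cauchy_seq dot u.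
Proof.
move=> ul e e0; have e40 : 0 < e / 4 by rewrite divr_gt0.
have [N hN] := cvg0_epsP ul e40; exists N => m n Nm Nn.
apply: le_trans (sqn_tri _ _ l) _.
have := hN _ Nm; have := hN _ Nn; lra.
Qed.

Lemma tendsD u v l l' : tends dot u l -> tends dot v l' ->
  tends dot (fun n => u n + v n) (l + l').
Proof.
move=> ul vl; apply: tends_le (cvg0_twice_sum ul vl) => n.
by rewrite opprD addrACA; exact: sqnD_le.
Qed.

Lemma tendsZ a u l : tends dot u l -> tends dot (fun n => a *: u n) (a *: l).
Proof.
move=> ul; apply: (@tends_le _ _ (fun n => sqmod a * sqn (u n - l))) => [n|].
  by rewrite -scalerBr sqnZ.
by have -> : 0 = sqmod a * 0 :> R by [rewrite mulr0]; apply: cvgM => //; exact: cvg_cst.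
Qed.

Lemma tendsB u v l l' : tends dot u l -> tends dot v l' ->
  tends dot (fun n => u n - v n) (l - l').
Proof.
by move=> ul /(tendsZ (-1)) vl; have := tendsD ul vl;
  rewrite scaleN1r; congr (tends dot _ _); apply/funext => n; rewrite scaleN1r.
Qed.

Lemma tends_cst l : tends dot (fun=> l) l.
Proof. by rewrite /tends subrr (sqn0 D); exact: cvg_cst. Qed.

Lemma tends_dot u v l l' : tends dot u l -> tends dot v l' ->
  (fun n => sqmod (dot (u n) (v n) - dot l l')) @ \oo --> 0.
Proof.
move=> ul vl.
apply: (@cvg0_le _ _ (fun n => 2 * (sqn (u n - l) *
   (2 * (sqn (v n - l') + sqn l')) + sqn l * sqn (v n - l')))) => [n|].
  rewrite sqmod_ge0 /=.
  have -> : dot (u n) (v n) - dot l l' = dot (u n - l) (v n) + dot l (v n - l').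
    by rewrite (dotBl D) (dotBr D) addrA subrK.
  apply: le_trans (sqmodD_le _ _) _; rewrite ler_wpM2l// lerD//; last exact: cauchy_schwarz.
  apply: le_trans (cauchy_schwarz D _ _) _; rewrite ler_wpM2l ?(sqn_ge0 D)//.
  by apply: le_trans (sqnD_le D _ _); rewrite subrK.
have -> : 0 = 2 * (0 * (2 * (0 + sqn l')) + sqn l * 0) :> R by ring.
apply: cvgM; first exact: cvg_cst; apply: cvgD; last by apply: cvgM => //; exact: cvg_cst.
apply: cvgM => //; apply: cvgM; first exact: cvg_cst.
by apply: cvgD => //; exact: cvg_cst.
Qed.

Lemma tends_dot_l u l y : tends dot u l -> (forall n, dot (u n) y = 0) -> dot l y = 0.
Proof.
move=> ul h; apply: sqmod_eq0.
apply: (cst_cvg0_eq0 (sqmod_ge0 _) _ (tends_dot ul (tends_cst y))) => n.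
by rewrite h sub0r sqmodN.
Qed.

Lemma tends_sqn_le u l c : tends dot u l -> (forall n, sqn (u n) <= c) -> sqn l <= c.
Proof.
move=> ul h; rewrite leNgt; apply/negP => lc.
(* If [c < sqn l], every [sqn (u n)] stays at distance at least [sqn l - c] from its limit
   [sqn l]. *)
have : (sqn l - c) ^+ 2 = 0.
  apply: (cst_cvg0_eq0 (sqr_ge0 _) _ (tends_dot ul ul)) => n.
  rewrite !(dot_sqn D) -rmorphB /= sqmod_real -(sqrrN (_ - sqn l)) opprB.
  rewrite ler_pXn2r ?nnegrE ?subr_ge0 ?(ltW lc) ?lerD2l ?lerN2 ?h//.
  exact: le_trans (h n) (ltW lc).
by move=> /eqP; rewrite sqrf_eq0 subr_eq0 gt_eqF.
Qed.

End InnerLimits.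

(** The two spaces may differ: this is how a map that preserves inner products on a range keeps
    doing so on limits. *)
Lemma dot_lim_eq (R : realType) (V W : lmodType R[i]) (dV : V -> V -> R[i])
    (dW : W -> W -> R[i]) (DV : inner dV) (DW : inner dW) u u' v v' l l' k k' :
  tends dV u l -> tends dV u' l' -> tends dW v k -> tends dW v' k' ->
  (forall n, dV (u n) (u' n) = dW (v n) (v' n)) -> dV l l' = dW k k'.
Proof.
move=> ul ul' vk vk' h; apply/eqP; rewrite -subr_eq0; apply/eqP/sqmod_eq0.
apply: (cst_cvg0_eq0 (sqmod_ge0 _) _
  (cvg0_twice_sum (tends_dot DV ul ul') (tends_dot DW vk vk'))) => n.
have -> : dV l l' - dW k k' = - (dV (u n) (u' n) - dV l l') + (dW (v n) (v' n) - dW k k').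
  by rewrite h; ring.
by apply: le_trans (sqmodD_le _ _) _; rewrite sqmodN.
Qed.

(** * Polar decomposition *)

Section Douglas.
Local Open Scope classical_set_scope.
Variables (R : realType) (E F : lmodType R[i]).
Variables (dE : E -> E -> R[i]) (dF : F -> F -> R[i]).
Hypotheses (DE : inner dE) (DF : inner dF).
Hypothesis (cE : cauchy_complete dE) (defF : definite dF).
Variables (A : {linear E -> F}) (A' : {linear F -> E}).
Hypothesis adj : forall e f, dF (A e) f = dE e (A' f).

(* The limit is the orthogonal projection of [e] on the closure of the range
   of [A'], obtained from a minimizing sequence and the parallelogram law. *)
Lemma coimage_projection e : exists e' g, tends dE (fun n => A' (g n)) e' /\ A e' = A e.
Proof.
pose X : set R := [set sqn dE (e - A' g) | g in setT]%classic.
have X0 : nonempty X by exists (sqn dE (e - A' 0)); exists 0.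
have lbX : has_lbound X by exists 0 => _ [g _ <-]; exact: sqn_ge0.
pose d := inf X.
have dle g : d <= sqn dE (e - A' g) by apply: ge_inf => //; exists g.
have /choice[g hg] n : exists g, sqn dE (e - A' g) < d + n.+1%:R^-1.
  have [] := @inf_adherent _ X (n.+1%:R^-1); first by rewrite invr_gt0.
    by split.
  by move=> _ [g _ <-] ?; exists g.
have half g1 g2 : sqn dE (A' g1 - A' g2) <=
    2 * (sqn dE (e - A' g1) + sqn dE (e - A' g2)) - 4 * d.
  rewrite -(parallelogram DE) lerBrDr.
  have -> : (e - A' g1) - (e - A' g2) = - (A' g1 - A' g2).
    by rewrite opprB addrC addrA subrK opprB.
  rewrite (sqnN DE) [leRHS]addrC lerD2l.
  have -> : (e - A' g1) + (e - A' g2) = 2 *: (e - A' (2^-1 *: (g1 + g2))).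
    rewrite scalerBr -linearZ /= scalerA divff ?pnatr_eq0// scale1r linearD.
    by rewrite scaler_nat mulr2n addrACA opprD.
  rewrite (sqnZ DE).
  have -> : sqmod (2 : R[i]) = 4 by rewrite -(rmorph_nat (real_complex R) 2) sqmod_real; ring.
  by rewrite ler_pM2l.
have [e' he'] : exists l, tends dE (fun n => A' (g n)) l.
  apply: cE => eps eps0.
  have e40 : 0 < eps / 4 by rewrite divr_gt0.
  have [N hN] := cvg0_epsP cvg_harmonic e40.
  exists N => m n /hN hm /hN hn; apply: le_trans (half _ _) _.
  have := hg m; have := hg n; rewrite /harmonic /= in hm hn.
  move: (_ (e - A' (g n))) (_ (e - A' (g m))) (m.+1%:R^-1) (n.+1%:R^-1) hm hn => a b p q.
  lra.
exists e', g; split=> //.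
(* Once [e - e'] is orthogonal to the range of [A'], taking [h = A (e - e')] gives
   [sqn dF (A (e - e')) = 0]. *)
suff orth h : dE (e - e') (A' h) = 0.
  apply/eqP; rewrite -subr_eq0 -opprB oppr_eq0 -linearB; apply/eqP/defF.
  by rewrite /sqn adj orth.
(* Moving [A' (g n)] along [A' h] stays in the range of [A'], so the squared distance cannot fall
   below [d]. The discriminant then bounds the failure of orthogonality by the excess over [d]. *)
have bound n : sqmod (dE (e - A' (g n)) (A' h)) <= n.+1%:R^-1 * sqn dE (A' h).
  apply: le_trans (_ : (sqn dE (e - A' (g n)) - d) * sqn dE (A' h) <= _); last first.
    by rewrite ler_wpM2r ?(sqn_ge0 DE)// lerBlDl ltW.
  apply: discriminant_le; rewrite ?sqmod_ge0 ?(sqn_ge0 DE)// => t.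
  set w := e - A' (g n); set q := dE w (A' h).
  have -> : sqn dE w - d - 2 * t * sqmod q + t ^+ 2 * sqmod q * sqn dE (A' h) =
      sqn dE (w - (t%:C%C * q) *: A' h) - d by rewrite (sqn_shift DE); ring.
  by rewrite subr_ge0 -linearZ -addrA -opprD -linearD.
apply: sqmod_eq0.
have bound0 : (fun n => n.+1%:R^-1 * sqn dE (A' h)) @ \oo --> 0.
  by rewrite -(mul0r (sqn dE (A' h))); apply: cvgM; [exact: cvg_harmonic|exact: cvg_cst].
have lim0 := tends_dot DE (tendsB DE (tends_cst DE e) he') (tends_cst DE (A' h)).
apply: (cst_cvg0_eq0 (sqmod_ge0 _) _ (cvg0_twice_sum lim0 bound0)) => n.
set z := dE (e - e') (A' h); set w := dE (e - A' (g n)) (A' h).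
have {1}-> : z = w - (w - z) by ring.
by apply: le_trans (sqmodD_le _ _) _; rewrite sqmodN ler_pM2l//= [leLHS]addrC lerD2l bound.
Qed.

End Douglas.

(* The relation is the graph of a unitary map between the orthogonal
   complements of the kernels of [A] and [B]. *)
Definition polar_graph (R : realType) (E F G : lmodType R[i]) (dE : E -> E -> R[i])
    (dG : G -> G -> R[i]) (A' : F -> E) (B' : F -> G) (e : E) (f : G) : Prop :=
  exists g : nat -> F, tends dE (fun n => A' (g n)) e /\ tends dG (fun n => B' (g n)) f.

Section Polar.
Variables (R : realType) (E F G : lmodType R[i]).
Variables (dE : E -> E -> R[i]) (dF : F -> F -> R[i]) (dG : G -> G -> R[i]).
Hypotheses (DE : inner dE) (DF : inner dF) (DG : inner dG).
Variables (A : {linear E -> F}) (A' : {linear F -> E}).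
Variables (B : {linear G -> F}) (B' : {linear F -> G}).
Hypothesis adjA : forall e f, dF (A e) f = dE e (A' f).
Hypothesis adjB : forall e f, dF (B e) f = dG e (B' f).
Hypothesis AB : forall f, A (A' f) = B (B' f).
Local Notation graph := (polar_graph dE dG A' B').

(** [A A' = B B'] makes [A' f -> B' f] an isometry between the ranges of [A'] and [B']. The graph
    relation is its closure. *)
Let dot_AB f f' : dE (A' f) (A' f') = dG (B' f) (B' f').
Proof. by rewrite -adjA -adjB AB. Qed.

Lemma polar_graph_dot e f e2 f2 : graph e f -> graph e2 f2 -> dE e e2 = dG f f2.
Proof.
move=> [g [ge gf]] [h [he hf]]; apply: (dot_lim_eq DE DG ge he gf hf) => n.
exact: dot_AB.
Qed.

Lemma polar_graph_orthol e f : graph e f -> forall k, A k = 0 -> dE e k = 0.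
Proof.
move=> [g [ge gf]] k Ak; apply: (tends_dot_l DE ge) => n.
by rewrite (dotJ DE) -adjA Ak (dot0l DF) rmorph0.
Qed.

Lemma polar_graph_orthor e f : graph e f -> forall k, B k = 0 -> dG f k = 0.
Proof.
move=> [g [ge gf]] k Bk; apply: (tends_dot_l DG gf) => n.
by rewrite (dotJ DG) -adjB Bk (dot0l DF) rmorph0.
Qed.

Hypothesis defF : definite dF.

(** With [y = A e - B f], the numbers [dF (A e) y = dE e (A' y)] and [dF (B f) y = dG f (B' y)] are
    limits of [dE (A' (g n)) (A' y)] and [dG (B' (g n)) (B' y)], which agree. So [y] is orthogonal
    to itself. *)
Lemma polar_graph_eq e f : graph e f -> A e = B f.
Proof.
move=> [g [ge gf]]; apply/eqP; rewrite -subr_eq0; apply/eqP/defF.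
rewrite /sqn; set y := A e - B f; suff -> : dF y y = 0 by [].
rewrite {1}/y (dotBl DF) adjA adjB; apply/eqP; rewrite subr_eq0; apply/eqP.
apply: (dot_lim_eq DE DG ge (tends_cst DE _) gf (tends_cst DG _)) => n.
exact: dot_AB.
Qed.

Hypotheses (cE : cauchy_complete dE) (cG : cauchy_complete dG).

(** The approximants [A' (g n)] of the projection of [e] are Cauchy, and so are their isometric
    images [B' (g n)]. Together with [polar_graph_eq] this puts the range of [A] inside that of [B];
    it is used in both directions. *)
Lemma polar_graph_ex e : exists e' f, A e' = A e /\ graph e' f.
Proof.
have [e' [g [ge Ae]]] := coimage_projection DE cE defF adjA e.
have [f gf] : exists f, tends dG (fun n => B' (g n)) f.
  apply: cG => eps /(tends_cauchy DE ge)[N hN]; exists N => m n Nm Nn.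
  by rewrite /sqn -linearB /= -dot_AB linearB; exact: hN.
by exists e', f; split=> //; exists g.
Qed.

End Polar.

Lemma polar_graphC (R : realType) (E F G : lmodType R[i]) (dE : E -> E -> R[i])
    (dG : G -> G -> R[i]) (A' : F -> E) (B' : F -> G) e f :
  polar_graph dE dG A' B' e f -> polar_graph dG dE B' A' f e.
Proof. by move=> [g [ge gf]]; exists g. Qed.

(** * Positive square roots *)

Section PositiveSqrt.
Local Open Scope classical_set_scope.
Variables (R : realType) (V : lmodType R[i]) (dot : V -> V -> R[i]).
Hypotheses (D : inner dot) (defV : definite dot) (cV : cauchy_complete dot).
Variable B : {linear V -> V}.
Hypothesis adjB : forall u v, dot (B u) v = dot u (B v).
Hypothesis contrB : forall u, sqn dot (B u) <= sqn dot u.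
Local Notation sqn := (sqn dot).
Local Notation nm := (nm dot).

(* [npol c X]: [X] is a polynomial in [B] with nonnegative coefficients whose
   value at [1] is [c]. *)
Inductive npol : R -> (V -> V) -> Prop :=
| npol0 : npol 0 (fun=> 0)
| npolB : npol 1 B
| npolD c d X Y : npol c X -> npol d Y -> npol (c + d) (fun u => X u + Y u)
| npolM c d X Y : npol c X -> npol d Y -> npol (c * d) (fun u => X (Y u))
| npolZ t c X : 0 <= t -> npol c X -> npol (t * c) (fun u => t%:C%C *: X u).

Lemma npol_linear c X : npol c X -> forall a u v, X (a *: u + v) = a *: X u + X v.
Proof.
elim=> {c X} [||c d X Y _ hX _ hY|c d X Y _ hX _ hY|t c X t0 _ hX] a u v.
- by rewrite scaler0 addr0.
- by rewrite linearP.
- by rewrite hX hY scalerDr addrACA.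
- by rewrite hY hX.
- by rewrite hX scalerDr !scalerA mulrC.
Qed.

Lemma npol_add c X : npol c X -> forall u v, X (u + v) = X u + X v.
Proof. by move=> /npol_linear h u v; rewrite -[u]scale1r h !scale1r. Qed.

Lemma npol_sub c X : npol c X -> forall u v, X (u - v) = X u - X v.
Proof.
by move=> /npol_linear h u v; rewrite addrC -scaleN1r h scaleN1r addrC.
Qed.

Lemma npol_bound c X : npol c X -> 0 <= c /\ forall u, nm (X u) <= c * nm u.
Proof.
elim=> {c X} [||c d X Y _ [c0 hX] _ [d0 hY]|c d X Y _ [c0 hX] _ [d0 hY]|t c X t0 _ [c0 hX]].
- by split=> // u; rewrite mul0r /nm (sqn0 D) sqrtr0.
- by split=> // u; rewrite mul1r -sqn_le_nm.
- split=> [|u]; first exact: addr_ge0.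
  by apply: le_trans (nmD D _ _) _; rewrite mulrDl lerD.
- split=> [|u]; first exact: mulr_ge0.
  by apply: le_trans (hX _) _; rewrite -mulrA ler_wpM2l.
- split=> [|u]; first exact: mulr_ge0.
  by rewrite nmZ_real// -mulrA ler_wpM2l.
Qed.

Lemma npol_commB c X : npol c X -> forall u, X (B u) = B (X u).
Proof.
elim=> {c X} [||c d X Y _ hX _ hY|c d X Y _ hX _ hY|t c X t0 _ hX] u //.
- by rewrite linear0.
- by rewrite hX hY linearD.
- by rewrite hY hX.
- by rewrite hX linearZ.
Qed.

Lemma npol_comm c X d Y : npol c X -> npol d Y -> forall u, X (Y u) = Y (X u).
Proof.
move=> hX; elim=> {d Y} [||d d' Y Y' _ hY _ hY'|d d' Y Y' _ hY _ hY'|t d Y t0 _ hY] u.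
- by rewrite -[in LHS](subrr 0) (npol_sub hX) subrr.
- exact: npol_commB hX u.
- by rewrite (npol_add hX) hY hY'.
- by rewrite hY hY'.
- have X0 : X 0 = 0 by rewrite -[in LHS](subrr 0) (npol_sub hX) subrr.
  by rewrite -[_ *: Y u]addr0 (npol_linear hX) hY X0 addr0.
Qed.

Lemma npol_selfadj c X : npol c X -> forall u v, dot (X u) v = dot u (X v).
Proof.
elim=> {c X} [||c d X Y hX iX hY iY|c d X Y hX iX hY iY|t c X t0 _ hX] u v.
- by rewrite (dot0l D) (dot0r D).
- exact: adjB.
- by rewrite (dotDl D) (dotDr D) iX iY.
- by rewrite iX iY (npol_comm hX hY).
- by rewrite (dotZl D) (dotZr D) hX; congr (_ * _); rewrite conjCE /= oppr0.
Qed.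

(** Successive approximation of [X = 1 - (1 - B)^(1/2)], which solves [2 X = B + X^2]. *)
Fixpoint approx (n : nat) : V -> V :=
  if n is m.+1 then fun u => (2^-1)%:C%C *: (B u + approx m (approx m u)) else fun=> 0.

(** The same iteration for the scalar [B = 1]: it majorizes the operator iteration, since all
    coefficients are nonnegative and [B] is a contraction. *)
Fixpoint bound (n : nat) : R :=
  if n is m.+1 then 2^-1 * (1 + bound m * bound m) else 0.

Lemma approx_npol n : npol (bound n) (approx n).
Proof.
elim: n => [|n ih]; first exact: npol0.
by apply: npolZ; [rewrite invr_ge0|apply: npolD; [exact: npolB|exact: npolM]].
Qed.

(** Polynomials in [B] commute, so with [X_n] for [approx n] one has [X_(n+2) - X_(n+1) = (X_(n+1) -
    X_n) (X_(n+1) + X_n) / 2]. Hence the increments also have nonnegative coefficients. *)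
Lemma approx_step n :
  npol (bound n.+1 - bound n) (fun u => approx n.+1 u - approx n u).
Proof.
elim: n => [|n ih].
  have h : npol (2^-1 * 1) (fun u => (2^-1)%:C%C *: B u).
    by apply: npolZ; [rewrite invr_ge0|exact: npolB].
  rewrite /= mulr0 addr0 subr0; congr npol: h; apply/funext => u.
  by rewrite addr0 subr0.
have hS := approx_npol n.+1; have hn := approx_npol n.
have h2 : (0 : R) <= 2^-1 by rewrite invr_ge0.
have := npolZ h2 (npolM ih (npolD hS hn)).
congr npol.
  by rewrite /=; field.
apply/funext => u; rewrite [approx n.+2 u]/= -/(approx n.+1) [X in _ = _ - X]/=.
rewrite -scalerBr; congr (_ *: _).
rewrite (npol_add hS) (npol_add hn) (npol_comm hS hn).
have cancel (a p s r : V) : p + s - (s + r) = a + p - (a + r).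
  by rewrite opprD addrA addrK opprD addrACA subrr add0r.
exact: cancel.
Qed.

Lemma approx_diff n m : npol (bound (n + m) - bound n)
  (fun u => approx (n + m) u - approx n u).
Proof.
elim: m => [|m ih].
  rewrite addn0 subrr; have := npol0; congr npol; apply/funext => u.
  by rewrite subrr.
have := npolD (approx_step (n + m)) ih; rewrite addnS.
by congr npol; [rewrite addrA subrK|apply/funext => u; rewrite addrA subrK].
Qed.

Lemma bound_ge0 n : 0 <= bound n.
Proof. exact: (npol_bound (approx_npol n)).1. Qed.

Lemma bound_le1 n : bound n <= 1.
Proof.
elim: n => [|n ih] //=; have b0 := bound_ge0 n.
have := mulr_ile1 b0 b0 ih ih; lra.
Qed.

(** By [npol_bound] the norm of [approx m u - approx n u] is at most [(bound m - bound n) * nm u]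
    for [n <= m], and [bound] is increasing and at most 1. *)
Lemma approx_cauchy u : cauchy_seq dot (approx ^~ u).
Proof.
have nd : nondecreasing_seq bound.
  move=> n m nm; rewrite -subr_ge0 -(subnKC nm).
  exact: (npol_bound (approx_diff n (m - n))).1.
have [l bl] : exists l : R, bound @ \oo --> l.
  exists (sup (range bound)); apply: nondecreasing_cvgn => //; exists 1 => _ [n _ <-].
  exact: bound_le1.
have bl2 : (fun n => (l - bound n) ^+ 2 * sqn u) @ \oo --> 0.
  have -> : 0 = (l - l) ^+ 2 * sqn u :> R by rewrite subrr expr0n mul0r.
  apply: cvgM; last exact: cvg_cst.
  have h : (fun n => l - bound n) @ \oo --> l - l by apply: cvgB => //; exact: cvg_cst.
  exact: (cvgM h h).
have bound_l n : bound n <= l.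
  by have /cvg_lim <- // := bl; apply: nondecreasing_cvgn_le => //; apply/cvg_ex; exists l.
move=> e /(cvg0_epsP bl2)[N hN].
have key m n : (N <= n)%N -> (n <= m)%N -> sqn (approx m u - approx n u) <= e.
  move=> /hN h nm; apply: le_trans _ h.
  have [b0 hb] := npol_bound (approx_diff n (m - n)).
  rewrite subnKC// in b0 hb.
  rewrite -(nm_sqr D (_ - _)) -(nm_sqr D u) -exprMn.
  rewrite ler_pXn2r ?nnegrE ?mulr_ge0 ?nm_ge0 ?subr_ge0//.
  by apply: le_trans (hb u) _; rewrite ler_wpM2r ?nm_ge0// lerD2r.
exists N => m n Nm Nn; have [mn|/ltnW nm] := leqP n m; first exact: key.
by rewrite (sqnC D); exact: key.
Qed.

Theorem positive_sqrt_ex : exists S : {linear V -> V},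
  [/\ forall u v, dot (S u) v = dot u (S v), forall u, 0 <= dot (S u) u,
      forall u, sqn (S u) <= 4 * sqn u & forall u, S (S u) = u - B u].
Proof.
have /choice[X hX] u : exists l, tends dot (approx ^~ u) l by exact/cV/approx_cauchy.
have lim_uniq f l l' : tends dot f l -> tends dot f l' -> l = l'.
  move=> fl fl'; apply/eqP; rewrite -subr_eq0; apply/eqP/defV.
  exact: (tends_dist D fl fl').
have linX a u v : X (a *: u + v) = a *: X u + X v.
  apply: (lim_uniq (approx ^~ (a *: u + v))) => //.
  have := tendsD D (tendsZ D a (hX u)) (hX v).
  congr (tends dot _ _); apply/funext => n; exact/esym/(npol_linear (approx_npol n)).
have adjX u v : dot (X u) v = dot u (X v).
  apply: (dot_lim_eq D D (hX u) (tends_cst D v) (tends_cst D u) (hX v)) => n.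
  exact: npol_selfadj (approx_npol n) _ _.
have contr n u : sqn (approx n u) <= sqn u.
  rewrite sqn_le_nm//; have [b0 hb] := npol_bound (approx_npol n).
  apply: le_trans (hb u) _; rewrite -[leRHS]mul1r ler_wpM2r ?nm_ge0//.
  exact: bound_le1.
have contrX u : sqn (X u) <= sqn u by apply: (tends_sqn_le D (hX u)).
(* The quadratic term passes to the limit because the approximants are contractions:
   [approx n (approx n u)] is compared with [approx n (X u)]. *)
have fixX u : 2 *: X u = B u + X (X u).
  have h1 : tends dot (fun n => approx n (approx n u)) (X (X u)).
    apply: (tends_le D (x := fun n => 2 * (sqn (approx n u - X u) +
        sqn (approx n (X u) - X (X u))))) => [n|].
      apply: le_trans (_ : 2 * (sqn (approx n (approx n u - X u)) +
        sqn (approx n (X u) - X (X u))) <= _); last by rewrite ler_pM2l// lerD2r.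
      apply: le_trans (sqnD_le D _ _).
      by rewrite (npol_sub (approx_npol n)) addrA subrK.
    by apply: cvg0_twice_sum; [exact: (hX u)|exact: (hX (X u))].
  have h2 : tends dot (fun n => 2 *: approx n.+1 u) (B u + X (X u)).
    have := tendsD D (tends_cst D (B u)) h1; congr (tends dot _ _); apply/funext => n /=.
    rewrite scalerA rmorphV ?unitfE ?pnatr_eq0//= rmorph_nat divff ?pnatr_eq0//.
    by rewrite scale1r.
  have h3 : tends dot (fun n => 2 *: approx n.+1 u) (2 *: X u).
    by apply: tendsZ => //; rewrite /tends (cvg_shiftS (fun n => sqn (approx n u - X u))); exact: hX.
  exact: lim_uniq h3 h2.
pose S u := u - X u.
have linS a u v : S (a *: u + v) = a *: S u + S v.
  by rewrite /S linX opprD addrACA scalerBr.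
pose mS := GRing.isLinear.Build _ _ _ _ S linS.
pose S' : {linear V -> V} := HB.pack S mS.
have adjS u v : dot (S u) v = dot u (S v) by rewrite (dotBl D) (dotBr D) adjX.
exists S'; split=> [u v|u|u|u] //=.
(* Self-adjointness makes this number real. Its sign comes from [2 Re (X u, u) <= |X u|^2 + |u|^2 <=
   2 |u|^2]. *)
- have -> : dot (S u) u = (complex.Re (dot (S u) u))%:C%C.
    have := dotJ D (S u) u; rewrite -adjS; case: (dot (S u) u) => x y [].
    by move=> /eqP; rewrite -addr_eq0 -mulr2n mulrn_eq0 /= => /eqP ->.
  rewrite ler0c (dotBl D) cReD cReN.
  have := sqn_ge0 D (X u - u); rewrite (sqnB D); have := contrX u.
  by rewrite -/(sqn u); lra.
- apply: le_trans (sqnD_le D _ _) _; rewrite (sqnN D).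
  have := contrX u; lra.
- have linXB v w : X (v - w) = X v - X w.
    by rewrite addrC -scaleN1r linX scaleN1r addrC.
  rewrite /S linXB; have := fixX u; rewrite scaler_nat mulr2n => h.
  have -> : B u = X u + X u - X (X u) by rewrite h addrK.
  by rewrite -[X u + X u - _]addrA [in RHS]opprD addrA.
Qed.

End PositiveSqrt.

(** * The decomposition attached to an isometry *)

Section TripleSum.
Local Open Scope classical_set_scope.
Variables (R : realType) (V : lmodType R[i]) (dot : V -> V -> R[i]).
Hypothesis D : inner dot.

Definition dot3 (x y : V * V * V) : R[i] :=
  dot x.1.1 y.1.1 + dot x.1.2 y.1.2 + dot x.2 y.2.

Lemma dot3_inner : inner dot3.
Proof.
split=> [a u v w|u v|u]; rewrite /dot3 /=.
- by rewrite !(dotPl D); ring.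
- by rewrite !rmorphD /= -!(dotJ D).
- by rewrite !addr_ge0 ?(dot_ge0 D).
Qed.

Lemma sqn_dot3 x : sqn dot3 x = sqn dot x.1.1 + sqn dot x.1.2 + sqn dot x.2.
Proof. by rewrite /sqn /dot3 !cReD. Qed.

Lemma dot3_complete : cauchy_complete dot -> cauchy_complete dot3.
Proof.
move=> cV u cu.
have proj (p : V * V * V -> V) : (forall x y, p (x - y) = p x - p y) ->
    (forall x, sqn dot (p x) <= sqn dot3 x) ->
    exists l, tends dot (fun n => p (u n)) l.
  move=> pB ple; apply: cV => e /cu[N hN]; exists N => m n Nm Nn.
  by rewrite -pB; apply: le_trans (ple _) _; exact: hN.
have [||l1 h1] := proj (fun x => x.1.1) => //.
  by move=> x; rewrite sqn_dot3 -addrA lerDl addr_ge0 ?(sqn_ge0 D).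
have [||l2 h2] := proj (fun x => x.1.2) => //.
  by move=> x; rewrite sqn_dot3 addrAC lerDr addr_ge0 ?(sqn_ge0 D).
have [||l3 h3] := proj (fun x => x.2) => //.
  by move=> x; rewrite sqn_dot3 lerDr addr_ge0 ?(sqn_ge0 D).
exists (l1, l2, l3); rewrite /tends.
rewrite (_ : (fun n => _) = (fun n => sqn dot ((u n).1.1 - l1) + sqn dot ((u n).1.2 - l2) +
    sqn dot ((u n).2 - l3))); last by apply/funext => n; rewrite sqn_dot3.
have h : 0 = 0 + 0 + 0 :> R by rewrite !addr0.
by rewrite [X in _ --> X]h; apply: cvgD => //; apply: cvgD.
Qed.

End TripleSum.

Section IsometryDecomposition.
Variables (R : realType) (V : lmodType R[i]) (dot : V -> V -> R[i]).
Hypotheses (D : inner dot) (defV : definite dot) (cV : cauchy_complete dot).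
Variables (T T' S : {linear V -> V}).
Hypothesis adjT : forall u v, dot (T u) v = dot u (T' v).
Hypothesis isoT : forall u, T' (T u) = u.
Hypothesis adjS : forall u v, dot (S u) v = dot u (S v).
Hypothesis sqrS : forall u w, dot (S u) (S w) = dot u w -
  dot (2^-1 *: (T' u + T' (T' (T' u)))) (2^-1 *: (T' w + T' (T' (T' w)))).

(** [mulY] is the product [(2 - T) (1 - T)] expanded. The [co] versions below are the adjoints of
    the three operators. *)
Definition mulX u := u - T (T u).
Definition mulY u := 2 *: u - 3 *: T u + T (T u).
Definition mulZ u := 2 *: u + T u + T (T u).

Definition coX u := u - T' (T' u).
Definition coY u := 2 *: u - 3 *: T' u + T' (T' u).
Definition coZ u := 2 *: u + T' u + T' (T' u).

Local Notation P u := (u - T (T' u)).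

Let T'P u : T' (P u) = 0.
Proof. by rewrite linearB isoT subrr. Qed.

Let P_id u : T' u = 0 -> P u = u.
Proof. by move=> ->; rewrite linear0 subr0. Qed.

Let adjT' u v : dot (T' u) v = dot u (T v).
Proof. by rewrite (dotJ D) -adjT -(dotJ D). Qed.

Let dotPP u v : dot (P u) (P v) = dot u v - dot (T' u) (T' v).
Proof.
by rewrite (dotBr D) -[dot (P u) (T _)]adjT' T'P (dot0l D) subr0 (dotBl D) adjT.
Qed.

Let dotP u v : dot (P u) v = dot u (P v).
Proof. by rewrite (dotBl D) (dotBr D) adjT adjT'. Qed.

Let real_conj (x : R) : (x%:C%C)^* = x%:C%C.
Proof. by rewrite conjCE /= oppr0. Qed.

(* [(1 + c P)^2 = 1 + P / 3] *)
Let c : R := 2 / Num.sqrt 3 - 1.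
Let b : R := (Num.sqrt 24)^-1.
Let a : R := (Num.sqrt 8)^-1.

(** This is [D]. Each weight of the identity for [A] enters through its square root, [1 + c P] being
    that of [1 + P / 3]. *)
Definition combine3 (x : V * V * V) : V :=
  (2^-1)%:C%C *: mulX (x.1.1 + c%:C%C *: (P x.1.1)) +
  b%:C%C *: mulY (P x.1.2) + a%:C%C *: mulZ (P x.2).

Definition combine3_adj (u : V) : V * V * V :=
  ((2^-1)%:C%C *: (coX u + c%:C%C *: (P (coX u))),
   b%:C%C *: (P (coY u)), a%:C%C *: (P (coZ u))).

Let linE := (linearD T, linearB T, linearZZ T, linearN T,
  linearD T', linearB T', linearZZ T', linearN T').
Let dotE := (dotDr D, dotBr D, dotDl D, dotBl D, dotNl D, dotNr D, dotZl D, dotZr D, real_conj, @conjC_nat R[i]).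

(** Pairing with an arbitrary [w] turns identities between vectors into identities between complex
    numbers, where [ring] and [field] apply. *)
Lemma dot_inj u v : (forall w, dot u w = dot v w) -> u = v.
Proof.
move=> h; apply/eqP; rewrite -subr_eq0; apply/eqP/defV.
by rewrite /sqn (dotBl D) h subrr.
Qed.

Lemma combine3_adj_linear k u v : combine3_adj (k *: u + v) = k *: combine3_adj u + combine3_adj v.
Proof.
rewrite /combine3_adj /coX /coY /coZ; congr (_, _, _); apply: dot_inj => w /=;
  rewrite !linE !dotE; ring.
Qed.

Lemma combine3_adjoint x u : dot (combine3 x) u = dot3 dot x (combine3_adj u).
Proof.
rewrite /dot3 /combine3 /combine3_adj /mulX /mulY /mulZ /coX /coY /coZ /=.
by rewrite !linE !dotE !adjT -!adjT'; ring.
Qed.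

Lemma combine3_linear k u v : combine3 (k *: u + v) = k *: combine3 u + combine3 v.
Proof.
apply: dot_inj => w; rewrite [LHS]combine3_adjoint (dotPl (dot3_inner D)) -!combine3_adjoint.
by rewrite [RHS](dotDl D) (dotZl D).
Qed.

Let sq_c : c%:C%C + c%:C%C + c%:C%C * c%:C%C = 3^-1 :> R[i].
Proof.
rewrite -rmorphM -!rmorphD /=.
have -> : c + c + c * c = 3^-1; last by rewrite rmorphV ?unitfE ?pnatr_eq0//= rmorph_nat.
have s3 : Num.sqrt 3 ^+ 2 = 3 :> R by rewrite sqr_sqrtr.
have -> : c + c + c * c = 4 / Num.sqrt 3 ^+ 2 - 1.
  by rewrite /c; field; rewrite gt_eqF// sqrtr_gt0.
by rewrite s3; field.
Qed.

Let sq_b : b%:C%C * b%:C%C = 24^-1 :> R[i].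
Proof.
rewrite -rmorphM /= -expr2 exprVn sqr_sqrtr//.
by rewrite rmorphV ?unitfE ?pnatr_eq0//= rmorph_nat.
Qed.

Let sq_a : a%:C%C * a%:C%C = 8^-1 :> R[i].
Proof.
rewrite -rmorphM /= -expr2 exprVn sqr_sqrtr//.
by rewrite rmorphV ?unitfE ?pnatr_eq0//= rmorph_nat.
Qed.

(* With [x] for [T] on the left and [y] for its adjoint on the right, [P] is
   [1 - x y], and this is the identity
   [4 - x y (1 + x^2) (1 + y^2) = (1 - x^2) (1 - y^2) (1 + (1 - x y) / 3)
    + (1 - x y) (p x * p y / 6 + q x * q y / 2)], where [p x = (2 - x) (1 - x)]
   and [q x = 2 + x + x^2]. *)
Lemma combine3_adj_dot u w : dot3 dot (combine3_adj u) (combine3_adj w) = dot (S u) (S w).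
Proof.
have hX f g : dot (f + c%:C%C *: (P f)) (g + c%:C%C *: (P g)) =
    dot f g + 3^-1 * (dot f g - dot (T' f) (T' g)).
  have h1 : dot (P f) g = dot (P f) (P g) by rewrite -{1}(P_id (T'P f)) dotP.
  have h2 : dot f (P g) = dot (P f) (P g) by rewrite -{1}(P_id (T'P g)) -dotP.
  rewrite -sq_c -dotPP; move: (P f) (P g) h1 h2 => p q h1 h2.
  by rewrite (dotDl D) !(dotDr D) !(dotZl D) !(dotZr D) real_conj h1 h2; ring.
rewrite sqrS /dot3 /combine3_adj /= !(dotZl D) !(dotZr D) !real_conj hX !dotPP.
rewrite !(mulrA b%:C%C) !(mulrA a%:C%C) sq_a sq_b half_real.
rewrite half_conj.
by rewrite /coX /coY /coZ !linE !dotE; field.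
Qed.

Lemma combine3_adjK u : combine3 (combine3_adj u) = S (S u).
Proof.
by apply: dot_inj => w; rewrite combine3_adjoint combine3_adj_dot [RHS]adjS.
Qed.

(** Applying [T'^2] gives [T'^2 f = f - g], so [k = f - g] is fixed by [T'^2] and therefore by
    [T^2]. Then [f] may be replaced by [g] in the first term, the equation collapses to
    [3 g + T h = 0], and [T'] separates [h] from [g]. *)
Lemma mulXYZ_injective f g h : T' g = 0 -> T' h = 0 ->
  mulX f + (2 *: g + T (T g)) + T h = 0 -> [/\ mulX f = 0, g = 0 & h = 0].
Proof.
move=> Tg Th e.
have fix_g : T' (T' f) = f - g.
  have := congr1 (fun u => T' (T' u)) e.
  rewrite /mulX !linE !isoT Tg Th !linear0 ?scaler0 add0r addr0 => /eqP.
  by rewrite addrAC subr_eq0 eq_sym -subr_eq => /eqP ->.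
pose k := f - g.
have fix_k : T' (T' k) = k by rewrite /k !linE Tg linear0 subr0 fix_g.
(* Equality case of Cauchy-Schwarz: [T^2] is isometric and the inner product of [T^2 k] with [k] is
   that of [k] with [T'^2 k = k]. *)
have Tk : T (T k) = k.
  apply/eqP; rewrite -subr_eq0; apply/eqP/defV.
  by rewrite (sqnB D) adjT adjT fix_k /sqn adjT adjT !isoT; ring.
have Xf : mulX f = mulX g.
  have fE : f = k + g by rewrite /k subrK.
  by clearbody k; rewrite fE /mulX !linE Tk opprD addrACA subrr add0r.
move: e; rewrite Xf /mulX.
have -> : g - T (T g) + (2 *: g + T (T g)) = 3 *: g.
  by apply: dot_inj => w; rewrite !dotE; ring.
move=> e; have h0 : h = 0.
  by have := congr1 T' e; rewrite linearD linearZZ Tg scaler0 add0r isoT linear0.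
move: e; rewrite h0 linear0 addr0 => /eqP; rewrite scaler_eq0 pnatr_eq0 /= => /eqP g0.
by rewrite g0 !linear0 ?addr0.
Qed.

Lemma combine3_ker x : combine3 x = 0 -> [/\ combine3 (x.1.1, 0, 0) = 0, P x.1.2 = 0 & P x.2 = 0].
Proof.
move: x => [[f g] h] /=.
have DX : mulX (f + c%:C%C *: (P f)) = 0 -> combine3 (f, 0, 0) = 0.
  move=> Xf; rewrite /combine3 /= Xf /mulY /mulZ !linear0 ?scaler0 ?subrr ?addr0.
  by rewrite ?linear0 ?scaler0 ?subrr ?addr0 ?scaler0 ?addr0.
rewrite {1}/combine3 /=.
move: (f + _) DX (P g) (P h) (T'P g) (T'P h) => f' DX g' h' Tg Th e.
(* Since [mulY] is [(2 + T^2) - 3 T] and [mulZ] is [(2 + T^2) + T], these are the coefficients of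
   [2 + T^2] and of [T], doubled to clear the factor 1/2 of [mulX]. *)
pose g2 := 2 *: (b%:C%C *: g' + a%:C%C *: h').
pose h2 := 2 *: (a%:C%C *: h' - 3 *: (b%:C%C *: g')).
have [|||Xf g20 h20] := @mulXYZ_injective f' g2 h2.
- by rewrite /g2 !linE Tg Th !scaler0 addr0 scaler0.
- by rewrite /h2 !linE Tg Th !scaler0 subr0 scaler0.
- rewrite -[RHS](scaler0 V 2) -e; apply: dot_inj => w.
  by rewrite /mulX /mulY /mulZ /g2 /h2 !linE !dotE half_real; field.
have b0 : b%:C%C != 0 :> R[i] by rewrite fmorph_eq0 invr_eq0 gt_eqF// sqrtr_gt0.
have a0 : a%:C%C != 0 :> R[i] by rewrite fmorph_eq0 invr_eq0 gt_eqF// sqrtr_gt0.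
have bg : b%:C%C *: g' = 0.
  have : g2 - h2 = 8 *: (b%:C%C *: g').
    by apply: dot_inj => w; rewrite /g2 /h2 !dotE; ring.
  by rewrite g20 h20 subr0 => /esym/eqP; rewrite scaler_eq0 pnatr_eq0 /= => /eqP.
have ah : a%:C%C *: h' = 0.
  move: g20; rewrite /g2 bg add0r => /eqP.
  by rewrite scaler_eq0 pnatr_eq0 /= => /eqP.
split; first exact: DX.
- by apply/eqP; have /eqP := bg; rewrite scaler_eq0 (negbTE b0).
- by apply/eqP; have /eqP := ah; rewrite scaler_eq0 (negbTE a0).
Qed.

Let scale_mulX k u : k *: mulX u = mulX (k *: u).
Proof. by apply: dot_inj => w; rewrite /mulX !linE !dotE; ring. Qed.

Let scale_mulY k u : k *: mulY u = mulY (k *: u).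
Proof. by apply: dot_inj => w; rewrite /mulY !linE !dotE; ring. Qed.

Let scale_mulZ k u : k *: mulZ u = mulZ (k *: u).
Proof. by apply: dot_inj => w; rewrite /mulZ !linE !dotE; ring. Qed.

Let mul0 : [/\ mulX 0 = 0, mulY 0 = 0 & mulZ 0 = 0].
Proof. by split; rewrite -[0 in LHS](scale0r (0 : V)) -?scale_mulX -?scale_mulY -?scale_mulZ scale0r. Qed.

Lemma combine3_sum d : exists x y z, [/\ T' y = 0, T' z = 0 &
  combine3 d = mulX x + mulY y + mulZ z].
Proof.
rewrite /combine3 scale_mulX scale_mulY scale_mulZ; do 3 eexists; split; last by [].
  by rewrite linearZZ T'P scaler0.
by rewrite linearZZ T'P scaler0.
Qed.

Lemma combine3_mulX u : exists v, combine3 (v, 0, 0) = mulX u.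
Proof.
have c1 : 1 + c%:C%C != 0 :> R[i].
  have -> : 1 + c%:C%C = (1 + c)%:C%C :> R[i].
    by apply/eqP; rewrite eq_complex /= addr0 !eqxx.
  rewrite fmorph_eq0 /= addrC subrK.
  by rewrite mulf_neq0 ?invr_eq0 ?pnatr_eq0// gt_eqF// sqrtr_gt0.
have P0 : P (0 : V) = 0 by rewrite !linear0 ?addr0 ?subr0.
(* As [P] is idempotent, the inverse of [1 + c P] is [1 - c / (1 + c) P]; the factor 2 undoes the
   weight 1/2. *)
exists (2 *: (u - (c%:C%C / (1 + c%:C%C)) *: (P u))).
have [m1 m2 m3] := mul0.
rewrite /combine3 [X in mulY X]P0 [X in mulZ X]P0 m2 m3 !scaler0 !addr0 scale_mulX; congr mulX.
have PP : P (P u) = P u by exact/P_id/T'P.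
have -> : P (2 *: (u - (c%:C%C / (1 + c%:C%C)) *: (P u))) =
    2 *: (P u - (c%:C%C / (1 + c%:C%C)) *: P (P u)).
  by apply: dot_inj => w; rewrite !linE !dotE; ring.
rewrite PP; move: (P u) => p; apply: dot_inj => w.
by rewrite !dotE half_real; field.
Qed.

Lemma combine3_mulY u : T' u = 0 -> exists v, combine3 (0, v, 0) = mulY u.
Proof.
move=> /P_id Tu; have [m1 m2 m3] := mul0.
have P0 : P (0 : V) = 0 by rewrite !linear0 ?addr0 ?subr0.
have b0 : b%:C%C != 0 :> R[i] by rewrite fmorph_eq0 invr_eq0 gt_eqF// sqrtr_gt0.
exists ((b%:C%C)^-1 *: u); rewrite /combine3 /= [X in mulZ X]P0 [X in c%:C%C *: X]P0.
rewrite scaler0 addr0 m1 m3 !scaler0 add0r addr0 scale_mulY; congr mulY.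
by rewrite !linE -scalerBr Tu scalerA divff// scale1r.
Qed.

Lemma combine3_mulZ u : T' u = 0 -> exists v, combine3 (0, 0, v) = mulZ u.
Proof.
move=> /P_id Tu; have [m1 m2 m3] := mul0.
have P0 : P (0 : V) = 0 by rewrite !linear0 ?addr0 ?subr0.
have a0 : a%:C%C != 0 :> R[i] by rewrite fmorph_eq0 invr_eq0 gt_eqF// sqrtr_gt0.
exists ((a%:C%C)^-1 *: u); rewrite /combine3 /= [X in mulY X]P0 [X in c%:C%C *: X]P0.
rewrite scaler0 addr0 m1 m2 !scaler0 add0r add0r scale_mulZ; congr mulZ.
by rewrite !linE -scalerBr Tu scalerA divff// scale1r.
Qed.

End IsometryDecomposition.

(** * Minimal preimages and orthogonality of the three summands *)

Definition is_lift (R : realType) (V : lmodType R[i]) (dot : V -> V -> R[i])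
    (S : V -> V) (u f : V) : Prop :=
  (forall k, S k = 0 -> dot f k = 0) /\ S f = u.

Section IsometryDecompositionTheorem.
Variables (R : realType) (V : lmodType R[i]) (dot : V -> V -> R[i]).
Hypotheses (D : inner dot) (defV : definite dot) (cV : cauchy_complete dot).
Variables (T T' S : {linear V -> V}).
Hypothesis adjT : forall u v, dot (T u) v = dot u (T' v).
Hypothesis isoT : forall u, T' (T u) = u.
Hypothesis adjS : forall u v, dot (S u) v = dot u (S v).
Hypothesis sqrS : forall u w, dot (S u) (S w) = dot u w -
  dot (2^-1 *: (T' u + T' (T' (T' u)))) (2^-1 *: (T' w + T' (T' (T' w)))).

Let comb : {linear (V * V * V)%type -> V} := HB.pack (combine3 T T')
  (GRing.isLinear.Build _ _ _ _ (combine3 T T') (combine3_linear D defV adjT)).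
Let comb_adj : {linear V -> (V * V * V)%type} := HB.pack (combine3_adj T T')
  (GRing.isLinear.Build _ _ _ _ (combine3_adj T T') (combine3_adj_linear D defV T T')).
Local Notation graph := (polar_graph (dot3 dot) dot comb_adj S).

Let adj3 x u : dot (comb x) u = dot3 dot x (comb_adj u).
Proof. exact: (combine3_adjoint D adjT). Qed.

Let comb_adjK u : comb (comb_adj u) = S (S u).
Proof. exact: (combine3_adjK D defV adjT isoT adjS sqrS). Qed.

Lemma graph_is_lift d f : graph d f -> is_lift dot S (comb d) f.
Proof.
move=> h; split; first exact: (polar_graph_orthor D D adjS h).
apply/esym; apply: (polar_graph_eq (dot3_inner D) D D _ adjS _ defV h).
- exact: adj3.
- exact: comb_adjK.
Qed.

Lemma is_lift_uniq u f g : is_lift dot S u f -> is_lift dot S u g -> f = g.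
Proof.
move=> [fk fu] [gk gu]; apply/eqP; rewrite -subr_eq0; apply/eqP/defV.
have k0 : S (f - g) = 0 by rewrite linearB fu gu subrr.
by rewrite /sqn (dotBl D) fk// gk// subrr.
Qed.

(** Here the product form of the kernel is used. The difference [d - d'] lies in the kernel of
    [comb], hence so does each of its components alone, and [d'] is orthogonal to them. If a
    component of [d] is zero, that of [d - d'] is minus that of [d'], which is thus orthogonal to
    itself. *)
Lemma graph_ex d : exists d' f, [/\ graph d' f, comb d' = comb d,
  d.1.1 = 0 -> d'.1.1 = 0, d.1.2 = 0 -> d'.1.2 = 0 & d.2 = 0 -> d'.2 = 0].
Proof.
have dot3D := dot3_inner D.
have [d' [f [dd' h]]] := polar_graph_ex dot3D adj3 adjS
  comb_adjK defV (dot3_complete D cV) cV d.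
have orth := polar_graph_orthol dot3D D adj3 h.
have ker0 : comb (d - d') = 0 by rewrite linearB dd' subrr.
have [kX kY kZ] := combine3_ker D defV adjT isoT ker0.
exists d', f; split=> // d0; apply: defV.
- have := orth _ kX; rewrite /dot3 /= d0 !(dot0r D) !addr0 sub0r (dotNr D).
  by move=> /eqP; rewrite oppr_eq0 => /eqP; rewrite /sqn => ->.
- have e0 : comb (0, (d - d').1.2, 0) = 0.
    rewrite /= /combine3 /mulX /mulY /mulZ /= kY !linear0 ?scaler0 ?subrr ?addr0 ?add0r.
    by rewrite ?linear0 ?scaler0 ?subrr ?addr0 ?scaler0 ?addr0.
  have := orth _ e0; rewrite /dot3 /= d0 !(dot0r D) !addr0 add0r sub0r (dotNr D).
  by move=> /eqP; rewrite oppr_eq0 => /eqP; rewrite /sqn => ->.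
- have e0 : comb (0, 0, (d - d').2) = 0.
    rewrite /= /combine3 /mulX /mulY /mulZ /= kZ !linear0 ?scaler0 ?subrr ?addr0 ?add0r.
    by rewrite ?linear0 ?scaler0 ?subrr ?addr0 ?scaler0 ?addr0.
  have := orth _ e0; rewrite /dot3 /= d0 !(dot0r D) !add0r (dotNr D).
  by move=> /eqP; rewrite oppr_eq0 => /eqP; rewrite /sqn => ->.
Qed.

Lemma range_sub_sum f : exists x y z, [/\ T' y = 0, T' z = 0 &
  S f = mulX T x + mulY T y + mulZ T z].
Proof.
have dot3D := dot3_inner D.
have [f' [d [ff' h]]] := polar_graph_ex D adjS adj3
  (fun u => esym (comb_adjK u)) defV cV (dot3_complete D cV) f.
have [_] := graph_is_lift (polar_graphC h); rewrite ff' => ->.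
exact: (combine3_sum D defV isoT).
Qed.

Lemma lift_mulX u : exists f x, [/\ is_lift dot S (mulX T u) f & graph (x, 0, 0) f].
Proof.
have [v vu] := combine3_mulX D defV isoT u; have [[[x y] z] [f [h e _ /= y0 z0]]] := graph_ex (v, 0, 0).
exists f, x; rewrite y0// z0// in h e; split=> //.
by rewrite -(etrans e vu); exact: graph_is_lift.
Qed.

Lemma lift_mulY u : T' u = 0 ->
  exists f y, [/\ is_lift dot S (mulY T u) f & graph (0, y, 0) f].
Proof.
move=> Tu.
have [v vu] := combine3_mulY D defV T Tu; have [[[x y] z] [f [h e /= x0 _ z0]]] := graph_ex (0, v, 0).
exists f, y; rewrite x0// z0// in h e; split=> //.
by rewrite -(etrans e vu); exact: graph_is_lift.
Qed.

Lemma lift_mulZ u : T' u = 0 ->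
  exists f z, [/\ is_lift dot S (mulZ T u) f & graph (0, 0, z) f].
Proof.
move=> Tu.
have [v vu] := combine3_mulZ D defV T Tu; have [[[x y] z] [f [h e /= x0 y0 _]]] := graph_ex (0, 0, v).
exists f, z; rewrite x0// y0// in h e; split=> //.
by rewrite -(etrans e vu); exact: graph_is_lift.
Qed.

Let graph_orth d f d' f' : graph d f -> graph d' f' ->
  dot3 dot d d' = 0 -> dot f f' = 0.
Proof.
by move=> h h'; rewrite (polar_graph_dot (dot3_inner D) D adj3 adjS comb_adjK h h').
Qed.

(** Lifts are unique, so each one is related by the graph to a triple with a single nonzero
    component. Triples supported in different components are orthogonal and the graph preserves
    inner products. *)
Theorem lift_orthogonal x y z f g h : T' y = 0 -> T' z = 0 ->
  is_lift dot S (mulX T x) f -> is_lift dot S (mulY T y) g ->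
  is_lift dot S (mulZ T z) h -> [/\ dot f g = 0, dot f h = 0 & dot g h = 0].
Proof.
move=> Ty Tz lf lg lh.
have [f' [x' [/(is_lift_uniq lf) <- gx]]] := lift_mulX x.
have [g' [y' [/(is_lift_uniq lg) <- gy]]] := lift_mulY Ty.
have [h' [z' [/(is_lift_uniq lh) <- gz]]] := lift_mulZ Tz.
split.
- by apply: (graph_orth gx gy); rewrite /dot3 /= !(dot0l D) !(dot0r D) !addr0.
- by apply: (graph_orth gx gz); rewrite /dot3 /= !(dot0l D) !(dot0r D) !addr0.
- by apply: (graph_orth gy gz); rewrite /dot3 /= !(dot0l D) !(dot0r D) !addr0.
Qed.

End IsometryDecompositionTheorem.

(** * Square-integrable functions on the circle *)

Section CircleIntegral.
Local Open Scope classical_set_scope.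
Variable R : realType.
Local Notation C := R[i].
Local Notation mu := (@lebesgue_measure R).
Local Notation A := (@angles R).
Implicit Types u v w : R -> C.

Lemma measurable_angles : measurable A.
Proof. exact: measurable_itv. Qed.
Local Notation mA := measurable_angles.

Lemma pi2_gt0 : 0 < 2 * pi :> R.
Proof. by rewrite mulr_gt0 ?pi_gt0. Qed.

Lemma mu_angles : mu A = (2 * pi)%:E.
Proof. by rewrite /angles lebesgue_measure_itv /= lte_fin pi2_gt0 -EFinB subr0. Qed.

Definition measC u := measurable_fun A (fun t => complex.Re (u t)) /\
  measurable_fun A (fun t => complex.Im (u t)).

Lemma measC_cst (z : C) : measC (fun=> z).
Proof. by split; exact: measurable_cst. Qed.

Lemma measCD u v : measC u -> measC v -> measC (fun t => u t + v t).
Proof.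
move=> [ur ui] [vr vi]; split.
  by under eq_fun do rewrite cReD; exact: measurable_funD.
by under eq_fun do rewrite cImD; exact: measurable_funD.
Qed.

Lemma measCM u v : measC u -> measC v -> measC (fun t => u t * v t).
Proof.
move=> [ur ui] [vr vi]; split.
  by under eq_fun do rewrite cReM; apply: measurable_funB; exact: measurable_funM.
by under eq_fun do rewrite cImM; apply: measurable_funD; exact: measurable_funM.
Qed.

Lemma measCJ u : measC u -> measC (fun t => (u t)^*).
Proof.
move=> [ur ui]; split; first by under eq_fun do rewrite cReJ.
by under eq_fun do rewrite cImJ; exact: measurable_funN.
Qed.

Lemma measCB u v : measC u -> measC v -> measC (fun t => u t - v t).
Proof.
move=> [ur ui] [vr vi]; split.
  by under eq_fun do rewrite cReD cReN; exact: measurable_funB.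
by under eq_fun do rewrite cImD cImN; exact: measurable_funB.
Qed.

Lemma measC_sqmod u : measC u -> measurable_fun A (fun t => sqmod (u t)).
Proof. by move=> [ur ui]; apply: measurable_funD; exact: measurable_funX. Qed.

Lemma measC_sqmodE u : measC u -> measurable_fun A (fun t => (sqmod (u t))%:E).
Proof. by move=> /measC_sqmod h; exact/measurable_EFinP. Qed.

Definition N2 u : \bar R := \int[mu]_(t in A) (sqmod (u t))%:E.

Lemma N2_ge0 u : (0 <= N2 u)%E.
Proof. by apply: integral_ge0 => t _; rewrite lee_fin sqmod_ge0. Qed.

Lemma L2P u : L2 u <-> measC u /\ (N2 u < +oo)%E.
Proof. by split=> [[]//|[[]]]. Qed.

Lemma N2_le u v : measC u -> measC v -> (forall t, A t -> sqmod (u t) <= sqmod (v t)) ->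
  (N2 u <= N2 v)%E.
Proof.
move=> mu' mv h; apply: ge0_le_integral => //.
- exact: mA.
- by move=> t _; rewrite lee_fin sqmod_ge0.
- exact: measC_sqmodE.
- exact: measC_sqmodE.
Qed.

Lemma N2D u v : measC u -> measC v ->
  (N2 (fun t => u t + v t)%R <= 2%:E * (N2 u + N2 v))%E.
Proof.
move=> mu' mv.
rewrite -ge0_integralD; last 5 first.
- exact: mA.
- by move=> t _; rewrite lee_fin sqmod_ge0.
- exact: measC_sqmodE.
- by move=> t _; rewrite lee_fin sqmod_ge0.
- exact: measC_sqmodE.
rewrite -ge0_integralZl//; last 3 first.
- exact: mA.
- by apply: emeasurable_funD; exact: measC_sqmodE.
- by move=> t _; rewrite -EFinD lee_fin addr_ge0 ?sqmod_ge0.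
apply: ge0_le_integral => //.
- exact: mA.
- by move=> t _; rewrite lee_fin sqmod_ge0.
- by apply: measC_sqmodE; exact: measCD.
- by apply: measurable_funeM; apply: emeasurable_funD; exact: measC_sqmodE.
- by move=> t _; rewrite -EFinD -EFinM lee_fin sqmodD_le.
Qed.

Lemma N2Z (a : C) u : measC u -> N2 (fun t => a * u t) = ((sqmod a)%:E * N2 u)%E.
Proof.
move=> mu'; rewrite -ge0_integralZl//; last 4 first.
- exact: mA.
- exact: measC_sqmodE.
- by move=> t _; rewrite lee_fin sqmod_ge0.
- by rewrite lee_fin sqmod_ge0.
by apply: eq_integral => t _; rewrite sqmodM EFinM.
Qed.

Lemma L2_lin (a : C) u v : L2 u -> L2 v -> L2 (a *: u + v).
Proof.
move=> /L2P[mu' u2] /L2P[mv v2]; apply/L2P; split.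
  by apply: measCD => //; apply: measCM => //; exact: measC_cst.
apply: le_lt_trans (N2D _ mv) _; first by apply: measCM => //; exact: measC_cst.
rewrite lte_mul_pinfty// lte_add_pinfty//.
by rewrite N2Z// lte_mul_pinfty// lee_fin sqmod_ge0.
Qed.

Lemma L2_0 : L2 (0 : R -> C).
Proof.
apply/L2P; split; first exact: measC_cst.
by rewrite /N2 integral0_eq// => t _; rewrite sqmod0.
Qed.

Definition integrableC u := mu.-integrable A (fun t => (complex.Re (u t))%:E) /\
  mu.-integrable A (fun t => (complex.Im (u t))%:E).

Lemma L2_integrable u v : L2 u -> L2 v -> integrableC (fun t => u t * (v t)^*).
Proof.
move=> /L2P[mu' u2] /L2P[mv v2].
have mf := measCM mu' (measCJ mv).
have int_sq w : measC w -> (N2 w < +oo)%E -> mu.-integrable A (fun t => (sqmod (w t))%:E).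
  move=> mw w2; apply/integrableP; split; first exact: measC_sqmodE.
  rewrite (_ : integral _ _ _ = N2 w)//; apply: eq_integral => t _.
  by rewrite gee0_abs// lee_fin sqmod_ge0.
have int_sum : mu.-integrable A ((fun t => (sqmod (u t))%:E) \+ (fun t => (sqmod (v t))%:E))%E.
  by apply: integrableD; [exact: mA|exact: int_sq|exact: int_sq].
have key (f : R -> R) : measurable_fun A f ->
    (forall t, `|f t| <= sqmod (u t) + sqmod (v t)) -> mu.-integrable A (fun t => (f t)%:E).
  move=> mf' le_f; refine (le_integrable _ _ _ int_sum); first exact: mA.
    exact/measurable_EFinP.
  move=> t _; rewrite /= lee_fin.
  by rewrite [leRHS]ger0_norm ?le_f//; apply: le_trans (normr_ge0 _) (le_f t).
split; apply: key.
- exact: mf.1.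
- by move=> t; have [h _] := normReM_le (u t) (v t)^*; rewrite sqmodJ in h.
- exact: mf.2.
- by move=> t; have [_ h] := normReM_le (u t) (v t)^*; rewrite sqmodJ in h.
Qed.

Lemma circle_mean_lin (a : C) u v : integrableC u -> integrableC v ->
  circle_mean (fun t => a * u t + v t) = a * circle_mean u + circle_mean v.
Proof.
move=> [ur ui] [vr vi]; rewrite /circle_mean.
have lin (x y : R) (f g h : R -> R) :
    mu.-integrable A (EFin \o f) -> mu.-integrable A (EFin \o g) ->
    mu.-integrable A (EFin \o h) ->
    (\int[mu]_(t in A) (x * f t + y * g t + h t))%R =
    x * (\int[mu]_(t in A) f t)%R + y * (\int[mu]_(t in A) g t)%R + (\int[mu]_(t in A) h t)%R.
  move=> fi gi hi.
  have xf : mu.-integrable A (EFin \o (fun t => x * f t)).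
    by refine (integrableZl _ x fi); exact: mA.
  have yg : mu.-integrable A (EFin \o (fun t => y * g t)).
    by refine (integrableZl _ y gi); exact: mA.
  have xyfg : mu.-integrable A (EFin \o (fun t => x * f t + y * g t)).
    by refine (integrableD _ xf yg); exact: mA.
  rewrite (RintegralD _ xyfg hi); last exact: mA.
  rewrite (RintegralD _ xf yg); last exact: mA.
  by rewrite (RintegralZl _ _ fi) ?(RintegralZl _ _ gi)//; exact: mA.
have -> : (\int[mu]_(t in A) complex.Re (a * u t + v t))%R =
    complex.Re a * (\int[mu]_(t in A) complex.Re (u t))%R +
    - complex.Im a * (\int[mu]_(t in A) complex.Im (u t))%R +
    (\int[mu]_(t in A) complex.Re (v t))%R.
  by rewrite -lin//; apply: eq_Rintegral => t _; rewrite !complexDE mulNr.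
have -> : (\int[mu]_(t in A) complex.Im (a * u t + v t))%R =
    complex.Re a * (\int[mu]_(t in A) complex.Im (u t))%R +
    complex.Im a * (\int[mu]_(t in A) complex.Re (u t))%R +
    (\int[mu]_(t in A) complex.Im (v t))%R.
  by rewrite -lin//; apply: eq_Rintegral => t _; rewrite !complexDE.
by case: a => x y; apply/eqP; rewrite eq_complex !complexDE /=; apply/andP; split; apply/eqP; ring.
Qed.

Lemma circle_meanJ u : integrableC u ->
  circle_mean (fun t => (u t)^*) = (circle_mean u)^*.
Proof.
move=> [ur ui]; rewrite /circle_mean.
have -> : (\int[mu]_(t in A) complex.Im (u t)^*)%R =
    - (\int[mu]_(t in A) complex.Im (u t))%R.
  rewrite -[RHS]mulN1r -RintegralZl//; last exact: mA.
  by apply: eq_Rintegral => t _; rewrite cImJ mulN1r.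
have -> : (\int[mu]_(t in A) complex.Re (u t)^*)%R = (\int[mu]_(t in A) complex.Re (u t))%R.
  by apply: eq_Rintegral => t _; rewrite cReJ.
by apply/eqP; rewrite eq_complex !complexDE /=; apply/andP; split; apply/eqP; ring.
Qed.

Lemma L2_dot_self u : L2 u -> L2_dot u u = ((2 * pi)^-1 * fine (N2 u))%:C%C.
Proof.
move=> _; rewrite /L2_dot /circle_mean.
have -> : (\int[mu]_(t in A) complex.Re (u t * (u t)^*))%R = fine (N2 u).
  by congr fine; apply: eq_integral => t _; rewrite -sqmodC.
have -> : (\int[mu]_(t in A) complex.Im (u t * (u t)^*))%R = 0.
  rewrite (@eq_Rintegral _ _ _ _ _ (cst 0)); first by rewrite Rintegral_cst ?mul0r//; exact: mA.
  by move=> t _; rewrite -sqmodC.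
by rewrite -rmorphM.
Qed.

End CircleIntegral.

(** * The semi-inner product space L^2 and Fatou's lemma *)

Section L2Space.
Local Open Scope classical_set_scope.
Variable R : realType.
Local Notation C := R[i].
Local Notation mu := (@lebesgue_measure R).
Local Notation A := (@angles R).
Local Notation mA := (@measurable_angles R).

Definition L2pred : {pred (R -> C)} := fun u => u \in @L2 R.

Lemma L2_submod : submod_closed L2pred.
Proof.
split; first by rewrite /L2pred; apply/mem_set/L2_0.
by move=> a u v /set_mem hu /set_mem hv; apply/mem_set/L2_lin.
Qed.

HB.instance Definition _ := GRing.isSubmodClosed.Build C (R -> C) L2pred L2_submod.

(** The elements are functions, so their values at points can be used in pointwise limits. *)
Record L2t := MkL2t { L2val :> R -> C; _ : L2val \in L2pred }.
HB.instance Definition _ := [isSub for L2val].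
HB.instance Definition _ := [Choice of L2t by <:].
HB.instance Definition _ := [SubChoice_isSubLmodule of L2t by <:].

Definition mkL2 u (h : L2 u) : L2t := MkL2t (mem_set h).

Lemma L2tP (u : L2t) : L2 (L2val u).
Proof. by case: u => u h; exact: set_mem. Qed.

Definition L2d (u v : L2t) : C := L2_dot (L2val u) (L2val v).

Lemma L2_measC (u : L2t) : measC (L2val u).
Proof. by have [] := (L2P _).1 (L2tP u). Qed.

Lemma L2d_inner : inner L2d.
Proof.
split=> [a u v w|u v|u]; rewrite /L2d.
- rewrite /L2_dot -circle_mean_lin; try exact: L2_integrable (L2tP _) (L2tP _).
  by congr circle_mean; apply/funext => t; rewrite mulrDl mulrA.
- rewrite /L2_dot -circle_meanJ; last exact: L2_integrable (L2tP _) (L2tP _).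
  by congr circle_mean; apply/funext => t; rewrite rmorphM /= conjCK mulrC.
- rewrite L2_dot_self; last exact: L2tP.
  by rewrite ler0c mulr_ge0 ?invr_ge0 ?(ltW (pi2_gt0 R))// fine_ge0// N2_ge0.
Qed.

Lemma N2_sqn (u : L2t) : N2 (L2val u) = (2 * pi * sqn L2d u)%:E.
Proof.
rewrite /sqn /L2d L2_dot_self; last exact: L2tP.
rewrite /= mulrA mulfV ?mul1r ?gt_eqF ?(pi2_gt0 R)// fineK//.
by rewrite ge0_fin_numE ?N2_ge0//; have [] := (L2P _).1 (L2tP u).
Qed.

Lemma N2_le_sqn (u : L2t) (M : R) : (N2 (L2val u) <= (2 * pi * M)%:E)%E = (sqn L2d u <= M).
Proof. by rewrite N2_sqn lee_fin ler_pM2l// pi2_gt0. Qed.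

Lemma limn_einf_le (x : nat -> \bar R) (M : \bar R) : (forall n, (x n <= M)%E) ->
  (limn_einf x <= M)%E.
Proof.
move=> h; rewrite limn_einf_lim; apply: lime_le; first exact: is_cvg_einfs.
apply: nearW => n; apply: le_trans (h n); apply: ereal_inf_lbound.
by exists n => /=.
Qed.

Lemma sqmod_cvg (z : nat -> C) (l : C) : (fun n => sqmod (z n - l)) @ \oo --> (0 : R) ->
  [/\ (fun n => complex.Re (z n)) @ \oo --> complex.Re l,
      (fun n => complex.Im (z n)) @ \oo --> complex.Im l &
      (fun n => sqmod (z n)) @ \oo --> sqmod l].
Proof.
move=> h.
have hr : (fun n => complex.Re (z n)) @ \oo --> complex.Re l.
  apply/cvgrPdist_le => e e0; have [N hN] := cvg0_epsP h (exprn_gt0 2 e0).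
  exists N => // n /hN; rewrite /sqmod !complexDE => /= hn.
  rewrite -(@ler_pXn2r _ 2)// ?nnegrE ?(ltW e0)// real_normK ?num_real//.
  by rewrite -sqrrN opprB; apply: le_trans hn; rewrite lerDl sqr_ge0.
have hi : (fun n => complex.Im (z n)) @ \oo --> complex.Im l.
  apply/cvgrPdist_le => e e0; have [N hN] := cvg0_epsP h (exprn_gt0 2 e0).
  exists N => // n /hN; rewrite /sqmod !complexDE => /= hn.
  rewrite -(@ler_pXn2r _ 2)// ?nnegrE ?(ltW e0)// real_normK ?num_real//.
  by rewrite -sqrrN opprB; apply: le_trans hn; rewrite lerDr sqr_ge0.
by split=> //; apply: cvgD; [exact: (cvgM hr hr)|exact: (cvgM hi hi)].
Qed.

Lemma cvg_sqmod (z : nat -> C) (lr li : R) :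
  (fun n => complex.Re (z n)) @ \oo --> lr -> (fun n => complex.Im (z n)) @ \oo --> li ->
  (fun n => sqmod (z n - (lr +i* li)%C)) @ \oo --> (0 : R).
Proof.
move=> hr hi.
have h1 : (fun n => complex.Re (z n) - lr) @ \oo --> (0 : R).
  by rewrite -[X in _ --> X](subrr lr); apply: cvgB => //; exact: cvg_cst.
have h2 : (fun n => complex.Im (z n) - li) @ \oo --> (0 : R).
  by rewrite -[X in _ --> X](subrr li); apply: cvgB => //; exact: cvg_cst.
have h3 : (fun n => (complex.Re (z n) - lr) ^+ 2 + (complex.Im (z n) - li) ^+ 2)
    @ \oo --> (0 : R).
  have e0 : 0 = 0 * 0 + 0 * 0 :> R by rewrite mulr0 addr0.
  rewrite [X in _ --> X]e0.
  by apply: cvgD; [exact: (cvgM h1 h1)|exact: (cvgM h2 h2)].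
by apply: (cvg0_le _ h3) => n; rewrite sqmod_ge0 /sqmod !complexDE lexx.
Qed.

(** Fatou's lemma for [sqmod], where the lower limit is a genuine limit. Both the completeness of
    L^2 and the L^2 summation of Taylor series on circles rest on it. *)
Lemma L2_fatou (v : nat -> L2t) (w : R -> C) (M : R) :
  (forall t, A t -> (fun n => sqmod (v n t - w t)) @ \oo --> (0 : R)) ->
  (forall n, sqn L2d (v n) <= M) -> L2 w /\ (N2 w <= (2 * pi * M)%:E)%E.
Proof.
move=> hv hM.
have mw : measC w.
  split.
    apply: (@measurable_fun_cvg _ _ _ _ (fun n t => complex.Re (v n t))).
      by move=> n; have [] := L2_measC (v n).
    by move=> t /hv /sqmod_cvg[].
  apply: (@measurable_fun_cvg _ _ _ _ (fun n t => complex.Im (v n t))).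
    by move=> n; have [] := L2_measC (v n).
  by move=> t /hv /sqmod_cvg[].
have bw : (N2 w <= (2 * pi * M)%:E)%E.
  apply: le_trans (limn_einf_le (x := fun n => N2 (v n)) _); last first.
    by move=> n; rewrite N2_le_sqn.
  rewrite /N2; have -> : (\int[mu]_(t in A) (sqmod (w t))%:E =
      \int[mu]_(t in A) limn_einf (fun n => (sqmod (v n t))%:E))%E.
    apply: eq_integral => t /set_mem /hv /sqmod_cvg[_ _] h.
    rewrite (cvg_limn_einf_sup (l := (sqmod (w t))%:E))//.
    by apply: cvg_EFin => //; exact: nearW.
  apply: fatou; first exact: mA.
    by move=> n; apply: measC_sqmodE; exact: L2_measC.
  by move=> n t _; rewrite lee_fin sqmod_ge0.
by split=> //; apply/L2P; split=> //; apply: le_lt_trans bw _; rewrite ltry.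
Qed.

End L2Space.

Section NonnegativeSeries.
Local Open Scope classical_set_scope.
Variable R : realType.
Implicit Types f : nat -> R.

Lemma nneseries_ltyP f : (forall n, 0 <= f n) ->
  (\sum_(0 <= n <oo) (f n)%:E < +oo)%E <->
  exists M, forall N, \sum_(0 <= n < N) f n <= M.
Proof.
move=> f0; have fE0 n : (0 <= (f n)%:E)%E by rewrite lee_fin.
split=> [h|[M hM]].
  have fin : (\sum_(0 <= n <oo) (f n)%:E)%E \is a fin_num.
    by rewrite ge0_fin_numE// nneseries_ge0.
  exists (fine (\sum_(0 <= n <oo) (f n)%:E)%E) => N.
  by rewrite -lee_fin fineK// -sumEFin; apply: nneseries_lim_ge.
apply: le_lt_trans (_ : M%:E < +oo)%E; last exact: ltry.
apply: lime_le; first exact: is_cvg_nneseries.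
by apply: nearW => N; rewrite sumEFin lee_fin.
Qed.

Lemma bounded_series_cvg f M : (forall n, 0 <= f n) ->
  (forall N, \sum_(0 <= n < N) f n <= M) -> cvgn (series f).
Proof.
move=> f0 hM; apply: nondecreasing_is_cvgn; last by exists M => _ [n _ <-]; exact: hM.
by apply/nondecreasing_seqP => n; rewrite /series /= big_nat_recr//= lerDl.
Qed.

End NonnegativeSeries.

(** * Completeness of L^2 *)

Section L2Complete.
Local Open Scope classical_set_scope.
Variable R : realType.
Local Notation C := R[i].
Local Notation mu := (@lebesgue_measure R).
Local Notation A := (@angles R).
Local Notation mA := (@measurable_angles R).
Local Notation L2t := (L2t R).
Local Notation L2d := (@L2d R).

(** Linear terms are traded for squares, whose integrals are the ones under control; [e] is tuned to
    the size of the function. *)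
Lemma normRe_Im_le (z : C) (e : R) : 0 < e ->
  `|complex.Re z| + `|complex.Im z| <= e + e^-1 * sqmod z.
Proof.
move=> e0; rewrite /sqmod -(real_normK (num_real (complex.Re z))).
rewrite -(real_normK (num_real (complex.Im z))).
move: `|_| `|complex.Im _| => x y.
rewrite -subr_ge0.
have -> : e + e^-1 * (x ^+ 2 + y ^+ 2) - (x + y) =
    e^-1 * ((x - e / 2) ^+ 2 + (y - e / 2) ^+ 2 + e ^+ 2 / 2) by field; rewrite gt_eqF.
by rewrite mulr_ge0 ?invr_ge0 ?(ltW e0)// !addr_ge0 ?sqr_ge0// divr_ge0 ?sqr_ge0.
Qed.

(** As in the Riesz-Fischer theorem, the sum [g] of the absolute increments has finite integral, so
    it is finite almost everywhere, and there the telescoping series of increments converges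
    absolutely. *)
Lemma fast_subsequence_ae (v : nat -> L2t) :
  (forall k, sqn L2d (v k.+1 - v k) <= 4^-1 ^+ k) ->
  {ae mu, forall t, A t -> exists l : C, (fun k => sqmod (v k t - l)) @ \oo --> (0 : R)}.
Proof.
move=> hv; pose w k := v k.+1 - v k.
pose d k t := `|complex.Re (w k t)| + `|complex.Im (w k t)|.
have d0 k t : 0 <= d k t by rewrite addr_ge0.
have md k : measurable_fun A (fun t => (d k t)%:E).
  have [wr wi] := L2_measC (w k).
  by apply/measurable_EFinP; apply: measurable_funD; exact: measurableT_comp.
pose g t : \bar R := (\sum_(0 <= k <oo) (d k t)%:E)%E.
have mg : measurable_fun A g.
  apply: (@emeasurable_fun_cvg _ _ _ _ (fun n t => \sum_(0 <= k < n) (d k t)%:E)%E) => [n|t At].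
    exact: emeasurable_sum.
  by apply: is_cvg_nneseries => n _ _; rewrite lee_fin.
(* AM-GM: an increment of L^2 norm at most 2^-k has L^1 norm of order 2^-k *)
have int_d k : (\int[mu]_(t in A) (d k t)%:E <= (4 * pi * 2^-1 ^+ k)%:E)%E.
  have p0 : (0 : R) < 2^-1 ^+ k by rewrite exprn_gt0// invr_gt0.
  have m1 : measurable_fun A (fun t => (2 ^+ k)%:E * (sqmod (w k t))%:E)%E.
    by apply: measurable_funeM; apply: measC_sqmodE; exact: L2_measC.
  have m2 : measurable_fun A (fun t => (2^-1 ^+ k)%:E + (2 ^+ k)%:E * (sqmod (w k t))%:E)%E.
    by apply: emeasurable_funD => //; exact: measurable_cst.
  apply: (@le_trans _ _ (\int[mu]_(t in A) ((2^-1 ^+ k)%:E + (2 ^+ k)%:E * (sqmod (w k t))%:E))%E).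
    apply: ge0_le_integral => //.
    - exact: mA.
    - by move=> t _; rewrite lee_fin.
    - exact: md.
    - move=> t _; rewrite -EFinM -EFinD lee_fin.
      by have := normRe_Im_le (w k t) p0; rewrite -exprVn invrK.
  rewrite ge0_integralD//; first last.
  - by move=> t _; rewrite -EFinM lee_fin mulr_ge0 ?exprn_ge0 ?sqmod_ge0.
  - exact: mA.
  rewrite integral_cst ?ge0_integralZl//; first last.
  - exact: mA.
  - by move=> t _; rewrite lee_fin sqmod_ge0.
  - by apply: measC_sqmodE; exact: L2_measC.
  - exact: mA.
  rewrite -[X in (_ * X + _)%E]/(mu A) mu_angles.
  rewrite -[X in (_ + _ * X)%E]/(N2 (L2val (w k))) N2_sqn -!EFinM -EFinD lee_fin.
  have -> : 4 * pi * 2^-1 ^+ k = 2^-1 ^+ k * (2 * pi) + 2 ^+ k * (2 * pi * 4^-1 ^+ k) :> R.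
    have -> : 4^-1 ^+ k = 2^-1 ^+ k * 2^-1 ^+ k :> R.
      by rewrite -exprMn; congr (_ ^+ _); field.
    by rewrite exprVn; field; rewrite expf_neq0.
  by rewrite lerD2l ler_wpM2l ?exprn_ge0// ler_wpM2l ?(ltW (pi2_gt0 R))// hv.
have int_g : (\int[mu]_(t in A) g t < +oo)%E.
  rewrite integral_nneseries//; last 2 first.
  - exact: mA.
  - by move=> n t _; rewrite lee_fin.
  apply: le_lt_trans (_ : (\sum_(0 <= k <oo) (4 * pi * 2^-1 ^+ k)%:E < +oo)%E).
    apply: lee_nneseries => // k _ _.
    by apply: integral_ge0 => t _; rewrite lee_fin.
  apply/nneseries_ltyP => [n|].
    by rewrite mulr_ge0 ?exprn_ge0 ?invr_ge0// mulr_ge0 ?pi_ge0.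
  exists (4 * pi * 2) => N; rewrite -mulr_sumr ler_pM2l ?mulr_gt0 ?pi_gt0//.
  have -> : \sum_(0 <= k < N) 2^-1 ^+ k = 2 - 2 * 2^-1 ^+ N :> R.
    elim: N => [|N ih]; first by rewrite big_geq// expr0 mulr1 subrr.
    by rewrite big_nat_recr//= ih exprS; field.
  by rewrite gerBl mulr_ge0 ?exprn_ge0 ?invr_ge0.
have ig : mu.-integrable A g.
  apply/integrableP; split=> //.
  apply: le_lt_trans int_g; rewrite le_eqVlt; apply/orP; left; apply/eqP.
  apply: eq_integral => t _; rewrite gee0_abs// nneseries_ge0// => n _ _.
  by rewrite lee_fin.
have aeg : {ae mu, forall t, A t -> g t \is a fin_num}.
  by refine (integrable_ae _ ig); exact: mA.
apply: negligibleS aeg => t; apply: contra_not => ht At.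
have gt : (g t < +oo)%E by rewrite -ge0_fin_numE ?ht// nneseries_ge0// => n _ _; rewrite lee_fin.
have /nneseries_ltyP[//|M hM] := gt.
have cvR (p : C -> R) : (forall x y, p (x - y) = p x - p y) -> (forall k, `|p (w k t)| <= d k t) ->
    exists l : R, (fun k => p (v k t)) @ \oo --> l.
  move=> pB pd.
  have : cvgn (series (fun k => p (w k t))).
    apply: normed_cvg.
    apply: (@bounded_series_cvg _ (fun k => `|p (w k t)|) M) => [k|N]; first exact: normr_ge0.
    by apply: le_trans (hM N); apply: ler_sum => k _; exact: pd.
  move=> /cvg_ex[l hl]; exists (p (v 0%N t) + l).
  have -> : (fun k => p (v k t)) = (fun k => p (v 0%N t) + series (fun k => p (w k t)) k).
    apply/funext; elim=> [|k ih]; first by rewrite /series /= big_geq// addr0.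
    by rewrite /series /= big_nat_recr//= addrA -ih pB addrC subrK.
  by apply: cvgD => //; exact: cvg_cst.
have [lr hr] : exists l : R, (fun k => complex.Re (v k t)) @ \oo --> l.
  by apply: cvR => [x y|k]; [rewrite cReD cReN|rewrite lerDl].
have [li hi] : exists l : R, (fun k => complex.Im (v k t)) @ \oo --> l.
  by apply: cvR => [x y|k]; [rewrite cImD cImN|rewrite lerDr].
by exists (lr +i* li)%C; exact: cvg_sqmod.
Qed.

Theorem L2_complete : cauchy_complete L2d.
Proof.
move=> u cu.
have D := @L2d_inner R.
have /choice[N hN] k : exists N, forall m n, (N <= m)%N -> (N <= n)%N ->
    sqn L2d (u m - u n) <= 4^-1 ^+ k.
  by apply: cu; rewrite exprn_gt0 ?invr_gt0.
(* Summing the thresholds makes [phi] nondecreasing while keeping [N k <= phi k]. *)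
pose phi k := (\sum_(j < k.+1) N j)%N.
have phi_ge k : (N k <= phi k)%N by rewrite /phi big_ord_recr /= leq_addl.
have phi_mono k j : (phi k <= phi (k + j))%N.
  elim: j => [|j ih]; first by rewrite addn0.
  by rewrite addnS (leq_trans ih)// /phi [leqRHS]big_ord_recr /= leq_addr.
pose v k := u (phi k).
have vv k j : sqn L2d (v (k + j)%N - v k) <= 4^-1 ^+ k.
  by apply: hN => //; apply: leq_trans (phi_mono k j).
have := @fast_subsequence_ae v; case=> [k|E [mE E0 hE]].
  by have := vv k 1%N; rewrite addn1.
(* [L2_fatou] wants convergence at every angle. Multiplying by the indicator of the complement of
   the exceptional set [E] provides it at the cost of a vector of seminorm 0. *)
pose ind t : C := (\1_(~` E) t : R)%:C%C.
have sqmod_ind t : sqmod (ind t) <= 1.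
  by rewrite sqmod_real indicE; case: (_ \in _); rewrite ?expr1n ?expr0n.
have m_ind : measC ind.
  split; last exact: measurable_cst.
  by apply: measurable_indic; apply: measurableC.
have L2ind (x : L2t) : L2 (fun t => ind t * L2val x t).
  have [mx x2] := (L2P _).1 (L2tP x).
  have mi := measCM m_ind mx.
  apply/L2P; split=> //; apply: le_lt_trans (N2_le mi mx _) x2 => t _.
  by rewrite sqmodM ler_piMl ?sqmod_ge0.
pose ivL x := mkL2 (L2ind x).
have ind_le x : sqn L2d (ivL x) <= sqn L2d x.
  rewrite -N2_le_sqn -N2_sqn; apply: N2_le; [exact: (L2_measC (ivL x))|exact: L2_measC|].
  by move=> t _; rewrite /= sqmodM ler_piMl ?sqmod_ge0.
have ind_out t : ~ E t -> ind t = 1.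
  by move=> tE; rewrite /ind indicE mem_set.
have ind_ae x : sqn L2d (ivL x - x) = 0.
  have p0 := pi2_gt0 R.
  suff : N2 (L2val (ivL x - x)) = 0%E.
    rewrite N2_sqn => /eqP; rewrite eqe mulf_eq0 gt_eqF//= => /eqP //.
  rewrite /N2 (_ : integral _ _ _ = \int[mu]_(t in A) cst 0%E t)%E; first exact: integral0.
  have mf : measurable_fun A (fun t => (sqmod ((ivL x - x) t))%:E).
    exact: (measC_sqmodE (L2_measC (ivL x - x))).
  apply: ae_eq_integral; [exact: mA|exact: mf|exact: measurable_cst|].
  exists E; split=> // t /= h; apply: contrapT => tE; apply: h => _.
  by rewrite /= fctE /= /ind -/(ind t) ind_out// mul1r subrr sqmod0.
have /choice[w hw] t : exists l : C, A t -> (fun k => sqmod (ivL (v k) t - l)) @ \oo --> (0 : R).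
  have [tE|tE] := pselect (E t).
    exists 0 => _; rewrite (_ : (fun k => _) = fun=> 0); first exact: cvg_cst.
    apply/funext => k; rewrite /= /ind indicE memNset ?mul0r ?subr0 ?sqmod0//.
  have [At|nAt] := pselect (A t); last by exists 0 => /nAt.
  have [l hl] : exists l : C, (fun k => sqmod (v k t - l)) @ \oo --> (0 : R).
    by apply: contrapT => nl; apply: tE; apply: hE => /= h; apply: nl; exact: h At.
  exists l => _; apply: cvg0_le hl => k; rewrite sqmod_ge0 /=.
  by rewrite -/(ind t) ind_out// mul1r.
have ivLB x y : ivL x - ivL y = ivL (x - y).
  by apply/val_inj/funext => t; rewrite /= !fctE mulrBr.
have fat m : L2 (fun t => w t - ivL (v m) t) /\
    (N2 (fun t => w t - ivL (v m) t)%R <= (2 * pi * 4^-1 ^+ m)%:E)%E.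
  apply: (@L2_fatou _ (fun k => ivL (v (m + k)%N) - ivL (v m))) => [t At|k].
    have := hw t At; rewrite -(cvg_shiftn m) => h; apply: cvg0_le h => k.
    by rewrite sqmod_ge0 /= addnC opprB addrA subrK.
  by rewrite ivLB; apply: le_trans (ind_le _) (vv m k).
have L2w : L2 w.
  have := L2_lin 1 (fat 0%N).1 (L2tP (ivL (v 0%N))); congr L2.
  by apply/funext => t; rewrite !fctE scale1r subrK.
pose W := mkL2 L2w.
have hW m : sqn L2d (W - v m) <= 2 * 4^-1 ^+ m.
  apply: le_trans (sqn_tri D W (v m) (ivL (v m))) _.
  rewrite [sqn _ (v m - _)](sqnC D) ind_ae addr0 ler_pM2l// -N2_le_sqn.
  exact: (fat m).2.
exists W; apply: cvg0_eps => [n|e e0]; first exact: sqn_ge0.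
(* The final estimate is [2 (4^-m + 2 * 4^-m) = 6 * 4^-m]. *)
have e60 : 0 < e / 6 by rewrite divr_gt0.
have lt41 : `|4^-1 : R| < 1 by rewrite ger0_norm ?invr_ge0// invf_lt1// ltr1n.
have [m hm] := cvg0_epsP (cvg_expr lt41) e60.
exists (phi m) => n hn; apply: le_trans (sqn_tri D _ _ (v m)) _.
have h1 : sqn L2d (u n - v m) <= 4^-1 ^+ m by apply: hN => //; apply: leq_trans hn.
move: (hm m (leqnn m)) (hW m) h1.
move: (4^-1 ^+ m) (sqn L2d (u n - v m)) (sqn L2d (W - v m)) => p x y hp hy hx.
by clear -hp hy hx; lra.
Qed.

End L2Complete.

Section RealTails.
Local Open Scope classical_set_scope.
Variable R : realType.
Implicit Types f : nat -> R.

Lemma bounded_series_tail f M e : (forall n, 0 <= f n) ->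
  (forall N, \sum_(0 <= n < N) f n <= M) -> 0 < e ->
  exists N, forall m n, (N <= m)%N -> (m <= n)%N -> \sum_(m <= k < n) f k <= e.
Proof.
move=> f0 hM e0; have /cvg_ex[l hl] := bounded_series_cvg f0 hM.
have nd : {homo series f : n m / (n <= m)%N >-> n <= m}.
  by apply/nondecreasing_seqP => n; rewrite /series /= big_nat_recr//= lerDl.
have le_l n : series f n <= l.
  by have /cvg_lim <- // := hl; apply: nondecreasing_cvgn_le => //; apply/cvg_ex; exists l.
have := (cvgrPdist_le _ _).1 hl e e0; case=> N _ hN.
exists N => m n Nm mn.
have -> : \sum_(m <= k < n) f k = series f n - series f m.
  by rewrite /series /= [in RHS](big_cat_nat (n := m))//= addrAC subrr add0r.
have := hN m Nm; rewrite /= ger0_norm ?subr_ge0// => h.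
by apply: le_trans h; rewrite lerD2r.
Qed.

End RealTails.

(** * Orthonormal sequences *)

Section Orthonormal.
Local Open Scope classical_set_scope.
Variables (R : realType) (V : lmodType R[i]) (dot : V -> V -> R[i]).
Hypothesis D : inner dot.
Variable e : nat -> V.
Hypothesis ortho : forall m n, dot (e m) (e n) = (m == n)%:R.
Implicit Types (a b : nat -> R[i]).
Local Notation sqn := (sqn dot).

Definition psum a N := \sum_(0 <= n < N) a n *: e n.

Lemma dot_sum_nat a (u : nat -> V) m n w :
  dot (\sum_(m <= k < n) a k *: u k) w = \sum_(m <= k < n) a k * dot (u k) w.
Proof.
rewrite (big_morph (dot^~ w) (id1 := 0) (op1 := +%R)).
- by apply: eq_bigr => k _; rewrite (dotZl D).
- by move=> x y; rewrite (dotDl D).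
- by rewrite (dot0l D).
Qed.

Lemma dot_range_e a m n k : dot (\sum_(m <= j < n) a j *: e j) (e k) =
  if (m <= k < n)%N then a k else 0.
Proof.
rewrite dot_sum_nat.
under eq_bigr do rewrite ortho.
case: ifP => kn.
  rewrite (bigD1_seq k) ?mem_index_iota ?iota_uniq//= eqxx mulr1 big1 ?addr0// => j jk.
  by rewrite (negbTE jk) mulr0.
rewrite big1_seq// => j /=; rewrite mem_index_iota => jn.
by case: eqP => [jk|_]; rewrite ?mulr0//; rewrite jk kn in jn.
Qed.

Lemma sqn_range a m n : sqn (\sum_(m <= j < n) a j *: e j) = \sum_(m <= j < n) sqmod (a j).
Proof.
apply: (@complexI R); rewrite -(dot_sqn D) dot_sum_nat raddf_sum /=.
apply: eq_big_nat => j mjn.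
by rewrite (dotJ D) dot_range_e mjn sqmodC.
Qed.

Lemma psumB a m n : (m <= n)%N -> psum a n - psum a m = \sum_(m <= j < n) a j *: e j.
Proof.
by move=> mn; rewrite /psum (big_cat_nat (n := m))//= addrAC subrr add0r.
Qed.

Lemma bessel u N : \sum_(0 <= n < N) sqmod (dot u (e n)) <= sqn u.
Proof.
pose a n := dot u (e n).
have := sqn_ge0 D (u - psum a N); rewrite (sqnB D) sqn_range.
have -> : complex.Re (dot u (psum a N)) = \sum_(0 <= n < N) sqmod (a n).
  rewrite (dotJ D) cReJ dot_sum_nat.
  have -> : \sum_(0 <= k < N) a k * dot (e k) u = (\sum_(0 <= n < N) sqmod (a n))%:C%C.
    rewrite raddf_sum; apply: eq_bigr => k _.
    by rewrite (dotJ D u) /= sqmodC.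
  by [].
rewrite mulr2n mulrDl mul1r opprD addrA subrK; lra.
Qed.

Definition square_summable a := exists M, forall N, \sum_(0 <= n < N) sqmod (a n) <= M.

Lemma psum_cauchy a : square_summable a -> cauchy_seq dot (psum a).
Proof.
move=> [M hM] eps eps0.
have [N hN] := bounded_series_tail (fun n => sqmod_ge0 (a n)) hM eps0.
have key m n : (N <= m)%N -> (m <= n)%N -> sqn (psum a n - psum a m) <= eps.
  by move=> Nm mn; rewrite psumB// sqn_range hN.
exists N => m n Nm Nn; have [mn|/ltnW nm] := leqP m n; last exact: key.
by rewrite (sqnC D) key.
Qed.

Lemma tends_psum_coef a u n : tends dot (psum a) u -> dot u (e n) = a n.
Proof.
move=> h; apply/eqP; rewrite -subr_eq0; apply/eqP/sqmod_eq0.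
have h2 := tends_dot D h (tends_cst D (e n)).
(* From index [n.+1] on, the partial sums contain the term [n], so their inner product with [e n] is
   exactly [a n]. *)
have h3 := h2; rewrite -(cvg_shiftn n.+1) in h3.
apply: (cst_cvg0_eq0 (sqmod_ge0 _) _ h3) => k.
by rewrite /= /psum dot_range_e /= ltn_addl// -sqmodN opprB.
Qed.

Lemma parseval_sqn a u : tends dot (psum a) u ->
  (fun N => \sum_(0 <= n < N) sqmod (a n)) @ \oo --> sqn u.
Proof.
move=> hu; have h := tends_dot D hu hu.
have [hr _ _] := sqmod_cvg h; move: hr; rewrite (dot_sqn D) /=.
rewrite (_ : (fun N => _) = (fun N => \sum_(0 <= n < N) sqmod (a n)))//.
by apply/funext => N; rewrite -/(sqn _) sqn_range.
Qed.

End Orthonormal.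

(** * Orthonormality of the exponentials *)

Section CircleExponentials.
Local Open Scope classical_set_scope.
Variable R : realType.
Local Notation C := R[i].
Local Notation mu := (@lebesgue_measure R).
Local Notation A := (@angles R).
Local Notation mA := (@measurable_angles R).

Lemma expiD (s t : R) : expi (s + t) = expi s * expi t.
Proof. by rewrite /expi sinD cosD; apply/eqP; rewrite eq_complex /=; apply/andP; split; apply/eqP; ring. Qed.

Lemma expi0 : expi 0 = 1 :> C.
Proof. by rewrite /expi cos0 sin0. Qed.

Lemma expiX (t : R) n : expi t ^+ n = expi (n%:R * t).
Proof.
elim: n => [|n ih]; first by rewrite expr0 mul0r expi0.
by rewrite exprS ih -expiD -nat1r mulrDl mul1r.
Qed.

Lemma sqmod_expi (t : R) : sqmod (expi t) = 1.
Proof. by rewrite /sqmod /= cos2Dsin2. Qed.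

Lemma expiMJ (t : R) : expi t * (expi t)^* = 1 :> C.
Proof. by rewrite -sqmodC sqmod_expi. Qed.

Lemma measC_expi n : measC (fun t : R => expi t ^+ n).
Proof.
elim: n => [|n ih]; first by under eq_fun do rewrite expr0; exact: measC_cst.
under eq_fun do rewrite exprS.
apply: measCM ih; split; apply: measurable_funTS; apply: continuous_measurable_fun.
  exact: continuous_cos.
exact: continuous_sin.
Qed.

Lemma L2_bounded (u : R -> C) (M : R) : measC u ->
  (forall t, A t -> sqmod (u t) <= M) -> L2 u /\ (N2 u <= (2 * pi * M)%:E)%E.
Proof.
move=> mu' hM.
have bd : (N2 u <= (2 * pi * M)%:E)%E.
  rewrite EFinM -mu_angles muleC -integral_cst; last exact: mA.
  apply: ge0_le_integral => //.
  - exact: mA.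
  - by move=> t _; rewrite lee_fin sqmod_ge0.
  - exact: measC_sqmodE.
by split=> //; apply/L2P; split=> //; apply: le_lt_trans bd (ltry _).
Qed.

Lemma L2_expi n : L2 (fun t : R => expi t ^+ n).
Proof.
apply: (@L2_bounded _ 1 (measC_expi n) _).1 => t _.
by rewrite sqmodX sqmod_expi expr1n.
Qed.

Definition circle_exp n : L2t R := mkL2 (L2_expi n).

Lemma int_periodic (f F : R -> R) : continuous f ->
  (forall x : R, is_derive x 1 F (f x)) -> F (2 * pi) = F 0 ->
  (\int[mu]_(t in A) f t)%R = 0.
Proof.
move=> cf dF F0; rewrite /Rintegral /angles (@continuous_FTC2 _ f F).
- by rewrite F0 -EFinB subrr.
- exact: pi2_gt0.
- exact: continuous_subspaceT.
- have dFx x : derivable F x 1 by have := dF x => ?.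
  have cF : continuous F by move=> x; apply/differentiable_continuous/derivable1_diffP.
  split.
  + by move=> x _; exact: dFx.
  + by apply: cvg_at_right_filter; exact: cF.
  + by apply: cvg_at_left_filter; exact: cF.
- by move=> x _; rewrite derive1E derive_val.
Qed.

Lemma is_derive_dilation (f g : R -> R) (k x : R) : k != 0 ->
  is_derive (k * x) 1 f (g (k * x)) ->
  is_derive x 1 (fun t => k^-1 * f (k * t)) (g (k * x)).
Proof.
move=> k0 df.
have h1 : is_derive x 1 (fun t : R => k * t) k.
  by apply: is_derive_eq (is_deriveZ k (is_derive_id x 1)) _; rewrite scaler1.
have h2 : is_derive x 1 (fun t : R => f (k * t)) (k * g (k * x)).
  by apply: is_derive_eq (is_derive1_comp df h1) _; rewrite mulrC.
by apply: is_derive_eq (is_deriveZ k^-1 h2) _; rewrite /GRing.scale /= mulKf.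
Qed.

Lemma circle_mean_expi n : circle_mean (fun t : R => expi t ^+ n.+1) = 0.
Proof.
pose k : R := n.+1%:R.
have k0 : k != 0 by rewrite pnatr_eq0.
have per (f : R -> R) : periodic f (pi *+ 2) -> f (k * (2 * pi)) = f 0.
  move=> pf; have -> : k * (2 * pi) = 0 + (pi *+ 2) *+ n.+1.
    by rewrite add0r -(mulr_natl (pi *+ 2) n.+1) -(mulr_natl pi 2).
  exact: periodicn.
have ck : continuous (fun t : R => k * t).
  by move=> x; apply: cvgM; [exact: cvg_cst|exact: cvg_id].
rewrite /circle_mean.
have -> : (\int[mu]_(t in A) complex.Re (expi t ^+ n.+1))%R = 0.
  rewrite (_ : (fun t => _) = (fun t => cos (k * t))); last first.
    by apply/funext => t; rewrite expiX.
  apply: (@int_periodic _ (fun t => k^-1 * sin (k * t))).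
  - move=> x; apply: continuous_comp; [exact: ck|exact: continuous_cos].
  - by move=> x; apply: is_derive_dilation.
  - by rewrite (per sin (@sinD2pi R)) mulr0.
have -> : (\int[mu]_(t in A) complex.Im (expi t ^+ n.+1))%R = 0.
  rewrite (_ : (fun t => _) = (fun t => sin (k * t))); last first.
    by apply/funext => t; rewrite expiX.
  apply: (@int_periodic _ (fun t => k^-1 * - cos (k * t))).
  - move=> x; apply: continuous_comp; [exact: ck|exact: continuous_sin].
  - move=> x; apply: (@is_derive_dilation (fun t => - cos t)) => //.
    by apply: is_derive_eq (is_deriveN (is_derive_cos (k * x))) _; rewrite opprK.
  - by rewrite (per cos (@cosD2pi R)) mulr0.
by rewrite mulr0.
Qed.

Lemma circle_exp_ortho m n : L2d (circle_exp m) (circle_exp n) = (m == n)%:R.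
Proof.
wlog mn : m n / (n <= m)%N.
  move=> h; have [mn|/ltnW nm] := leqP n m; first exact: h.
  by rewrite (dotJ (@L2d_inner R)) h// eq_sym rmorph_nat.
rewrite /L2d /L2_dot /=.
have -> : (fun t : R => expi t ^+ m * (expi t ^+ n)^*) = (fun t => expi t ^+ (m - n)).
  apply/funext => t; rewrite -{1}(subnK mn) exprD -mulrA rmorphXn /= -exprMn expiMJ.
  by rewrite expr1n mulr1.
have [->|nm] := eqVneq m n.
  rewrite subnn (_ : (fun t => _) = fun=> 1)//.
  rewrite /circle_mean /= !Rintegral_cst; try exact: mA.
  rewrite -[X in fine X]/(mu A) mu_angles /= mul1r mul0r.
  have p0 := pi2_gt0 R; apply/eqP; rewrite eq_complex /=; apply/andP; split; apply/eqP.
    by rewrite mulr0 subr0 mulVf// gt_eqF.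
  by ring.
have : (0 < m - n)%N by rewrite subn_gt0 ltn_neqAle eq_sym nm.
by case: (m - n)%N => // k _; rewrite circle_mean_expi.
Qed.

End CircleExponentials.

(** * Dilations and boundary functions *)

Section Boundary.
Local Open Scope classical_set_scope.
Variable R : realType.
Local Notation C := R[i].
Local Notation mu := (@lebesgue_measure R).
Local Notation A := (@angles R).
Local Notation mA := (@measurable_angles R).
Local Notation L2t := (L2t R).
Local Notation L2d := (@L2d R).
Local Notation psum := (psum (@circle_exp R)).
Implicit Types (f g : disk R -> C) (a b c : nat -> C).

Lemma norm_le_sqmod (z : C) (e : R) : 0 <= e -> (`|z| <= e%:C%C) = (sqmod z <= e ^+ 2).
Proof.
move=> e0; rewrite -(@ler_pXn2r _ 2)// ?nnegrE ?normr_ge0 ?ler0c//.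
by rewrite -sqmod_norm -rmorphXn /= lecR.
Qed.

Lemma disk_sqmod (z : disk R) : sqmod (sval z) < 1.
Proof.
case: z => z /= h; rewrite -ltcR sqmod_norm.
by rewrite expr_lt1// normr_ge0.
Qed.

Lemma cvgC_sqmod (x : nat -> C) (l : C) : ((x : nat -> C^o) @ \oo --> (l : C^o)) <->
  (fun n => sqmod (x n - l)) @ \oo --> (0 : R).
Proof.
split=> h.
  apply: cvg0_eps => [n|e e0]; first exact: sqmod_ge0.
  have s0 : 0 < Num.sqrt e by rewrite sqrtr_gt0.
  have s0C : 0 < (Num.sqrt e)%:C%C :> C by rewrite ltcR.
  have [N _ hN] := (cvgrPdist_le _ _).1 h _ s0C.
  exists N => n /hN /=; rewrite norm_le_sqmod ?(ltW s0)// sqr_sqrtr ?(ltW e0)//.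
  by rewrite -sqmodN opprB.
apply/cvgrPdist_le => e e0.
have eE := ge0_complexE (ltW e0); rewrite eE ltcR in e0.
have [N hN] := cvg0_epsP h (exprn_gt0 2 e0).
exists N => // n /hN /= hn; rewrite eE norm_le_sqmod ?(ltW e0)//.
by rewrite -sqmodN opprB.
Qed.

Lemma taylorP f a : taylor f a <-> forall z,
  (fun N => sqmod (\sum_(0 <= n < N) a n * sval z ^+ n - f z)) @ \oo --> (0 : R).
Proof. by split=> h z; apply/cvgC_sqmod; exact: h. Qed.

Lemma dilateE (r t : R) : 0 <= r < 1 ->
  exists z : disk R, sval z = r%:C%C * expi t /\ forall f, dilate f r t = f z.
Proof.
move=> /andP[r0 r1].
have h : `|r%:C%C * expi t| < 1.
  rewrite -(@expr_lt1 _ 2)// ?normr_ge0// -sqmod_norm ltcR sqmodM sqmod_expi mulr1.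
  by rewrite sqmod_real expr_lt1.
by exists (exist (fun z : C => is_true (`|z| < 1)) _ h); split=> // f; rewrite /dilate insubT.
Qed.

Lemma psumE a N (t : R) : psum a N t = \sum_(0 <= n < N) a n * expi t ^+ n.
Proof.
rewrite /psum; elim: N => [|N ih]; first by rewrite !big_geq.
by rewrite !big_nat_recr //= -ih.
Qed.

(** Fatou's lemma applied to [psum c (k + n) - psum c n] as [k] grows bounds [w - psum c n] by a
    tail of the coefficient series, so the pointwise sum is also the L^2 sum. *)
Lemma psum_pointwise_tends c (w : R -> C) : square_summable c ->
  (forall t, A t -> (fun N => sqmod (psum c N t - w t)) @ \oo --> (0 : R)) ->
  exists W : L2t, L2val W = w /\ tends L2d (psum c) W.
Proof.
move=> [M hM] hw; have D := @L2d_inner R.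
have fat e : 0 < e -> exists N, forall n, (N <= n)%N ->
    L2 (fun t => w t - psum c n t) /\
    (N2 (fun t => w t - psum c n t)%R <= (2 * pi * e)%:E)%E.
  move=> e0; have [N hN] := bounded_series_tail (fun n => sqmod_ge0 (c n)) hM e0.
  exists N => n Nn.
  apply: (@L2_fatou _ (fun k => psum c (k + n)%N - psum c n)) => [t At|k].
    have := hw t At; rewrite -(cvg_shiftn n) => h; apply: cvg0_le h => k.
    by rewrite sqmod_ge0 /= opprB addrA subrK.
  by rewrite psumB ?leq_addl// (sqn_range D (@circle_exp_ortho R)) hN// leq_addl.
have L2w : L2 w.
  have [N hN] := fat 1 ltr01.
  have := L2_lin 1 (hN N (leqnn N)).1 (L2tP (psum c N)); congr L2.
  by apply/funext => t; rewrite !fctE scale1r subrK.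
exists (mkL2 L2w); split=> //; apply: cvg0_eps => [n|e e0]; first exact: sqn_ge0.
have [N hN] := fat e e0; exists N => n Nn.
by rewrite (sqnC D) -N2_le_sqn; exact: (hN n Nn).2.
Qed.

(** Taylor coefficients of [z -> f (r z)], which are the Fourier coefficients of [dilate f r]. *)
Definition weighted a (r : R) n := a n * (r%:C%C) ^+ n.

Lemma weighted_summable a r : 0 <= r < 1 -> square_summable a ->
  square_summable (weighted a r).
Proof.
move=> /andP[r0 r1] [M hM]; exists M => N; apply: le_trans (hM N).
apply: ler_sum => n _; rewrite /weighted sqmodM sqmodX sqmod_real.
by rewrite ler_piMr ?sqmod_ge0// -exprM exprn_ile1// ltW.
Qed.

Lemma dilate_tends f a r : 0 <= r < 1 -> taylor f a -> square_summable (weighted a r) ->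
  exists W : L2t, L2val W = dilate f r /\ tends L2d (psum (weighted a r)) W.
Proof.
move=> r01 /taylorP fa sa; apply: psum_pointwise_tends => // t At.
have [z [zE fz]] := dilateE t r01; rewrite fz.
rewrite (_ : (fun N => _) =
  (fun N => sqmod (\sum_(0 <= n < N) a n * sval z ^+ n - f z))); first exact: fa.
apply/funext => N; congr (sqmod (_ - _)); rewrite zE (psumE (weighted a r) N t).
by apply: eq_bigr => n _; rewrite /weighted exprMn mulrA.
Qed.

Lemma bernoulli_le (r : R) n : 0 <= r < 1 -> 0 <= 1 - r ^+ n <= n%:R * (1 - r).
Proof.
move=> /andP[r0 r1]; rewrite subr_ge0 exprn_ile1 ?(ltW r1)//=.
elim: n => [|n ih]; first by rewrite expr0 subrr mul0r.
have -> : 1 - r ^+ n.+1 = (1 - r ^+ n) + r ^+ n * (1 - r) by rewrite exprSr; ring.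
rewrite -natr1 mulrDl lerD// mul1r ler_piMl ?subr_ge0 ?(ltW r1)//.
by rewrite exprn_ile1 ?(ltW r1).
Qed.

(** By Parseval the distance is the sum of [|a n|^2 (1 - r^n)^2]. Beyond [N] the coefficients alone
    are small; below [N], Bernoulli's inequality gives at most [K (1 - r)^2]. *)
Lemma dilate_limit f a U e : taylor f a -> square_summable a -> tends L2d (psum a) U ->
  0 < e -> exists2 d : R, 0 < d & forall r (W : L2t), 0 <= r < 1 -> 1 - d <= r ->
  tends L2d (psum (weighted a r)) W -> sqn L2d (W - U) <= e.
Proof.
move=> fa sa aU e0; have D := @L2d_inner R; have ort := @circle_exp_ortho R.
have e20 : 0 < e / 2 by rewrite divr_gt0.
have [M hM] := sa.
have [N hN] := bounded_series_tail (fun n => sqmod_ge0 (a n)) hM e20.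
pose K := \sum_(0 <= n < N) sqmod (a n) * n%:R ^+ 2.
have K0 : 0 <= K by apply: sumr_ge0 => n _; rewrite mulr_ge0 ?sqmod_ge0 ?sqr_ge0.
(* Since [d <= 1], one has [K d^2 <= K d <= e / 2]; the [+ 1] covers [K = 0]. *)
pose d := Num.min 1 (e / (2 * (K + 1))).
have d0 : 0 < d by rewrite lt_min ltr01 divr_gt0// mulr_gt0// ltr_wpDl.
have Kd : K * d ^+ 2 <= e / 2.
  have d1 : d <= 1 by rewrite ge_min lexx.
  have dK : d <= e / (2 * (K + 1)) by rewrite ge_min lexx orbT.
  apply: (@le_trans _ _ (K * (e / (2 * (K + 1))))).
    by rewrite ler_wpM2l// (le_trans _ dK)// expr2 ler_piMr// ltW.
  have -> : K * (e / (2 * (K + 1))) = (e / 2) * (K / (K + 1)).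
    by field; rewrite gt_eqF// ltr_wpDl.
  by rewrite ler_piMr ?(ltW e20)// ler_pdivrMr ?ltr_wpDl// mul1r lerDl.
exists d => // r W r01 dr aW.
pose c n := weighted a r n - a n.
have cE n : sqmod (c n) = sqmod (a n) * (1 - r ^+ n) ^+ 2.
  rewrite /c /weighted.
  have -> : a n * r%:C%C ^+ n - a n = - (a n * (1 - r ^+ n)%:C%C).
    by rewrite rmorphB rmorphXn /=; ring.
  by rewrite sqmodN sqmodM sqmod_real.
have cW : tends L2d (psum c) (W - U).
  have -> : psum c = (fun n => psum (weighted a r) n - psum a n).
    apply/funext => n; rewrite /psum -sumrB; apply: eq_bigr => k _.
    by rewrite scalerBl.
  exact: (tendsB D aW aU).
have := parseval_sqn D ort cW; rewrite -(cvg_shiftn N) => h.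
have /cvg_lim <- // := h; apply: limr_le; first by apply/cvg_ex; eexists; exact: h.
apply: nearW => k /=; rewrite (big_cat_nat (n := N)) ?leq_addl//=.
have -> : e = e / 2 + e / 2 by rewrite -splitr.
apply: lerD.
  apply: le_trans Kd; rewrite /K mulr_suml; apply: ler_sum => n _.
  rewrite cE -mulrA ler_wpM2l ?sqmod_ge0// -exprMn.
  have /andP[b0 b1] := bernoulli_le n r01.
  rewrite ler_pXn2r ?nnegrE ?mulr_ge0 ?(ltW d0)//.
  by apply: le_trans b1 _; rewrite ler_wpM2l// lerBlDr addrC -lerBlDr.
apply: le_trans (hN N (k + N)%N (leqnn _) (leq_addl _ _)).
apply: ler_sum => n _; rewrite cE ler_piMr ?sqmod_ge0//.
have /andP[b0 b1] := bernoulli_le n r01.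
by rewrite exprn_ile1// lerBlDr lerDl exprn_ge0//; case/andP: r01.
Qed.

Definition boundary_limit f (u : R -> C) : Prop :=
  (\int[mu]_(t in A) (sqmod (dilate f r t - u t))%:E)%E @[r --> 1^'-] --> 0%E.

Lemma boundary_limit_near f (u : R -> C) e : boundary_limit f u -> 0 < e ->
  \forall r \near (1 : R)^'-, [/\ 0 <= r < 1, 1 - e <= r &
    (N2 (fun t => dilate f r t - u t)%R <= e%:E)%E].
Proof.
move=> /fine_cvgP[fin cv] e0; near=> r; split.
- by apply/andP; split; [apply: ltW|]; near: r; [exact: nbhs_left_gt|exact: nbhs_left_lt].
- by apply: ltW; near: r; apply: nbhs_left_gt; rewrite gtrBl.
- have fr : (\int[mu]_(t in A) (sqmod (dilate f r t - u t))%:E)%E \is a fin_num.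
    by near: r.
  rewrite /N2 -(fineK fr) lee_fin.
  have : `|0 - fine (\int[mu]_(t in A) (sqmod (dilate f r t - u t))%:E)%E| <= e.
    by near: r; exact: (cvgrPdist_le _ _).1 cv e e0.
  by rewrite sub0r normrN; apply: le_trans; exact: ler_norm.
Unshelve. all: by end_near. Qed.

Lemma boundary_limit_psum f a (U : L2t) : taylor f a -> square_summable a ->
  tends L2d (psum a) U -> boundary_limit f (L2val U).
Proof.
move=> fa sa aU.
have key r : 0 <= r < 1 -> exists W : L2t, tends L2d (psum (weighted a r)) W /\
    (\int[mu]_(t in A) (sqmod (dilate f r t - U t))%:E)%E = (2 * pi * sqn L2d (W - U))%:E.
  move=> r01; have [W [WE aW]] := dilate_tends r01 fa (weighted_summable r01 sa).
  by exists W; split=> //; rewrite -N2_sqn /N2 -WE.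
have near01 : \forall r \near (1 : R)^'-, 0 <= r < 1.
  by near=> r; apply/andP; split; [apply: ltW|]; near: r; [exact: nbhs_left_gt|exact: nbhs_left_lt].
apply/fine_cvgP; split.
  near=> r; have r01 : 0 <= r < 1 by near: r.
  by have [W [_ ->]] := key r r01.
apply/cvgrPdist_le => e e0.
have e20 : 0 < e / (2 * pi) by rewrite divr_gt0// pi2_gt0.
have [d d0 hd] := dilate_limit fa sa aU e20.
near=> r.
have r01 : 0 <= r < 1 by near: r.
have dr : 1 - d <= r by apply: ltW; near: r; apply: nbhs_left_gt; rewrite gtrBl.
have [W [aW WE]] := key r r01.
have WU0 := mulr_ge0 (ltW (pi2_gt0 R)) (sqn_ge0 (@L2d_inner R) (W - U)).
rewrite /= WE /= sub0r normrN (ger0_norm WU0).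
by rewrite mulrC -ler_pdivlMr ?pi2_gt0// (hd r W).
Unshelve. all: by end_near. Qed.

(** [boundary f] is a choice among the radial limits. The L^2 sum [U] of the Taylor coefficients
    shows that there is one, and comparing both with a common dilation puts the chosen one at
    distance 0 from [U]. *)
Lemma boundary_spec f a : taylor f a -> square_summable a ->
  exists B : L2t, [/\ L2val B = boundary f, tends L2d (psum a) B & boundary_limit f (boundary f)].
Proof.
move=> fa sa; have D := @L2d_inner R; have ort := @circle_exp_ortho R.
have [U aU] := L2_complete (psum_cauchy D ort sa).
have [L2b lb] : [set u | L2 u /\ boundary_limit f u] (boundary f).
  by rewrite /boundary; apply: xgetPex; exists (L2val U); split; [exact: L2tP|exact: boundary_limit_psum aU].
exists (mkL2 L2b); split=> //.
have BU : sqn L2d (mkL2 L2b - U) = 0.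
  apply/eqP; rewrite eq_le sqn_ge0// andbT; apply/ler_addgt0Pr => e e0; rewrite add0r.
  have e40 : 0 < e / 4 by rewrite divr_gt0.
  have [d d0 hd] := dilate_limit fa sa aU e40.
  have m0 : 0 < Num.min d (2 * pi * (e / 4)) by rewrite lt_min d0 mulr_gt0// pi2_gt0.
  have [r [r01 dr Nr]] := filter_ex (boundary_limit_near lb m0).
  have [W [WE aW]] := dilate_tends r01 fa (weighted_summable r01 sa).
  have h1 : sqn L2d (W - U) <= e / 4.
    by apply: hd aW => //; apply: le_trans dr; rewrite lerD2l lerN2 ge_min lexx.
  have h2 : sqn L2d (W - mkL2 L2b) <= e / 4.
    rewrite -N2_le_sqn /= WE; apply: le_trans Nr _.
    by rewrite lee_fin ge_min lexx orbT.
  apply: le_trans (sqn_tri D _ _ W) _; rewrite !(sqnC D _ W).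
  by move: h1 h2; move: (sqn _ _) (sqn _ _) => x y; clear; lra.
apply: (tends_le D (x := fun n => 2 * (sqn L2d (psum a n - U) + 0))).
  by move=> n; rewrite -BU; exact: sqn_tri.
by apply: cvg0_twice_sum => //; exact: cvg_cst.
Qed.

End Boundary.

(** * The Hardy space and its multipliers *)

Section GeometricSum.
Local Open Scope classical_set_scope.
Variable R : realType.

Lemma geometric_sum_le (q : R) N : 0 <= q < 1 -> \sum_(0 <= n < N) q ^+ n <= (1 - q)^-1.
Proof.
move=> /andP[q0 q1].
have -> : \sum_(0 <= n < N) q ^+ n = (1 - q ^+ N) / (1 - q).
  elim: N => [|N ih]; first by rewrite big_geq// expr0 subrr mul0r.
  by rewrite big_nat_recr//= ih exprS; field; rewrite subr_eq0 gt_eqF.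
by rewrite ler_piMl ?invr_ge0 ?subr_ge0 ?(ltW q1)// gerBl exprn_ge0.
Qed.

End GeometricSum.

Section HardySpace.
Local Open Scope classical_set_scope.
Variable R : realType.
Local Notation C := R[i].
Local Notation L2t := (L2t R).
Local Notation L2d := (@L2d R).
Local Notation psum := (psum (@circle_exp R)).
Implicit Types (f g : disk R -> C) (a b c : nat -> C).

Lemma H2P f : H2 f <-> exists a, taylor f a /\ square_summable a.
Proof.
split=> -[a [fa sa]]; exists a; split=> //.
  by apply/nneseries_ltyP => // n; exact: sqmod_ge0.
by apply/nneseries_ltyP => // n; exact: sqmod_ge0.
Qed.

Lemma taylor_lin (k : C) f g a b : taylor f a -> taylor g b ->
  taylor (k *: f + g) (fun n => k * a n + b n).
Proof.
move=> /taylorP fa /taylorP gb; apply/taylorP => z.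
pose x N := \sum_(0 <= n < N) a n * sval z ^+ n - f z.
pose y N := \sum_(0 <= n < N) b n * sval z ^+ n - g z.
have h : (fun N => 2 * (sqmod k * sqmod (x N) + sqmod (y N))) @ \oo --> (0 : R).
  apply: (@cvg0_twice_sum R (fun N => sqmod k * sqmod (x N))); last exact: gb.
  by rewrite -[X in _ --> X](mulr0 (sqmod k)); apply: cvgM; [exact: cvg_cst|exact: fa].
apply: (cvg0_le _ h) => N; rewrite sqmod_ge0 /=.
have -> : \sum_(0 <= n < N) (k * a n + b n) * sval z ^+ n - (k *: f + g) z = k * x N + y N.
  rewrite /x /y !fctE mulrBr mulr_sumr addrACA -opprD -big_split /=.
  by congr (_ - _); apply: eq_bigr => n _; rewrite mulrDl mulrA.
by apply: le_trans (sqmodD_le _ _) _; rewrite sqmodM.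
Qed.

Lemma summable_lin (k : C) a b : square_summable a -> square_summable b ->
  square_summable (fun n => k * a n + b n).
Proof.
move=> [M hM] [M' hM']; exists (2 * (sqmod k * M + M')) => N.
apply: (@le_trans _ _ (\sum_(0 <= n < N) 2 * (sqmod k * sqmod (a n) + sqmod (b n)))).
  by apply: ler_sum => n _; apply: le_trans (sqmodD_le _ _) _; rewrite sqmodM.
by rewrite -mulr_sumr big_split /= -mulr_sumr ler_pM2l// lerD// ler_wpM2l ?sqmod_ge0.
Qed.

Lemma summable0 : square_summable (fun=> 0 : C).
Proof. by exists 0 => N; rewrite big1// => n _; exact: sqmod0. Qed.

Lemma taylor0 : taylor (0 : disk R -> C) (fun=> 0).
Proof.
apply/taylorP => z; rewrite (_ : (fun N => _) = fun=> 0); first exact: cvg_cst.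
by apply/funext => N; rewrite big1 ?subr0 ?sqmod0// => n _; rewrite mul0r.
Qed.

Definition H2pred : {pred (disk R -> C)} := fun f => f \in @H2 R.

Lemma H2_submod : submod_closed H2pred.
Proof.
split.
  by apply/mem_set/H2P; exists (fun=> 0); split; [exact: taylor0|exact: summable0].
move=> k f g /set_mem/H2P[a [fa sa]] /set_mem/H2P[b [gb sb]].
apply/mem_set/H2P; exists (fun n => k * a n + b n).
by split; [exact: taylor_lin|exact: summable_lin].
Qed.

HB.instance Definition _ := GRing.isSubmodClosed.Build C (disk R -> C) H2pred H2_submod.

Record H2t := MkH2t { H2val :> disk R -> C; _ : H2val \in H2pred }.
HB.instance Definition _ := [isSub for H2val].
HB.instance Definition _ := [Choice of H2t by <:].
HB.instance Definition _ := [SubChoice_isSubLmodule of H2t by <:].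

Definition mkH2 f (h : H2 f) : H2t := MkH2t (mem_set h).

Lemma H2tP (f : H2t) : H2 (H2val f).
Proof. by case: f => f h; exact: set_mem. Qed.

Lemma H2t_coef (f : H2t) : exists a, taylor (H2val f) a /\ square_summable a.
Proof. exact/H2P/H2tP. Qed.

Lemma H2t_boundary (f : H2t) : L2 (boundary (H2val f)).
Proof.
have [a [fa sa]] := H2t_coef f; have [B [<- _ _]] := boundary_spec fa sa.
exact: L2tP.
Qed.

Definition bd (f : H2t) : L2t := mkL2 (H2t_boundary f).

Lemma bd_tends (f : H2t) a : taylor (H2val f) a -> square_summable a ->
  tends L2d (psum a) (bd f).
Proof.
move=> fa sa; have [B [BE aB _]] := boundary_spec fa sa.
by have -> : bd f = B by apply: val_inj; rewrite /= BE.
Qed.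

Lemma bd_coef (f : H2t) a n : taylor (H2val f) a -> square_summable a ->
  L2d (bd f) (circle_exp R n) = a n.
Proof.
by move=> fa sa; exact: (tends_psum_coef (@L2d_inner R) (@circle_exp_ortho R) _ (bd_tends fa sa)).
Qed.

Definition H2d (f g : H2t) : C := H2_dot (H2val f) (H2val g).

Lemma H2dE (f g : H2t) : H2d f g = L2d (bd f) (bd g).
Proof. by []. Qed.

#[local] Opaque bd.

Lemma psum_lin (k : C) a b :
  psum (fun n => k * a n + b n) = (fun N => k *: psum a N + psum b N).
Proof.
apply/funext => N; rewrite /psum scaler_sumr -big_split /=.
by apply: eq_bigr => n _; rewrite scalerDl scalerA.
Qed.

(** Both sides are limits of the same partial sums. As [boundary] picks representatives
    independently, [bd] is linear only up to seminorm 0, which inner products do not see. *)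
Lemma bd_lin (k : C) (f g : H2t) : sqn L2d (bd (k *: f + g) - (k *: bd f + bd g)) = 0.
Proof.
have D := @L2d_inner R.
have [a [fa sa]] := H2t_coef f; have [b [gb sb]] := H2t_coef g.
have h1 := @bd_tends (k *: f + g) _ (taylor_lin (k := k) fa gb) (summable_lin k sa sb).
have h2 := tendsD D (tendsZ D k (bd_tends fa sa)) (bd_tends gb sb).
by rewrite psum_lin in h1; exact: (tends_dist D h1 h2).
Qed.

Lemma bd_dotl (k : C) (f g : H2t) w :
  L2d (bd (k *: f + g)) w = k * L2d (bd f) w + L2d (bd g) w.
Proof.
have D := @L2d_inner R; apply/eqP; rewrite -subr_eq0 -(dotPl D) -(dotBl D).
by apply/eqP/(sqn_eq0_dot D)/bd_lin.
Qed.

Lemma H2d_inner : inner H2d.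
Proof.
split=> [k f g h|f g|f]; rewrite !H2dE.
- exact: bd_dotl.
- exact: dotJ (@L2d_inner R) _ _.
- exact: dot_ge0 (@L2d_inner R) _.
Qed.

Lemma bdB (f g : H2t) w : L2d (bd (f - g)) w = L2d (bd f) w - L2d (bd g) w.
Proof. by rewrite addrC -scaleN1r bd_dotl mulN1r addrC. Qed.

Lemma bdBr (f g : H2t) w : L2d w (bd (f - g)) = L2d w (bd f) - L2d w (bd g).
Proof.
have D := @L2d_inner R.
rewrite (dotJ D (bd (f - g)) w).
rewrite (bdB f g w).
rewrite rmorphB.
rewrite (dotJ D (bd f) w).
by rewrite (dotJ D (bd g) w).
Qed.

Lemma sqn_bdB (f g : H2t) : sqn H2d (f - g) = sqn L2d (bd f - bd g).
Proof.
have D := @L2d_inner R; rewrite /sqn H2dE.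
rewrite (bdB f g (bd (f - g))) (bdBr f g (bd f)) (bdBr f g (bd g)).
by move: (bd f) (bd g) => u v; rewrite (dotBl D) !(dotBr D).
Qed.

Lemma H2t_ext (f g : H2t) : (forall z, H2val f z = H2val g z) -> f = g.
Proof. by move=> h; apply/val_inj/funext. Qed.

(** The Taylor coefficients are inner products with exponentials, so they vanish with the seminorm,
    and [f] vanishes with them at every point. *)
Lemma H2_definite : definite H2d.
Proof.
move=> f f0; have [a [fa sa]] := H2t_coef f; apply: H2t_ext => z.
have a0 n : a n = 0.
  by rewrite -(bd_coef n fa sa); apply: (sqn_eq0_dot (@L2d_inner R)).
have := (taylorP _ _).1 fa z => h; apply/eqP; rewrite -oppr_eq0; apply/eqP/sqmod_eq0.
apply: (cst_cvg0_eq0 (sqmod_ge0 _) _ h) => N.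
by rewrite big1 ?add0r// => n _; rewrite a0 mul0r.
Qed.

(** The terms [c n z^n] are dominated by [|c n|^2 + |z|^(2n)], so real and imaginary parts converge
    absolutely. *)
Lemma taylor_ex c : square_summable c -> exists f, taylor f c.
Proof.
move=> [M hM].
have lim_ex (z : disk R) : exists l : C,
    (fun N => sqmod (\sum_(0 <= n < N) c n * sval z ^+ n - l)) @ \oo --> (0 : R).
  have z1 := disk_sqmod z; have z0 := sqmod_ge0 (sval z).
  set q := sqmod (sval z) in z1 z0.
  have bnd N : \sum_(0 <= n < N) (sqmod (c n) + q ^+ n) <= M + (1 - q)^-1.
    by rewrite big_split /= lerD// geometric_sum_le// z0.
  have cvR (p : C -> R) : (forall x y, p (x + y) = p x + p y) -> p 0 = 0 ->
      (forall x y, `|p (x * y)| <= sqmod x + sqmod y) ->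
      exists l : R, (fun N => p (\sum_(0 <= n < N) c n * sval z ^+ n)) @ \oo --> l.
    move=> pD p0 pM.
    have /cvg_ex[l hl] : cvgn (series (fun n => p (c n * sval z ^+ n))).
      apply: normed_cvg.
      apply: (@bounded_series_cvg _ (fun k => `|p (c k * sval z ^+ k)|) (M + (1 - q)^-1)) => [k|N].
        exact: normr_ge0.
      apply: le_trans (bnd N); apply: ler_sum => n _.
      by apply: le_trans (pM _ _) _; rewrite sqmodX.
    exists l; rewrite (_ : (fun N => _) = series (fun n => p (c n * sval z ^+ n)))//.
    by apply/funext => N; rewrite (big_morph p pD p0).
  have [lr hr] : exists l : R, (fun N => complex.Re (\sum_(0 <= n < N) c n * sval z ^+ n)) @ \oo --> l.
    by apply: cvR => [x y||x y]; [rewrite cReD|by []|exact: (normReM_le x y).1].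
  have [li hi] : exists l : R, (fun N => complex.Im (\sum_(0 <= n < N) c n * sval z ^+ n)) @ \oo --> l.
    by apply: cvR => [x y||x y]; [rewrite cImD|by []|exact: (normReM_le x y).2].
  exists (lr +i* li)%C; exact: cvg_sqmod.
have [f hf] := choice lim_ex; exists f; apply/taylorP; exact: hf.
Qed.

(** The projection keeps the Fourier coefficients of [u] of nonnegative index, square summable by
    Bessel's inequality. Orthogonality is checked on exponentials and extended by continuity. *)
Lemma projection_ex (u : L2t) : exists h : H2t, forall g : H2t, L2d (u - bd h) (bd g) = 0.
Proof.
have D := @L2d_inner R; have ort := @circle_exp_ortho R.
pose c n := L2d u (circle_exp R n).
have sc : square_summable c by exists (sqn L2d u) => N; exact: bessel.
have [f fc] := taylor_ex sc.
have H2f : H2 f by apply/H2P; exists c.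
exists (mkH2 H2f) => g; have [b [gb sb]] := H2t_coef g.
rewrite (dotJ D); apply/eqP; rewrite conjC_eq0; apply/eqP.
apply: (tends_dot_l D (bd_tends gb sb)) => N.
rewrite (dot_sum_nat D) big1// => n _.
by rewrite (dotJ D) (dotBl D) (@bd_coef (mkH2 H2f) c n fc sc) subrr rmorph0 mulr0.
Qed.

(** The boundary functions converge to some [u] in L^2, and the projection of [u] is the limit
    sought, because projecting does not increase the distance to the elements [f k]. *)
Lemma H2_complete : cauchy_complete H2d.
Proof.
have D := @L2d_inner R; have DH := H2d_inner.
move=> f cf.
have [u hu] : exists u, tends L2d (fun k => bd (f k)) u.
  apply: L2_complete => e /cf[N hN]; exists N => m n Nm Nn.
  by rewrite -sqn_bdB; exact: hN.
have [h hh] := projection_ex u; exists h.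
apply: (tends_le DH _ hu) => k.
have /eqP : H2d (f k - h) (f k - h) = L2d (bd (f k) - u) (bd (f k - h)).
  by rewrite H2dE (bdB (f k) h) -(dotBl D) -[in LHS](subrK u (bd (f k))) -addrA (dotDl D) hh addr0.
set g := f k - h => /eqP gg.
have := cauchy_schwarz D (bd (f k) - u) (bd g); rewrite -gg (dot_sqn DH) sqmod_real.
have -> : sqn L2d (bd g) = sqn H2d g by [].
have := sqn_ge0 DH g; rewrite le_eqVlt => /orP[/eqP <- _|g0]; first exact: sqn_ge0.
by rewrite expr2 ler_pM2r.
Qed.

(** Cauchy-Schwarz against the partial sums of the reproducing kernel at [z]. *)
Lemma point_eval_le (f : H2t) z : sqmod (H2val f z) <= sqn H2d f * (1 - sqmod (sval z))^-1.
Proof.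
have D := @L2d_inner R; have ort := @circle_exp_ortho R.
have [a [fa sa]] := H2t_coef f.
have h := (sqmod_cvg ((taylorP _ _).1 fa z)).
case: h => _ _ h; have /cvg_lim <- // := h.
apply: limr_le; first by apply/cvg_ex; eexists; exact: h.
apply: nearW => N.
pose b n := (sval z ^+ n)^*.
have -> : \sum_(0 <= n < N) a n * sval z ^+ n = L2d (psum a N) (psum b N).
  rewrite (dot_sum_nat D); apply: eq_big_nat => n nN.
  by rewrite (dotJ D) (dot_range_e D ort) nN /b conjCK.
apply: le_trans (cauchy_schwarz D _ _) _.
rewrite !(sqn_range D ort); apply: ler_pM.
- by apply: sumr_ge0 => n _; exact: sqmod_ge0.
- by apply: sumr_ge0 => n _; exact: sqmod_ge0.
- apply: le_trans (bessel D ort (bd f) N); apply: ler_sum => n _.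
  by rewrite (bd_coef n fa sa).
- have z1 := disk_sqmod z; have z0 := sqmod_ge0 (sval z).
  under eq_bigr do rewrite /b sqmodJ sqmodX.
  by apply: geometric_sum_le; rewrite z0.
Qed.

End HardySpace.

(** * Coefficient bounds from pointwise domination *)

Section Multipliers.
Local Open Scope classical_set_scope.
Variable R : realType.
Local Notation C := R[i].
Local Notation A := (@angles R).
Local Notation L2t := (L2t R).
Local Notation L2d := (@L2d R).
Local Notation H2t := (H2t R).
Local Notation H2d := (@H2d R).
Local Notation psum := (psum (@circle_exp R)).
Implicit Types (f g h : disk R -> C) (a d : nat -> C).
#[local] Opaque bd.

Lemma sqn_pointwise_le (U W : L2t) : (forall t, A t -> sqmod (U t) <= sqmod (W t)) ->
  sqn L2d U <= sqn L2d W.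
Proof. by move=> h; rewrite -N2_le_sqn -N2_sqn; apply: N2_le h; exact: L2_measC. Qed.

Lemma tends_psum_sqn_le a (U : L2t) M : tends L2d (psum a) U ->
  (forall N, \sum_(0 <= n < N) sqmod (a n) <= M) -> sqn L2d U <= M.
Proof.
move=> aU hM; have h := parseval_sqn (@L2d_inner R) (@circle_exp_ortho R) aU.
have /cvg_lim <- // := h; apply: limr_le; first by apply/cvg_ex; eexists; exact: h.
exact: nearW.
Qed.

(** Abel's lemma: convergence at a point [p] between [r] and 1 bounds the terms there, and at radius
    [r] they are then dominated by a geometric series. *)
Lemma taylor_weighted_summable h d (r : R) : taylor h d -> 0 <= r < 1 ->
  square_summable (weighted d r).
Proof.
move=> /taylorP hd /andP[r0 r1]; pose p := (1 + r) / 2.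
have p0 : 0 < p by rewrite /p; lra.
have p1 : p < 1 by rewrite /p; lra.
have rp : r < p by rewrite /p; lra.
have hp : `|p%:C%C| < 1 :> C.
  by rewrite -(@expr_lt1 _ 2)// ?normr_ge0// -sqmod_norm ltcR sqmod_real expr_lt1// ltW.
have := hd (exist (fun z : C => is_true (`|z| < 1)) _ hp) => /=.
set l := h _; set s := fun N => \sum_(0 <= n < N) d n * p%:C%C ^+ n => sl.
have [N hN] := cvg0_epsP sl ltr01.
(* From [N] on, a term is the difference of two partial sums whose squared distance to [l] is at
   most 1, so its squared modulus is at most [2 (1 + 1)]; the remaining terms are added in. *)
pose B := 4 + \sum_(0 <= n < N) sqmod (d n * p%:C%C ^+ n).
have B0 : 0 <= B by rewrite addr_ge0// sumr_ge0// => n _; exact: sqmod_ge0.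
have term_le n : sqmod (d n * p%:C%C ^+ n) <= B.
  have [Nn|nN] := leqP N n.
    apply: (@le_trans _ _ 4); last by rewrite lerDl sumr_ge0// => k _; exact: sqmod_ge0.
    have -> : d n * p%:C%C ^+ n = (s n.+1 - l) + - (s n - l).
      by rewrite /s big_nat_recr//=; ring.
    apply: le_trans (sqmodD_le _ _) _; rewrite sqmodN.
    move: (hN n Nn) (hN n.+1 (leq_trans Nn (leqnSn n))); rewrite -/(s n) -/(s n.+1).
    by move: (sqmod _) (sqmod _) => x y; clear; lra.
  rewrite /B (bigD1_seq n) ?mem_index_iota ?iota_uniq//= addrCA lerDl.
  by rewrite addr_ge0// sumr_ge0// => k _; exact: sqmod_ge0.
pose q := (r / p) ^+ 2.
have q01 : 0 <= q < 1.
  rewrite /q sqr_ge0 /= expr_lt1//; last by apply: mulr_ge0 => //; rewrite invr_ge0 ltW.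
  by rewrite ltr_pdivrMr// mul1r.
exists (B * (1 - q)^-1) => M.
apply: (@le_trans _ _ (\sum_(0 <= n < M) B * q ^+ n)); last first.
  by rewrite -mulr_sumr ler_wpM2l// geometric_sum_le.
apply: ler_sum => n _.
have -> : weighted d r n = (d n * p%:C%C ^+ n) * ((r / p)%:C%C) ^+ n.
  rewrite /weighted -mulrA -exprMn -rmorphM; congr (_ * _%:C%C ^+ _).
  by rewrite mulrCA divff ?mulr1// gt_eqF.
rewrite sqmodM sqmodX sqmod_real -/q.
by rewrite ler_wpM2r// exprn_ge0//; case/andP: q01.
Qed.

(** With [N] fixed, [r] goes to 1. Bernoulli's inequality gives [r^(2n) >= 1 - 2 N s] for
    [r = 1 - s], and [s] is taken so small that the loss is at most [e]. *)
Lemma weighted_bound d X : (forall N (r : R), 0 <= r < 1 ->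
    \sum_(0 <= n < N) sqmod (weighted d r n) <= X) ->
  forall N, \sum_(0 <= n < N) sqmod (d n) <= X.
Proof.
move=> h N; apply/ler_addgt0Pr => e e0.
pose S := \sum_(0 <= n < N) sqmod (d n).
have S0 : 0 <= S by apply: sumr_ge0 => n _; exact: sqmod_ge0.
pose K := S * (2 * N%:R) + 1.
have K0 : 0 < K by rewrite ltr_wpDl// mulr_ge0// mulr_ge0.
pose s := Num.min 1 (e / K).
have s0 : 0 < s by rewrite lt_min ltr01 divr_gt0.
have s1 : s <= 1 by rewrite ge_min lexx.
have r01 : 0 <= 1 - s < 1 by rewrite subr_ge0 s1 gtrBl.
have := h N _ r01.
have low : S * (1 - 2 * N%:R * s) <= \sum_(0 <= n < N) sqmod (weighted d (1 - s) n).
  rewrite /S mulr_suml !big_nat; apply: ler_sum => n /andP[_ nN].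
  rewrite /weighted sqmodM sqmodX sqmod_real ler_wpM2l ?sqmod_ge0// -exprM.
  have /andP[_] := bernoulli_le (2 * n)%N r01.
  have -> : 1 - (1 - s) = s by ring.
  rewrite natrM lerBlDr -lerBlDl => hb.
  apply: le_trans hb; rewrite lerD2l lerN2 ler_wpM2r ?(ltW s0)//.
  by rewrite ler_wpM2l// ler_nat ltnW.
move=> /(le_trans low); rewrite mulrBr mulr1 lerBlDr => /le_trans; apply.
rewrite lerD2l mulrA.
have sK : s <= e / K by rewrite ge_min lexx orbT.
apply: (@le_trans _ _ (K * s)); first by rewrite ler_wpM2r ?(ltW s0)// /K lerDl.
by rewrite mulrC -ler_pdivlMr.
Qed.

(** On each circle of radius [r < 1] the domination is pointwise, so Parseval carries it to the
    weighted coefficients. This yields membership in H^2 and norm bounds for products before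
    anything is known about their boundary functions. *)
Lemma coef_mult_le f a h d (M S : R) : 0 <= M -> taylor f a ->
  (forall N, \sum_(0 <= n < N) sqmod (a n) <= S) -> taylor h d ->
  (forall z, sqmod (h z) <= M * sqmod (f z)) ->
  forall N, \sum_(0 <= n < N) sqmod (d n) <= M * S.
Proof.
move=> M0 fa aS hd hM; apply: weighted_bound => N r r01.
have D := @L2d_inner R.
have [W [WE fW]] := dilate_tends r01 fa (taylor_weighted_summable fa r01).
have [Z [ZE hZ]] := dilate_tends r01 hd (taylor_weighted_summable hd r01).
have WS : sqn L2d W <= S.
  apply: (tends_psum_sqn_le fW) => K; apply: le_trans (aS K).
  apply: ler_sum => n _; rewrite /weighted sqmodM sqmodX sqmod_real.
  by case/andP: r01 => r0 r1; rewrite ler_piMr ?sqmod_ge0// -exprM exprn_ile1// ltW.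
have ZW : sqn L2d Z <= M * sqn L2d W.
  have -> : M * sqn L2d W = sqn L2d ((Num.sqrt M)%:C%C *: W).
    by rewrite (sqnZ D) sqmod_real sqr_sqrtr.
  apply: sqn_pointwise_le => t At.
  have -> : ((Num.sqrt M)%:C%C *: W) t = (Num.sqrt M)%:C%C * W t by [].
  rewrite sqmodM sqmod_real sqr_sqrtr// ZE WE.
  by have [z [_ fz]] := dilateE t r01; rewrite !fz.
have bes := bessel D (@circle_exp_ortho R) Z N.
apply: le_trans (_ : sqn L2d Z <= _); last by apply: le_trans ZW _; rewrite ler_wpM2l.
apply: le_trans bes; apply: ler_sum => n _.
by rewrite (tends_psum_coef D (@circle_exp_ortho R) n hZ).
Qed.


End Multipliers.

Lemma big_nat_eq0 (V : nmodType) m n (F : nat -> V) :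
  (forall k, (m <= k < n)%N -> F k = 0) -> \sum_(m <= k < n) F k = 0.
Proof. by move=> h; rewrite big_nat big1. Qed.

(** * Multiplication by bounded analytic functions *)

Section BoundedMultipliers.
Local Open Scope classical_set_scope.
Variable R : realType.
Local Notation C := R[i].
Local Notation L2t := (L2t R).
Local Notation L2d := (@L2d R).
Local Notation H2t := (H2t R).
Local Notation H2d := (@H2d R).
Local Notation psum := (psum (@circle_exp R)).
Implicit Types (f g h : disk R -> C) (a d : nat -> C).
#[local] Opaque bd.

Lemma partial_sums_le_sqn (f : H2t) a N : taylor (H2val f) a -> square_summable a ->
  \sum_(0 <= n < N) sqmod (a n) <= sqn H2d f.
Proof.
move=> fa sa; apply: le_trans (bessel (@L2d_inner R) (@circle_exp_ortho R) (bd f) N).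
by apply: ler_sum => n _; rewrite (bd_coef n fa sa).
Qed.

Lemma mult_summable (f : H2t) h d (M : R) : 0 <= M -> taylor h d ->
  (forall z, sqmod (h z) <= M * sqmod (H2val f z)) -> square_summable d.
Proof.
move=> M0 hd hM; have [a [fa sa]] := H2t_coef f.
exists (M * sqn H2d f); apply: (coef_mult_le M0 fa _ hd hM) => N.
exact: partial_sums_le_sqn.
Qed.

Lemma sqn_mult_le (f h : H2t) (M : R) : 0 <= M ->
  (forall z, sqmod (H2val h z) <= M * sqmod (H2val f z)) -> sqn H2d h <= M * sqn H2d f.
Proof.
move=> M0 hM; have [a [fa sa]] := H2t_coef f; have [d [hd sd]] := H2t_coef h.
apply: (tends_psum_sqn_le (bd_tends hd sd)).
apply: (coef_mult_le M0 fa _ hd hM) => N; exact: partial_sums_le_sqn.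
Qed.

Definition trunc a N n : C := if (n < N)%N then a n else 0.

Definition poly_fun a N : disk R -> C := fun z => \sum_(0 <= n < N) a n * sval z ^+ n.

Lemma taylor_shift f a : taylor f a ->
  taylor (fun z => sval z * f z) (fun n => if n is m.+1 then a m else 0).
Proof.
move=> /taylorP fa; apply/taylorP => z.
rewrite -(cvg_shiftS (fun N => sqmod _)).
have h : (fun N => sqmod (sval z) *
    sqmod (\sum_(0 <= n < N) a n * sval z ^+ n - f z)) @ \oo --> (0 : R).
  by rewrite -[X in _ --> X](mulr0 (sqmod (sval z))); apply: cvgM; [exact: cvg_cst|exact: fa].
rewrite (_ : (fun N => _) = (fun N => sqmod (sval z) *
    sqmod (\sum_(0 <= n < N) a n * sval z ^+ n - f z)))//.
apply/funext => N; rewrite -sqmodM; congr sqmod.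
rewrite big_nat_recl//= mul0r add0r mulrBr mulr_sumr; congr (_ - _).
by apply: eq_bigr => n _; rewrite exprS mulrCA.
Qed.

Lemma taylor_shiftn f a k : taylor f a -> exists d, taylor (fun z => sval z ^+ k * f z) d.
Proof.
move=> fa; elim: k => [|k [d hd]].
  exists a; rewrite (_ : (fun z => _) = f)//.
  by apply/funext => z; rewrite expr0 mul1r.
exists (fun n => if n is m.+1 then d m else 0).
rewrite (_ : (fun z => _) = (fun z => sval z * (sval z ^+ k * f z))); first exact: taylor_shift.
by apply/funext => z; rewrite exprS mulrA.
Qed.

(** Shifts by powers of [z] and linear combinations take the place of a Cauchy product of series. *)
Lemma taylor_mul_poly f d a N : taylor f d -> exists d', taylor (f * poly_fun a N) d'.
Proof.
move=> fd; elim: N => [|N [d' hd']].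
  exists (fun=> 0); rewrite (_ : f * _ = 0); first exact: taylor0.
  by apply/funext => z; rewrite !fctE /poly_fun big_geq// mulr0.
have [e he] := taylor_shiftn N fd.
exists (fun n => a N * e n + d' n).
rewrite (_ : f * _ = a N *: (fun z => sval z ^+ N * f z) + f * poly_fun a N).
  exact: taylor_lin.
apply/funext => z; rewrite !fctE /poly_fun big_nat_recr//= mulrDr addrC; congr (_ + _).
by rewrite /GRing.scale /=; ring.
Qed.

Lemma taylor_poly a N : taylor (poly_fun a N) (trunc a N).
Proof.
apply/taylorP => z; apply: cvg0_eps => [n|e e0]; first exact: sqmod_ge0.
exists N => n Nn; rewrite /poly_fun (big_cat_nat (n := N))//=.
have -> : \sum_(N <= k < n) trunc a N k * sval z ^+ k = 0.
  by apply: big_nat_eq0 => k /andP[Nk _]; rewrite /trunc ltnNge Nk mul0r.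
rewrite addr0 (eq_big_nat _ _ (F2 := fun k => a k * sval z ^+ k)) => [|k /andP[_ kN]].
  by rewrite subrr sqmod0 ltW.
by rewrite /trunc kN.
Qed.

Lemma summable_trunc a N : square_summable (trunc a N).
Proof.
exists (\sum_(0 <= n < N) sqmod (a n)) => M.
have [MN|NM] := leqP M N.
  rewrite [leRHS](big_cat_nat (n := M))//=.
  rewrite ler_wpDr ?sumr_ge0// => [n _|]; first exact: sqmod_ge0.
  apply: ler_sum => n _; rewrite /trunc; case: ifP => // _.
  by rewrite sqmod0 sqmod_ge0.
rewrite (big_cat_nat (n := N)) ?(ltnW NM)//=.
have -> : \sum_(N <= k < M) sqmod (trunc a N k) = 0.
  by apply: big_nat_eq0 => k /andP[Nk _]; rewrite /trunc ltnNge Nk sqmod0.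
rewrite addr0; apply: ler_sum => n _; rewrite /trunc; case: ifP => // _.
by rewrite sqmod0 sqmod_ge0.
Qed.

Lemma H2_poly a N : H2 (poly_fun a N).
Proof. by apply/H2P; exists (trunc a N); split; [exact: taylor_poly|exact: summable_trunc]. Qed.

Definition pol a N : H2t := mkH2 (H2_poly a N).

Lemma pol_tends (f : H2t) a : taylor (H2val f) a -> square_summable a ->
  tends H2d (pol a) f.
Proof.
move=> fa [M hM]; apply: cvg0_eps => [n|e e0]; first exact: (sqn_ge0 (@H2d_inner R)).
have [N hN] := bounded_series_tail (fun n => sqmod_ge0 (a n)) hM e0.
exists N => n Nn; rewrite (sqnC (@H2d_inner R)).
pose d k := -1 * trunc a n k + a k.
have gd : taylor (H2val (f - pol a n)) d.
  rewrite (_ : H2val _ = -1 *: poly_fun a n + H2val f); last by rewrite scaleN1r addrC.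
  by apply: taylor_lin fa; exact: taylor_poly.
have sd : square_summable d.
  by apply: summable_lin; [exact: summable_trunc|exists M].
have dE k : d k = if (k < n)%N then 0 else a k.
  by rewrite /d /trunc; case: ifP; rewrite ?mulN1r ?addNr ?oppr0 ?add0r.
apply: (tends_psum_sqn_le (bd_tends gd sd)) => K.
have [Kn|nK] := leqP K n.
  rewrite big_nat_eq0 ?(ltW e0)// => k /andP[_ kK].
  by rewrite dE (leq_trans kK Kn) sqmod0.
apply: le_trans (hN n K Nn (ltnW nK)).
rewrite (big_cat_nat (n := n)) ?(ltnW nK)//=.
have -> : \sum_(0 <= k < n) sqmod (d k) = 0.
  by apply: big_nat_eq0 => k /andP[_ kn]; rewrite dE kn sqmod0.
rewrite add0r; apply: ler_sum => k _; rewrite dE; case: ifP => // _.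
by rewrite sqmod0 sqmod_ge0.
Qed.

Definition bounded_by (b : disk R -> C) (M : R) :=
  0 <= M /\ forall z, sqmod (b z) <= M.

Lemma Hinf_bounded b : Hinf b -> exists M, bounded_by b M.
Proof.
move=> [_ [M hM]].
have M0 : 0 <= M by apply: le_trans (hM (disk0 R)).
have ME := ge0_complexE M0; set m := complex.Re M in ME.
have m0 : 0 <= m by rewrite ME ler0c in M0.
exists (m ^+ 2); split=> [|z]; first exact: sqr_ge0.
by rewrite -norm_le_sqmod// -ME.
Qed.

(** The products of [b] with the Taylor polynomials of [f] lie in H^2 and form a Cauchy sequence
    because [b] is bounded. Point evaluations are continuous, so their limit is [b f] at every
    point. *)
Theorem mult_H2 b f : Hinf b -> H2 f -> H2 (b * f).
Proof.
move=> hb H2f; have [[d bd'] _] := hb; have [M [M0 bM]] := Hinf_bounded hb.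
pose F := mkH2 H2f; have [a [fa sa]] := H2t_coef F.
have D := @H2d_inner R.
have H2N N : H2 (b * poly_fun a N).
  have [e he] := taylor_mul_poly a N bd'.
  apply/H2P; exists e; split=> //; apply: (@mult_summable (pol a N) _ _ M M0 he) => z.
  by rewrite sqmodM ler_wpM2r ?sqmod_ge0.
pose G N := mkH2 (H2N N).
have GB n m : sqn H2d (G n - G m) <= M * sqn H2d (pol a n - pol a m).
  apply: sqn_mult_le => // z.
  have -> : H2val (G n - G m) z = b z * H2val (pol a n - pol a m) z.
    by rewrite /= !fctE mulrBr.
  by rewrite sqmodM ler_wpM2r ?sqmod_ge0.
have pF : tends H2d (pol a) F := pol_tends fa sa.
have [L GL] : exists L, tends H2d G L.
  apply: H2_complete => e e0.
  have eM : 0 < e / (M + 1) by rewrite divr_gt0// ltr_wpDl.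
  have [N hN] := tends_cauchy D pF eM; exists N => m n Nm Nn.
  apply: le_trans (GB m n) _; apply: (@le_trans _ _ (M * (e / (M + 1)))).
    by rewrite ler_wpM2l// hN.
  rewrite mulrA ler_pdivrMr ?ltr_wpDl// mulrC ler_wpM2l ?(ltW e0)//.
  by rewrite lerDl.
suff -> : b * f = H2val L by exact: H2tP.
apply/funext => z; apply/eqP; rewrite -subr_eq0; apply/eqP/sqmod_eq0.
have z1 := disk_sqmod z.
have h1 : (fun N => sqn H2d (G N - L) * (1 - sqmod (sval z))^-1) @ \oo --> (0 : R).
  by rewrite -[X in _ --> X](mul0r ((1 - sqmod (sval z))^-1)); apply: cvgM => //; exact: cvg_cst.
have h2 : (fun N => M * sqmod (poly_fun a N z - f z)) @ \oo --> (0 : R).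
  rewrite -[X in _ --> X](mulr0 M); apply: cvgM; first exact: cvg_cst.
  exact: ((taylorP _ _).1 fa z).
apply: (cst_cvg0_eq0 (sqmod_ge0 _) _ (cvg0_twice_sum h1 h2)) => N.
have -> : (b * f) z - L z = (G N - L) z + - (b z * (poly_fun a N z - f z)).
  by rewrite /= !fctE; ring.
apply: le_trans (sqmodD_le _ _) _; rewrite ler_pM2l// lerD//.
  exact: point_eval_le.
by rewrite sqmodN sqmodM ler_wpM2r// sqmod_ge0.
Qed.

End BoundedMultipliers.

(** * The boundary function of a product *)

Section BoundaryProducts.
Local Open Scope classical_set_scope.
Variable R : realType.
Local Notation C := R[i].
Local Notation mu := (@lebesgue_measure R).
Local Notation A := (@angles R).
Local Notation mA := (@measurable_angles R).
Local Notation L2t := (L2t R).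
Local Notation L2d := (@L2d R).
Local Notation H2t := (H2t R).
Local Notation H2d := (@H2d R).
Local Notation psum := (psum (@circle_exp R)).
Implicit Types (f g h : disk R -> C).

(** Induction on the list removes one square at a time, so that a pointwise estimate with several
    error terms is integrated in one go. *)
Lemma integral_le_sqn (d : R -> R) (c : R) (s : seq (R * L2t)) :
  measurable_fun A d -> 0 <= c -> (forall i, i \in s -> 0 <= i.1) ->
  (forall t, A t -> 0 <= d t <= c + \sum_(i <- s) i.1 * sqmod (i.2 t)) ->
  (\int[mu]_(t in A) (d t)%:E <= (2 * pi * (c + \sum_(i <- s) i.1 * sqn L2d i.2))%:E)%E.
Proof.
move=> md c0 s0 hd.
have mi (i : R * L2t) : measurable_fun A (fun t => (i.1 * sqmod (i.2 t))%:E).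
  apply/measurable_EFinP; apply: measurable_funM; first exact: measurable_cst.
  exact: (measC_sqmod (L2_measC i.2)).
elim: s c c0 d md s0 hd => [|i s ih] c c0 d md s0 hd;
  have mdE : measurable_fun A (fun t => (d t)%:E) by exact/measurable_EFinP.
  rewrite big_nil addr0 EFinM -mu_angles muleC -integral_cst; last exact: mA.
  apply: ge0_le_integral => //.
  - exact: mA.
  - by move=> t At; rewrite lee_fin; case/andP: (hd t At).
  - by move=> t At; rewrite lee_fin; have := hd t At; rewrite big_nil addr0 => /andP[].
have i0 : 0 <= i.1 by apply: s0; rewrite mem_head.
(* The maximum keeps the remainder nonnegative, as the induction hypothesis demands. *)
pose d' t := Num.max 0 (d t - i.1 * sqmod (i.2 t)).
have md' : measurable_fun A d'.
  apply: measurable_maxr; first exact: measurable_cst.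
  apply: measurable_funB => //.
  apply: measurable_funM; first exact: measurable_cst.
  exact: (measC_sqmod (L2_measC i.2)).
have mdE' : measurable_fun A (fun t => (d' t)%:E) by exact/measurable_EFinP.
have ih' : (\int[mu]_(t in A) (d' t)%:E <= (2 * pi * (c + \sum_(i <- s) i.1 * sqn L2d i.2))%:E)%E.
  apply: ih => // [j js|t At]; first by apply: s0; rewrite inE js orbT.
  rewrite /d' le_max lexx /= ge_max; apply/andP; split.
    by rewrite addr_ge0// big_seq sumr_ge0// => j js; rewrite mulr_ge0 ?sqmod_ge0// s0// inE js orbT.
  by have /andP[_] := hd t At; rewrite big_cons lerBlDl addrCA.
apply: (@le_trans _ _ (\int[mu]_(t in A) ((d' t)%:E + (i.1 * sqmod (i.2 t))%:E))%E).
  have m1 : measurable_fun A (fun t => (d' t)%:E + (i.1 * sqmod (i.2 t))%:E)%E.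
    by apply: emeasurable_funD => //; exact/measurable_EFinP.
  apply: ge0_le_integral => //.
  - exact: mA.
  - by move=> t At; rewrite lee_fin; case/andP: (hd t At).
  - by move=> t At; rewrite -EFinD lee_fin -lerBlDr /d' le_max lexx orbT.
have i1 : (\int[mu]_(t in A) (i.1 * sqmod (i.2 t))%:E = (2 * pi * (i.1 * sqn L2d i.2))%:E)%E.
  have -> : 2 * pi * (i.1 * sqn L2d i.2) = i.1 * (2 * pi * sqn L2d i.2) by ring.
  rewrite EFinM -N2_sqn /N2 -ge0_integralZl//.
  - exact: mA.
  - exact: (measC_sqmodE (L2_measC i.2)).
  - by move=> t _; rewrite lee_fin sqmod_ge0.
rewrite ge0_integralD//.
- rewrite i1 big_cons; apply: le_trans (leeD2r _ ih') _.
  by rewrite -EFinD lee_fin -mulrDr -addrA [_ + i.1 * _]addrC.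
- exact: mA.
- by move=> t _; rewrite lee_fin /d' le_max lexx.
- by move=> t _; rewrite lee_fin mulr_ge0 ?sqmod_ge0.
- exact: mi.
Qed.

Lemma ae_zero (x : R -> C) : measC x ->
  (forall e, 0 < e ->
    (\int[mu]_(t in A) (`|complex.Re (x t)| + `|complex.Im (x t)|)%:E <= e%:E)%E) ->
  {ae mu, forall t, A t -> x t = 0}.
Proof.
move=> [mr mi] hx; pose d t := (`|complex.Re (x t)| + `|complex.Im (x t)|)%:E.
have md : measurable_fun A d.
  by apply/measurable_EFinP; apply: measurable_funD; exact: measurableT_comp.
have int0 : (\int[mu]_(t in A) `|d t| = 0)%E.
  have -> : (\int[mu]_(t in A) `|d t| = \int[mu]_(t in A) d t)%E.
    by apply: eq_integral => t _; rewrite gee0_abs// lee_fin addr_ge0.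
  apply/eqP; rewrite eq_le; apply/andP; split.
    by apply/lee_addgt0Pr => e e0; rewrite add0e; exact: hx.
  by apply: integral_ge0 => t _; rewrite lee_fin addr_ge0.
have /ae_eq_integral_abs h := int0.
have : ae_eq mu A d (cst 0%E) by apply: h => //; exact: mA.
apply: negligibleS => t /=; apply: contra_not => dt At; have := dt At.
rewrite /d /= => -[] /eqP; rewrite paddr_eq0// !normr_eq0 => /andP[/eqP xr /eqP xi].
by apply/eqP; rewrite eq_complex xr xi eqxx.
Qed.

Lemma norm1D_le (z w : C) : `|complex.Re (z + w)| + `|complex.Im (z + w)| <=
  (`|complex.Re z| + `|complex.Im z|) + (`|complex.Re w| + `|complex.Im w|).
Proof. by rewrite cReD cImD addrACA lerD// ler_normD. Qed.

Lemma norm1M_le (z w : C) (s : R) : 0 < s ->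
  `|complex.Re (z * w)| + `|complex.Im (z * w)| <= 2 * (s * sqmod z + s^-1 * sqmod w).
Proof.
move=> s0; have q0 : Num.sqrt s != 0 by rewrite gt_eqF// sqrtr_gt0.
have -> : z * w = ((Num.sqrt s)%:C%C * z) * ((Num.sqrt s)^-1%:C%C * w).
  by rewrite mulrACA -rmorphM divff// mul1r.
have [h1 h2] := normReM_le ((Num.sqrt s)%:C%C * z) ((Num.sqrt s)^-1%:C%C * w).
have := lerD h1 h2; rewrite !sqmodM !sqmod_real exprVn sqr_sqrtr ?(ltW s0)//.
by move: (s * _) (s^-1 * _) => x y; lra.
Qed.

(** Inside the disk the product formula is exact. At radius [r] the difference [u - p q] is a
    combination of the errors [X], [Y], [Z] made in replacing the three functions by their
    dilations. A product of two L^2 functions calls for an L^1 estimate. *)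
Theorem boundary_mult (b f : disk R -> C) : Hinf b -> H2 b -> H2 f -> H2 (b * f) ->
  {ae mu, forall t, A t -> boundary (b * f) t = boundary b t * boundary f t}.
Proof.
move=> hb H2b H2f H2bf; have [M [M0 bM]] := Hinf_bounded hb.
have D := @L2d_inner R.
pose p := bd (mkH2 H2b); pose q := bd (mkH2 H2f); pose u := bd (mkH2 H2bf).
have mx : measC (fun t => u t - p t * q t).
  by apply: measCB; [|apply: measCM]; exact: L2_measC.
have ae0 : {ae mu, forall t, A t -> u t - p t * q t = 0}.
  apply: (ae_zero mx) => e e0.
  (* Products are split with weights [s] and [1 / s], and the errors have squared norm at most
     [s^2]. The total is [2 pi] times [s + 2 s M + s + 2 s + 2 s + 2 s sqn q], that is [K s]. *)
  pose K := 2 * pi * (1 + 2 * M + 2 * sqn L2d q + 5).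
  have K0 : 0 < K.
    by rewrite mulr_gt0 ?pi2_gt0// ltr_wpDl// !addr_ge0// mulr_ge0// sqn_ge0.
  have [s s0 eE] : exists2 s : R, 0 < s & e = K * s.
    by exists (e / K); [rewrite divr_gt0|rewrite mulrC divfK// gt_eqF].
  have m0 : 0 < Num.min 1 (2 * pi * (s ^+ 2)).
    by rewrite lt_min ltr01 mulr_gt0 ?pi2_gt0// exprn_gt0.
  have lim (g : H2t) : boundary_limit (H2val g) (bd g).
    have [a [ga sa]] := H2t_coef g; have [B [BE _ lb]] := boundary_spec ga sa.
    exact: lb.
  have [r [[r01 _ hu] [[_ _ hp] [_ _ hq]]]] :=
    filter_ex (filterI (boundary_limit_near (lim (mkH2 H2bf)) m0)
      (filterI (boundary_limit_near (lim (mkH2 H2b)) m0)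
        (boundary_limit_near (lim (mkH2 H2f)) m0))).
  have dil (g : H2t) : (N2 (fun t => dilate (H2val g) r t - bd g t)%R <=
      (Num.min 1 (2 * pi * s ^+ 2))%:E)%E -> exists W : L2t,
      (forall t, W t = dilate (H2val g) r t - bd g t) /\ sqn L2d W <= s ^+ 2.
    move=> hg; have [a [ga sa]] := H2t_coef g.
    have [W [WE _]] := dilate_tends r01 ga (weighted_summable r01 sa).
    exists (W - bd g); split=> [t|]; first by rewrite -WE.
    rewrite -N2_le_sqn; apply: (@le_trans _ _ (Num.min 1 (2 * pi * s ^+ 2))%:E).
      by apply: le_trans hg; rewrite /N2 -WE.
    by rewrite lee_fin ge_min lexx orbT.
  have [X [XE Xs]] := dil (mkH2 H2bf) hu.
  have [Z [ZE Zs]] := dil (mkH2 H2b) hp.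
  have [Y [YE Ys]] := dil (mkH2 H2f) hq.
  pose l := [:: (s^-1, X); (2 * s^-1, Y); (2 * s^-1, Z); (2 * s, q)].
  have sv0 : 0 <= s^-1 by rewrite invr_ge0 ltW.
  apply: (@le_trans _ _ (2 * pi * ((s + 2 * s * M) + \sum_(i <- l) i.1 * sqn L2d i.2))%:E).
    apply: integral_le_sqn.
    - have [mr mi] := mx.
      by apply: measurable_funD; exact: measurableT_comp.
    - by rewrite addr_ge0 ?(ltW s0)// mulr_ge0// mulr_ge0// ltW.
    - by move=> i; rewrite !inE => /or4P[] /eqP -> /=; rewrite ?sv0 ?mulr_ge0 ?sv0 ?(ltW s0).
    - move=> t At; rewrite addr_ge0//= !big_cons big_nil /= addr0.
      have [z [_ fz]] := dilateE t r01.
      have Xt : X t = b z * f z - u t by rewrite -[b z * f z]/((b * f) z) -(fz (b * f)); exact: XE.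
      have Yt : Y t = f z - q t by rewrite -(fz f); exact: YE.
      have Zt : Z t = b z - p t by rewrite -(fz b); exact: ZE.
      (* The path is [u], [b f], [b q], [p q]: the uniform bound on [b] serves the middle step, and
         the norm of [q] the last. *)
      have -> : u t - p t * q t = - X t + b z * Y t + q t * Z t.
        rewrite Xt Yt Zt; move: (b z) (f z) (u t) (q t) (p t) => ? ? ? ? ?; ring.
      apply: le_trans (norm1D_le _ _) _.
      have h1 := norm1D_le (- X t) (b z * Y t).
      have h2 := normRe_Im_le (X t) s0.
      have h3 := norm1M_le (b z) (Y t) s0.
      have h4 := norm1M_le (q t) (Z t) s0.
      have h5 : s * sqmod (b z) <= s * M by rewrite ler_wpM2l ?(ltW s0).
      rewrite cReN cImN !normrN in h1.
      move: h1 h2 h3 h4 h5; clear.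
      move: (sqmod (X t)) (sqmod (Y t)) (sqmod (Z t)) (sqmod (q t)) (sqmod (b z)) => x y w v o.
      move: `|_| `|_| `|_| `|_| `|_| `|_| `|_| `|_| => a1 a2 a3 a4 a5 a6 a7 a8.
      by move: s^-1 => k; lra.
  rewrite lee_fin !big_cons big_nil /= addr0.
  rewrite eE (_ : K * s = 2 * pi * ((1 + 2 * M + 2 * sqn L2d q + 5) * s)); last by rewrite mulrA.
  rewrite ler_pM2l ?pi2_gt0//.
  have e1 : s^-1 * s ^+ 2 = s by field; rewrite gt_eqF.
  have hX : s^-1 * sqn L2d X <= s by rewrite -[leRHS]e1 ler_wpM2l.
  have hY : s^-1 * sqn L2d Y <= s by rewrite -[leRHS]e1 ler_wpM2l.
  have hZ : s^-1 * sqn L2d Z <= s by rewrite -[leRHS]e1 ler_wpM2l.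
  move: hX hY hZ; rewrite -!(mulrA 2 s^-1); clear.
  move: (s^-1 * sqn _ X) (s^-1 * sqn _ Y) (s^-1 * sqn _ Z) (sqn _ q) => x y z v.
  by lra.
apply: negligibleS ae0 => t /=; apply: contra_not => h At.
by have /eqP := h At; rewrite subr_eq0 => /eqP.
Qed.

End BoundaryProducts.

(** * Toeplitz operators *)

Section Toeplitz.
Local Open Scope classical_set_scope.
Variable R : realType.
Local Notation C := R[i].
Local Notation mu := (@lebesgue_measure R).
Local Notation A := (@angles R).
Local Notation mA := (@measurable_angles R).
Local Notation L2t := (L2t R).
Local Notation L2d := (@L2d R).
Local Notation H2t := (H2t R).
Local Notation H2d := (@H2d R).

Lemma circle_mean_ae (u v : R -> C) : measC u -> measC v ->
  {ae mu, forall t, A t -> u t = v t} -> circle_mean u = circle_mean v.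
Proof.
move=> [ur ui] [vr vi] uv; rewrite /circle_mean /Rintegral.
have key (p : C -> R) : measurable_fun A (fun t => p (u t)) ->
    measurable_fun A (fun t => p (v t)) ->
    (\int[mu]_(t in A) (p (u t))%:E = \int[mu]_(t in A) (p (v t))%:E)%E.
  move=> mpu mpv.
  have mu' : measurable_fun A (fun t => (p (u t))%:E) by exact/measurable_EFinP.
  have mv' : measurable_fun A (fun t => (p (v t))%:E) by exact/measurable_EFinP.
  apply: ae_eq_integral; [exact: mA|exact: mu'|exact: mv'|].
  by apply: negligibleS uv => t /=; apply: contra_not => h At; rewrite /= h.
by rewrite (key (@complex.Re R) ur vr) (key (@complex.Im R) ui vi).
Qed.

Lemma L2_ae (u : R -> C) (v : L2t) : measC u ->
  {ae mu, forall t, A t -> sqmod (u t) = sqmod (v t)} -> L2 u.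
Proof.
move=> mu' uv; apply/L2P; split=> //.
have -> : N2 u = N2 (L2val v).
  have m1 := measC_sqmodE mu'; have m2 := measC_sqmodE (L2_measC v).
  apply: ae_eq_integral; [exact: mA|exact: m1|exact: m2|].
  by apply: negligibleS uv => t /=; apply: contra_not => h At; rewrite /= h.
by have [] := (L2P _).1 (L2tP v).
Qed.

Lemma riesz_projP (u : R -> C) : L2 u -> H2 (riesz_proj u) /\
  forall g, H2 g -> L2_dot (fun t => u t - boundary (riesz_proj u) t) (boundary g) = 0.
Proof.
move=> L2u; have [h hh] := projection_ex (mkL2 L2u).
have : [set h | H2 h /\ forall g, H2 g ->
    L2_dot (fun t => u t - boundary h t) (boundary g) = 0] (riesz_proj u).
  rewrite /riesz_proj; apply: xgetPex; exists (H2val h); split; first exact: H2tP.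
  by move=> g H2g; exact: (hh (mkH2 H2g)).
by [].
Qed.

Lemma riesz_proj_dot (u : L2t) (h g : H2t) :
  H2val h = riesz_proj (L2val u) -> H2d h g = L2d u (bd g).
Proof.
move=> hE; have [_ hg] := riesz_projP (L2tP u).
apply/eqP; rewrite -subr_eq0 -oppr_eq0 opprB; apply/eqP.
rewrite H2dE -(dotBl (@L2d_inner R)) -[RHS](hg _ (H2tP g)).
by rewrite -hE.
Qed.

Lemma H2d_inj (h k : H2t) : (forall g, H2d h g = H2d k g) -> h = k.
Proof.
move=> hk; apply/eqP; rewrite -subr_eq0; apply/eqP/(@H2_definite R).
by rewrite /sqn (dotBl (@H2d_inner R)) hk subrr.
Qed.

Section BoundedSymbol.
Variable b : disk R -> C.
Hypotheses (hb : Hinf b) (H2b : H2 b).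

Definition mulH (f : H2t) : H2t := mkH2 (mult_H2 hb (H2tP f)).

Lemma boundary_mulH (f : H2t) :
  {ae mu, forall t, A t -> bd (mulH f) t = boundary b t * bd f t}.
Proof. exact: (boundary_mult hb H2b (H2tP f) (H2tP (mulH f))). Qed.

Let mb : measC (boundary b).
Proof. exact: (L2_measC (bd (mkH2 H2b))). Qed.

(** Square integrability is inherited from the boundary function of [b f], which is almost
    everywhere this product. The conjugate symbol gives a product of the same modulus. *)
Lemma L2_symbol_mul (f : H2t) : L2 (fun t => boundary b t * boundary (H2val f) t).
Proof.
apply: (@L2_ae _ (bd (mulH f))).
  exact: (measCM mb (L2_measC (bd f))).
apply: negligibleS (boundary_mulH f) => t /=; apply: contra_not => h At.
by rewrite h.
Qed.

Lemma L2_conj_symbol_mul (f : H2t) :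
  L2 (fun t => (boundary b t)^* * boundary (H2val f) t).
Proof.
apply: (@L2_ae _ (bd (mulH f))).
  exact: (measCM (measCJ mb) (L2_measC (bd f))).
apply: negligibleS (boundary_mulH f) => t /=; apply: contra_not => h At.
by rewrite h// !sqmodM sqmodJ.
Qed.

(** For an analytic symbol the product is, up to a null set, already the boundary function of [b f],
    so projecting it returns [b f]. *)
Lemma toeplitz_mul (f : H2t) : toeplitz (boundary b) (H2val f) = H2val (mulH f).
Proof.
have [H2h _] := riesz_projP (L2_symbol_mul f).
have -> : toeplitz (boundary b) (H2val f) = H2val (mkH2 H2h) by [].
congr H2val; apply: H2d_inj => g.
rewrite (@riesz_proj_dot (mkL2 (L2_symbol_mul f)) (mkH2 H2h) g)// H2dE.
apply: circle_mean_ae.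
- exact: (measCM (measCM mb (L2_measC (bd f))) (measCJ (L2_measC (bd g)))).
- exact: (measCM (L2_measC (bd (mulH f))) (measCJ (L2_measC (bd g)))).
apply: negligibleS (boundary_mulH f) => t /=; apply: contra_not => h At.
by rewrite h.
Qed.

Lemma H2_toeplitz_conj (f : H2t) : H2 (toeplitz (fun t => (boundary b t)^*) (H2val f)).
Proof. exact: (riesz_projP (L2_conj_symbol_mul f)).1. Qed.

Definition mulH_adj (f : H2t) : H2t := mkH2 (H2_toeplitz_conj f).

Lemma mulH_adjP (f g : H2t) : H2d (mulH_adj f) g = H2d f (mulH g).
Proof.
have e : H2val (mulH_adj f) = riesz_proj (L2val (mkL2 (L2_conj_symbol_mul f))).
  by [].
rewrite (riesz_proj_dot g e) H2dE.
apply: circle_mean_ae.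
- exact: (measCM (measCM (measCJ mb) (L2_measC (bd f))) (measCJ (L2_measC (bd g)))).
- exact: (measCM (L2_measC (bd f)) (measCJ (L2_measC (bd (mulH g))))).
apply: negligibleS (boundary_mulH g) => t /=; apply: contra_not => h At.
by rewrite h// rmorphM /= mulrAC mulrC mulrA.
Qed.

Lemma mulH_linear (k : C) (f g : H2t) : mulH (k *: f + g) = k *: mulH f + mulH g.
Proof. by apply: H2t_ext => z; rewrite /= !fctE mulrDr; congr (_ + _); rewrite /GRing.scale /= mulrCA. Qed.

Lemma mulH_adj_linear (k : C) (f g : H2t) :
  mulH_adj (k *: f + g) = k *: mulH_adj f + mulH_adj g.
Proof.
apply: H2d_inj => h.
by rewrite (dotPl (@H2d_inner R)) !mulH_adjP (dotPl (@H2d_inner R)).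
Qed.

Lemma mulH_isometry (f g : H2t) :
  {ae mu, forall t, A t -> `|boundary b t| = 1} -> H2d (mulH f) (mulH g) = H2d f g.
Proof.
move=> b1; rewrite !H2dE; apply: circle_mean_ae.
- exact: (measCM (L2_measC (bd (mulH f))) (measCJ (L2_measC (bd (mulH g))))).
- exact: (measCM (L2_measC (bd f)) (measCJ (L2_measC (bd g)))).
have := negligibleU (negligibleU (boundary_mulH f) (boundary_mulH g)) b1.
apply: negligibleS => t /= h; apply: contrapT => nh; apply: h => At.
have hf : bd (mulH f) t = boundary b t * bd f t.
  by apply: contrapT => k; apply: nh; left; left => /(_ At).
have hg : bd (mulH g) t = boundary b t * bd g t.
  by apply: contrapT => k; apply: nh; left; right => /(_ At).
have hb1 : `|boundary b t| = 1.
  by apply: contrapT => k; apply: nh; right => /(_ At).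
suff : bd (mulH f) t * (bd (mulH g) t)^* = bd f t * (bd g t)^* by [].
rewrite hf hg rmorphM /= mulrACA.
have -> : boundary b t * (boundary b t)^* = 1 by rewrite -normCK hb1 expr1n.
by rewrite mul1r.
Qed.

End BoundedSymbol.
End Toeplitz.

(** * Inner functions and the space H(b) *)

Section InnerSymbol.
Local Open Scope classical_set_scope.
Variable R : realType.
Local Notation C := R[i].
Local Notation H2t := (H2t R).
Local Notation H2d := (@H2d R).

Lemma H2_1 : H2 (1 : disk R -> C).
Proof.
have -> : 1 = poly_fun (fun=> 1) 1 :> (disk R -> C).
  by apply/funext => z; rewrite /poly_fun big_nat1 expr0 mulr1.
exact: H2_poly.
Qed.

Lemma Hinf_H2 (b : disk R -> C) : Hinf b -> H2 b.
Proof. by move=> hb; rewrite -[b]mulr1; apply: mult_H2 => //; exact: H2_1. Qed.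

Lemma Hinf_bounded_H2 (b : disk R -> C) M : H2 b -> (forall z, sqmod (b z) <= M) -> Hinf b.
Proof.
move=> /H2P[a [ba _]] hM; split; first by exists a.
have M0 : 0 <= M by apply: le_trans (sqmod_ge0 _) (hM (disk0 R)).
(* [M <= (1 + M)^2], so no square root of [M] is needed to bound the modulus. *)
exists (1 + M)%:C%C => z; rewrite norm_le_sqmod ?addr_ge0//.
apply: le_trans (hM z) _; rewrite sqrrD expr1n mul1r; have := sqr_ge0 M; lra.
Qed.

Variable I : disk R -> C.
Hypothesis inI : inner_function I.

Let hI : Hinf I := inI.1.
Let H2I : H2 I := Hinf_H2 hI.
Let aI : {ae (@lebesgue_measure R), forall t, @angles R t -> `|boundary I t| = 1} := inI.2.

Let T : {linear H2t -> H2t} := HB.pack (mulH hI)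
  (GRing.isLinear.Build _ _ _ _ (mulH hI) (mulH_linear hI)).
Let T' : {linear H2t -> H2t} := HB.pack (mulH_adj hI H2I)
  (GRing.isLinear.Build _ _ _ _ (mulH_adj hI H2I) (mulH_adj_linear hI H2I)).
Let D := @H2d_inner R.

Let adjT u v : H2d (T u) v = H2d u (T' v).
Proof. by rewrite (dotJ D) [RHS](dotJ D) (mulH_adjP hI H2I v u). Qed.

Let isoT u : T' (T u) = u.
Proof.
apply: H2d_inj => g.
exact: (etrans (mulH_adjP hI H2I (T u) g) (mulH_isometry hI H2I u g aI)).
Qed.

Local Notation b := (2^-1 *: (I * (1 + I ^+ 2)) : disk R -> C).

Let half (u v : H2t) : H2t := 2^-1 *: (u + v).

Let b_mul (f : H2t) : b * H2val f = H2val (half (T f) (T (T (T f)))).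
Proof.
apply/funext => z; rewrite expr2 /= !fctE /GRing.scale /=.
by move: (I z) (f z) => i x; ring.
Qed.

Let H2b : H2 b.
Proof.
have -> : b = H2val (half (T (mkH2 H2_1)) (T (T (T (mkH2 H2_1))))).
  by rewrite -b_mul /= mulr1.
exact: H2tP.
Qed.

Let hb : Hinf b.
Proof.
have [M [M0 IM]] := Hinf_bounded hI.
apply: (@Hinf_bounded_H2 _ (M + M * (M * M)) H2b) => z.
have -> : b z = 2^-1 * (I z + I z * (I z * I z)).
  by rewrite expr2 /= !fctE /GRing.scale /=; move: (I z) => i; ring.
rewrite sqmodM.
rewrite sqmod_half.
have h := sqmodD_le (I z) (I z * (I z * I z)); rewrite !sqmodM in h.
have h2 : sqmod (I z) * (sqmod (I z) * sqmod (I z)) <= M * (M * M).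
  by rewrite !ler_pM ?mulr_ge0 ?sqmod_ge0.
have h3 : 0 <= M * (M * M) by rewrite !mulr_ge0.
have h4 := IM z; move: (sqmod (I z + _)) h => x h.
move: (sqmod (I z)) h h2 h4 => i; move: (i * (i * i)) (M * (M * M)) h3 => w v.
by lra.
Qed.

Let Mb' (f : H2t) := half (T' f) (T' (T' (T' f))).

Let mulHbE f : mulH hb f = half (T f) (T (T (T f))).
Proof. by apply/val_inj; exact: b_mul. Qed.

Let mulHb_adjE f : mulH_adj hb H2b f = Mb' f.
Proof.
apply: H2d_inj => g; rewrite (mulH_adjP hb H2b f g) mulHbE /half /Mb'.
have adjT' u v : H2d (T' u) v = H2d u (T v) by exact: mulH_adjP.
rewrite (dotZr D) (dotDr D) (dotZl D) (dotDl D) !adjT'; congr (_ * _).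
exact: half_conj.
Qed.

Let opT (f : disk R -> C) := f - toeplitz (boundary b) (toeplitz (fun t => (boundary b t)^*) f).

Let opT_H2 (f : H2t) : opT (H2val f) = H2val (f - mulH hb (mulH_adj hb H2b f)).
Proof.
rewrite /opT; have -> : toeplitz (fun t => (boundary b t)^*) (H2val f) =
  H2val (mulH_adj hb H2b f) by [].
by rewrite (toeplitz_mul hb H2b).
Qed.

Let sqnT u : sqn H2d (T u) = sqn H2d u.
Proof. by rewrite /sqn adjT isoT. Qed.

Let sqnT' u : sqn H2d (T' u) <= sqn H2d u.
Proof.
have := sqn_ge0 D (u - T (T' u)); rewrite (sqnB D) sqnT.
have -> : complex.Re (H2d u (T (T' u))) = sqn H2d (T' u).
  by rewrite (dotJ D) adjT cReJ.
move: (sqn _ (T' u)) (sqn _ u) => x y; lra.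
Qed.

Let sqn_half u v M : sqn H2d u <= M -> sqn H2d v <= M -> sqn H2d (half u v) <= M.
Proof.
move=> hu hv; rewrite /half (sqnZ D).
rewrite sqmod_half.
have := sqnD_le D u v; move: (sqn _ (u + v)) (sqn _ u) (sqn _ v) hu hv => x y w; lra.
Qed.

Let Mb : {linear H2t -> H2t} := HB.pack (mulH hb)
  (GRing.isLinear.Build _ _ _ _ (mulH hb) (mulH_linear hb)).
Let Mba : {linear H2t -> H2t} := HB.pack (mulH_adj hb H2b)
  (GRing.isLinear.Build _ _ _ _ (mulH_adj hb H2b) (mulH_adj_linear hb H2b)).

Let adjMb u v : H2d (Mba u) v = H2d u (Mb v).
Proof. exact: mulH_adjP. Qed.

Let adjMb' u v : H2d (Mb u) v = H2d u (Mba v).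
Proof. by rewrite (dotJ D) -adjMb -(dotJ D). Qed.

Let sqnMb u : sqn H2d (Mb u) <= sqn H2d u.
Proof.
have -> : Mb u = half (T u) (T (T (T u))) := mulHbE u.
by apply: sqn_half; rewrite ?(sqnT (T _)) sqnT.
Qed.

Let sqnMba u : sqn H2d (Mba u) <= sqn H2d u.
Proof.
have -> : Mba u = half (T' u) (T' (T' (T' u))) := mulHb_adjE u.
apply: sqn_half; first exact: sqnT'.
by apply: le_trans (sqnT' _) _; apply: le_trans (sqnT' _) _; exact: sqnT'.
Qed.

(** Existence guarantees that the choice in [op_sqrt] is a square root and not the default identity
    map. *)
Let positive_sqrt_defect : exists S, positive_operator S /\
  forall f, H2 f -> S (S f) = opT f.
Proof.
pose B : {linear H2t -> H2t} := Mb \o Mba.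
have adjB u v : H2d (B u) v = H2d u (B v).
  exact: (etrans (adjMb' (Mba u) v) (adjMb u (Mba v))).
have contrB u : sqn H2d (B u) <= sqn H2d u.
  exact: le_trans (sqnMb _) (sqnMba _).
have [S [adjS posS bndS sqrS]] :=
  positive_sqrt_ex D (@H2_definite R) (@H2_complete R) adjB contrB.
(* [positive_operator] speaks of maps on all functions of the disk, so [S] is extended by 0 outside
   H^2. *)
pose W (f : disk R -> C) : disk R -> C :=
  if pselect (H2 f) is left h then H2val (S (mkH2 h)) else 0.
have WE (f : H2t) : W (H2val f) = H2val (S f).
  rewrite /W; case: pselect => [h|]; last by move=> /(_ (H2tP f)).
  by congr (H2val (S _)); exact: val_inj.
have WmkE (f : disk R -> C) (h : H2 f) : W f = H2val (S (mkH2 h)).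
  exact: (WE (mkH2 h)).
exists W; split; last first.
  by move=> f h; rewrite (WmkE f h) WE sqrS -(opT_H2 (mkH2 h)).
split; first split.
- by move=> f h; rewrite (WmkE f h); exact: H2tP.
- move=> a f g hf hg; have -> : a *: f + g = H2val (a *: mkH2 hf + mkH2 hg) by [].
  by rewrite WE (WmkE f hf) (WmkE g hg) linearP.
- exists 2 => f h; rewrite (WmkE f h).
  have e4 : 2 ^+ 2 = 4 :> R by ring.
  have := bndS (mkH2 h); rewrite -[in X in X -> _]e4 => hS.
  exact: (nm_le_sqn D (ler0n R 2) hS).
- by move=> f g hf hg; rewrite (WmkE f hf) (WmkE g hg); exact: (adjS (mkH2 hf) (mkH2 hg)).
- by move=> f h; rewrite (WmkE f h); exact: posS.
Qed.

Let defectP : positive_operator (defect b) /\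
  forall f, H2 f -> defect b (defect b f) = opT f.
Proof.
pose Q := [set S : (disk R -> C) -> disk R -> C | positive_operator S /\
  forall f, H2 f -> S (S f) = opT f].
have Qex : exists S, Q S := positive_sqrt_defect.
have h : Q (defect b) by rewrite /defect /op_sqrt -/Q; exact: (xgetPex _ Qex).
exact: h.
Qed.

Let H2_defect (f : H2t) : H2 (defect b (H2val f)).
Proof. by have [[[h _ _] _ _] _] := defectP; exact: h (H2tP f). Qed.

Let Sd (f : H2t) : H2t := mkH2 (H2_defect f).

Let Sd_linear a (f g : H2t) : Sd (a *: f + g) = a *: Sd f + Sd g.
Proof.
have [[[_ h _] _ _] _] := defectP; apply: val_inj.
exact: (h a _ _ (H2tP f) (H2tP g)).
Qed.

Let S : {linear H2t -> H2t} := HB.pack Sd (GRing.isLinear.Build _ _ _ _ Sd Sd_linear).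

Let adjS u v : H2d (S u) v = H2d u (S v).
Proof. by have [[_ h _] _] := defectP; exact: (h _ _ (H2tP u) (H2tP v)). Qed.

Let SS u : S (S u) = u - Mb (Mba u).
Proof.
have [_ h] := defectP; apply: val_inj.
exact: (etrans (h _ (H2tP u)) (opT_H2 u)).
Qed.

Let sqrS u w : H2d (S u) (S w) = H2d u w -
  H2d (2^-1 *: (T' u + T' (T' (T' u)))) (2^-1 *: (T' w + T' (T' (T' w)))).
Proof.
have e1 : H2d (S u) (S w) = H2d u (w - Mb (Mba w)) by rewrite -(SS w); exact: adjS.
have e2 : H2d u (Mb (Mba w)) = H2d (Mba u) (Mba w) := esym (adjMb u (Mba w)).
have eM x : Mba x = 2^-1 *: (T' x + T' (T' (T' x))) := mulHb_adjE x.
by rewrite e1 (dotBr D) e2 -(eM u) -(eM w).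
Qed.

(** Orthogonality to [I H^2] says that the adjoint of multiplication by [I], applied to [h], pairs
    to 0 with all of H^2. *)
Let model_spaceP (h : disk R -> C) : model_space I h <->
  exists k : H2t, H2val k = h /\ T' k = 0.
Proof.
split=> [[H2h hI0]|[k [<- k0]]].
  exists (mkH2 H2h); split=> //; apply: H2d_inj => g; rewrite (dot0l D).
  by rewrite [LHS](mulH_adjP hI H2I); exact: hI0 (H2tP g).
split; first exact: H2tP.
move=> g hg; have e := mulH_adjP hI H2I k (mkH2 hg).
apply: (etrans (esym e)).
by rewrite -[mulH_adj _ _ _]/(T' k) k0 (dot0l D).
Qed.

Let mulXE (f : H2t) : H2val (mulX T f) = (1 - I ^+ 2) * H2val f.
Proof.
apply/funext => z; rewrite expr2 /= !fctE.
by move: (I z) (f z) => i x; ring.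
Qed.

Let two_fun : 2 = (fun=> 2) :> (disk R -> C).
Proof. by apply/funext => z; rewrite mulr2n fctE -mulr2n. Qed.

Let mulYE (f : H2t) : H2val (mulY T f) = (2 - I) * (1 - I) * H2val f.
Proof.
apply/funext => z; rewrite two_fun /= !fctE /GRing.scale /=.
by move: (I z) (f z) => i x; ring.
Qed.

Let mulZE (f : H2t) : H2val (mulZ T f) = (2 + I + I ^+ 2) * H2val f.
Proof.
apply/funext => z; rewrite two_fun expr2 /= !fctE /GRing.scale /=.
by move: (I z) (f z) => i x; ring.
Qed.

(** As soon as one lift is known, the choice made by [dBR_lift] is a lift too, not the default 0. *)
Let dBR_liftP (u f : H2t) : is_lift H2d S u f ->
  exists k, H2val k = dBR_lift b (H2val u) /\ is_lift H2d S u k.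
Proof.
move=> [fk Sf].
pose Q := [set f : disk R -> C | [/\ H2 f, forall g, H2 g -> defect b g = 0 -> H2_dot f g = 0 &
  defect b f = H2val u]].
have Qex : exists f, Q f.
  exists (H2val f); split; first exact: H2tP.
  - move=> g hg g0; apply: (fk (mkH2 hg)); exact: val_inj.
  - exact: (congr1 (@H2val R) Sf).
have [h1 h2 h3] : Q (dBR_lift b (H2val u)) by rewrite /dBR_lift -/Q; exact: (xgetPex _ Qex).
exists (mkH2 h1); split; first exact: erefl.
split; last by apply: val_inj; exact: h3.
by move=> k Sk; apply: (h2 _ (H2tP k)); exact: (congr1 (@H2val R) Sk).
Qed.

Let liftX (x : H2t) : exists f, is_lift H2d S (mulX T x) f.
Proof.
have [f [_ [h _]]] := lift_mulX D (@H2_definite R) (@H2_complete R) adjT isoT adjS sqrS x.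
by exists f.
Qed.

Let liftY (x : H2t) : T' x = 0 -> exists f, is_lift H2d S (mulY T x) f.
Proof.
move=> Tx.
have [f [_ [h _]]] := lift_mulY D (@H2_definite R) (@H2_complete R) adjT isoT adjS sqrS Tx.
by exists f.
Qed.

Let liftZ (x : H2t) : T' x = 0 -> exists f, is_lift H2d S (mulZ T x) f.
Proof.
move=> Tx.
have [f [_ [h _]]] := lift_mulZ D (@H2_definite R) (@H2_complete R) adjT isoT adjS sqrS Tx.
by exists f.
Qed.

Let lift_range (u f : H2t) : is_lift H2d S u f -> dBR_space b (H2val u).
Proof.
move=> [_ Sf]; exists (H2val f); first exact: H2tP.
exact: (congr1 (@H2val R) Sf).
Qed.

Let dBR_dot_lift (u v f g : H2t) : is_lift H2d S u f -> is_lift H2d S v g ->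
  exists f' g', [/\ is_lift H2d S u f', is_lift H2d S v g' &
    dBR_dot b (H2val u) (H2val v) = H2d f' g'].
Proof.
move=> /dBR_liftP[k [ke kl]] /dBR_liftP[k' [ke' kl']].
exists k, k'; split; [exact: kl|exact: kl'|].
by rewrite /dBR_dot -ke -ke'; exact: erefl.
Qed.

Let orth := lift_orthogonal D (@H2_definite R) (@H2_complete R) adjT isoT adjS sqrS.

Lemma inner_dBR_decomposition : orthogonal_sum3 (dBR_dot b) (dBR_space b)
  (mulset (1 - I ^+ 2) (@H2 R))
  (mulset ((2 - I) * (1 - I)) (model_space I))
  (mulset (2 + I + I ^+ 2) (model_space I)).
Proof.
have T0 : T' 0 = 0 by exact: linear0.
have subX : mulset (1 - I ^+ 2) (@H2 R) `<=` dBR_space b.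
  move=> _ [h H2h <-]; rewrite -(mulXE (mkH2 H2h)).
  by have [f hf] := liftX (mkH2 H2h); exact: lift_range hf.
have subY : mulset ((2 - I) * (1 - I)) (model_space I) `<=` dBR_space b.
  move=> _ [h /model_spaceP[k [<- Tk]] <-]; rewrite -mulYE.
  by have [f hf] := liftY Tk; exact: lift_range hf.
have subZ : mulset (2 + I + I ^+ 2) (model_space I) `<=` dBR_space b.
  move=> _ [h /model_spaceP[k [<- Tk]] <-]; rewrite -mulZE.
  by have [f hf] := liftZ Tk; exact: lift_range hf.
split; first by split; [exact: subX|exact: subY|exact: subZ].
- apply/seteqP; split=> [w [f H2f <-]|w [x [y [z [hx hy hz ->]]]]].
    have [x [y [z [Ty Tz e]]]] :=
      range_sub_sum D (@H2_definite R) (@H2_complete R) adjT isoT adjS sqrS (mkH2 H2f).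
    exists (H2val (mulX T x)), (H2val (mulY T y)), (H2val (mulZ T z)); split.
    + exists (H2val x); [exact: H2tP|exact: (esym (mulXE x))].
    + exists (H2val y); last exact: (esym (mulYE y)).
      by apply/model_spaceP; exists y; split; [exact: erefl|exact: Ty].
    + exists (H2val z); last exact: (esym (mulZE z)).
      by apply/model_spaceP; exists z; split; [exact: erefl|exact: Tz].
    + exact: (congr1 (@H2val R) e).
  have [fx Hx <-] := subX _ hx; have [fy Hy <-] := subY _ hy; have [fz Hz <-] := subZ _ hz.
  exists (H2val (mkH2 Hx + mkH2 Hy + mkH2 Hz)); first exact: H2tP.
  have e : S (mkH2 Hx + mkH2 Hy + mkH2 Hz) = S (mkH2 Hx) + S (mkH2 Hy) + S (mkH2 Hz).
    by rewrite !linearD.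
  exact: (congr1 (@H2val R) e).
(* [lift_orthogonal] takes lifts from all three summands at once; when only two are compared, a lift
   of the image of 0 fills the third place. *)
- have [fz0 lz0] := liftZ T0; have [fy0 ly0] := liftY T0; have [fx0 lx0] := liftX 0.
  split.
  + move=> _ _ [x H2x <-] [_ /model_spaceP[k [<- Tk]] <-].
    have [f lf] := liftX (mkH2 H2x); have [g lg] := liftY Tk.
    have [f' [g' [lf' lg']]] := dBR_dot_lift lf lg; rewrite mulXE mulYE => ->.
    by have [h _ _] := orth Tk T0 lf' lg' lz0.
  + move=> _ _ [x H2x <-] [_ /model_spaceP[k [<- Tk]] <-].
    have [f lf] := liftX (mkH2 H2x); have [g lg] := liftZ Tk.
    have [f' [g' [lf' lg']]] := dBR_dot_lift lf lg; rewrite mulXE mulZE => ->.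
    by have [_ h _] := orth T0 Tk lf' ly0 lg'.
  + move=> _ _ [_ /model_spaceP[k [<- Tk]] <-] [_ /model_spaceP[l [<- Tl]] <-].
    have [f lf] := liftY Tk; have [g lg] := liftZ Tl.
    have [f' [g' [lf' lg']]] := dBR_dot_lift lf lg; rewrite mulYE mulZE => ->.
    by have [_ _ h] := orth Tk Tl lx0 lf' lg'.
Qed.

End InnerSymbol.

Theorem theorem2 (R : realType) (I : disk R -> R[i]) :
  inner_function I ->
  I (disk0 R) = 0 ->
  let b : disk R -> R[i] := 2^-1 *: (I * (1 + I ^+ 2)) in
  orthogonal_sum3 (dBR_dot b) (dBR_space b)
    (mulset (1 - I ^+ 2) (@H2 R))
    (mulset ((2 - I) * (1 - I)) (model_space I))
    (mulset (2 + I + I ^+ 2) (model_space I)).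
Proof. by move=> inI _; exact: inner_dBR_decomposition. Qed.
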